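(* Let $p\in(0,\infty)$, let $\phi_0\in\mathrm{Cvx}(\mathbb{R}^n)$, and let $\phi(t,x)$ be the solution with $\phi(0,\cdot)=\phi_0$ of $$\partial_t\phi=\Delta\phi-|D\phi|^2+\langle x,D\phi\rangle-n .$$ Write $\phi=\phi(t,\cdot)$ and $\phi^{*,p}=\phi^{*,p}(t,\cdot)=(\phi(t,\cdot))^{*,p}$. Then for every $t>0$, $$\partial_t\mathcal{M}_p(\phi)=\frac{p\,\mathcal{M}_p(\phi)}{p+1}\left(\frac1p\int_{\mathbb{R}^n}I(d\phi^{p,y})\frac{e^{-\phi^{*,p}(t,y)}\,dy}{V(\phi^{*,p})}-\mathrm{tr}\,\mathrm{Cov}(\phi^{*,p})-|b(\phi^{*,p})|^2\right).$$
   Context: For $f:\mathbb{R}^n\to\mathbb{R}\cup\{\infty\}$ let $V(f)=\int_{\mathbb{R}^n}e^{-f(x)}\,dx$ (with $e^{-\infty}=0$). $\mathrm{Cvx}(\mathbb{R}^n)$ is the set of proper, convex, lower semi-continuous functions $\phi:\mathbb{R}^n\to\mathbb{R}\cup\{\infty\}$ with $0<V(\phi)<\infty$. For $f$ with $0<V(f)<\infty$, the $L^p$-Legendre transform is $$f^{*,p}(y)=\frac1p\log\int_{\mathbb{R}^n}e^{p(\langle x,y\rangle-f(x))}\frac{e^{-f(x)}\,dx}{V(f)},$$ and $\mathcal{M}_p(f)=V(f)V(f^{*,p})$. The solution considered is $$\phi(t,x)=-\log\int_{\mathbb{R}^n}e^{-\frac{|x-e^{-t}y|^2}{2(1-e^{-2t})}}\frac{e^{-\phi_0(y)}\,dy}{(2\pi(1-e^{-2t}))^{n/2}},\qquad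 t>0.$$ For $\phi=\phi(t,\cdot)$ and $y$ with $\phi^{*,p}(t,y)<\infty$, $d\phi^{p,y}$ is the probability measure $$d\phi^{p,y}(x)=\frac{e^{p\langle x,y\rangle-(p+1)\phi(x)}\,dx}{\int_{\mathbb{R}^n}e^{p\langle z,y\rangle-(p+1)\phi(z)}\,dz};$$ the integral over $y$ is over $\{\phi^{*,p}(t,\cdot)<\infty\}$, since $e^{-\phi^{*,p}}=0$ elsewhere. The Fisher information of a probability measure $\mu=f(x)\,dx$ is $I(\mu)=\int_{\mathbb{R}^n}|D\log f(x)|^2f(x)\,dx$. For a function $f$ with $0<V(f)<\infty$, $b(f)=\int x\,\frac{e^{-f(x)}dx}{V(f)}$ and $\mathrm{Cov}(f)$ is the covariance matrix of the probability measure $\frac{e^{-f(x)}dx}{V(f)}$, i.e. the matrix with entries $\int x_ix_j\,d\mu-\int x_i\,d\mu\int x_j\,d\mu$ for $\mu=\frac{e^{-f(x)}dx}{V(f)}$. *)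

(* Defs.v *)
From HB Require Import structures.
From mathcomp Require Import all_boot all_order all_algebra.
From mathcomp Require Import all_classical all_reals all_analysis.

Set Implicit Arguments.
Unset Strict Implicit.
Unset Printing Implicit Defensive.

Import Order.TTheory GRing.Theory Num.Theory.
Import numFieldNormedType.Exports.

Local Open Scope classical_set_scope.
Local Open Scope ring_scope.

(* ['rV[R]_n] carries the product (= Borel) sigma-algebra, generated by the
   coordinates, in the same way as [n.-tuple R] in MathComp-Analysis. *)
Definition rV_display : measure_display.
Proof. exact: default_measure_display. Qed.

Section measurable_rV.
Context {R : realType}.
Variable n : nat.

Let coors : 'I_n -> 'rV[R]_n -> measurableTypeR R := fun i x => x 0 i.

Let rV_set0 : g_sigma_preimage coors set0.
Proof. exact: sigma_algebra0. Qed.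

Let rV_setC A : g_sigma_preimage coors A -> g_sigma_preimage coors (~` A).
Proof. exact: sigma_algebraC. Qed.

Let rV_bigcup (F : _^nat) : (forall i, g_sigma_preimage coors (F i)) ->
  g_sigma_preimage coors (\bigcup_i (F i)).
Proof. exact: sigma_algebra_bigcup. Qed.

HB.instance Definition _ := @isMeasurable.Build rV_display
  'rV[R]_n (g_sigma_preimage coors) rV_set0 rV_setC rV_bigcup.

End measurable_rV.

Lemma measurable_coord (R : realType) n (i : 'I_n) :
  measurable_fun [set: 'rV[R]_n] (fun x : 'rV[R]_n => x 0 i : measurableTypeR R).
Proof.
move=> _ Y mY; rewrite setTI; apply: sub_sigma_algebra => /=.
rewrite -bigcup_seq/=; exists i => /=; first by rewrite mem_index_enum.
by exists Y => //; rewrite setTI.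
Qed.

Lemma measurable_fun_coordP d (T : measurableType d) (R : realType) n
    (f : T -> 'rV[R]_n) :
  measurable_fun [set: T] f <->
  forall i, measurable_fun [set: T] (fun t => f t 0 i : measurableTypeR R).
Proof.
split=> [mf i|mf].
  exact: (measurableT_comp (measurable_coord i) mf).
have prefS : g_sigma_preimage (fun i t => f t 0 i : measurableTypeR R) `<=` measurable.
  apply: smallest_sub; first exact: sigma_algebra_measurable.
  case: n => [|n] in f mf *; first by rewrite big_ord0.
  rewrite -bigcup_mkord_ord; apply: bigcup_sub => i Ii.
  by move=> A [B mB <-]; exact: mf.
move=> _ A mA; apply: prefS.
by rewrite (g_sigma_preimage_comp (fun (i : 'I_n) (x : 'rV[R]_n) => x 0 i : measurableTypeR R) f);
  exists A.
Qed.

(* The identification R * R^n = R^(1 + n) along which the Lebesgue measure is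
   built by recursion on the dimension. *)
Definition rV_cons (R : realType) n (z : measurableTypeR R * 'rV[R]_n) : 'rV[R]_n.+1 :=
  \row_i oapp (z.2 0) z.1 (unlift ord0 i).

Definition rV_uncons (R : realType) n (x : 'rV[R]_n.+1) : measurableTypeR R * 'rV[R]_n :=
  (x 0 ord0, \row_j x 0 (lift ord0 j)).

Lemma rV_consK (R : realType) n : cancel (@rV_cons R n) (@rV_uncons R n).
Proof.
move=> [a v]; rewrite /rV_uncons /rV_cons mxE unlift_none/=; congr pair.
by apply/rowP => j; rewrite !mxE liftK.
Qed.

Lemma rV_unconsK (R : realType) n : cancel (@rV_uncons R n) (@rV_cons R n).
Proof.
move=> x; apply/rowP => i; rewrite mxE.
by case: unliftP => [j ->|->]//=; rewrite mxE.
Qed.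

Lemma measurable_rV_cons (R : realType) n :
  measurable_fun [set: measurableTypeR R * 'rV[R]_n] (@rV_cons R n).
Proof.
apply/measurable_fun_coordP => i; rewrite /rV_cons.
under eq_fun do rewrite mxE.
case: unliftP => [j _|_]/=; last exact: measurable_fst.
exact: (measurableT_comp (measurable_coord j) measurable_snd).
Qed.

Lemma measurable_rV_uncons (R : realType) n :
  measurable_fun [set: 'rV[R]_n.+1] (@rV_uncons R n).
Proof.
apply/measurable_fun_pairP; split; first exact: measurable_coord.
apply/measurable_fun_coordP => j; rewrite /rV_uncons /comp/=.
by under eq_fun do rewrite mxE; exact: measurable_coord.
Qed.

Section lebesgue_step.
Local Open Scope ereal_scope.
Context {R : realType} {n : nat}.
Variable mu : {sigma_finite_measure set 'rV[R]_n -> \bar R}.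

Definition lebesgue_step : set 'rV[R]_n.+1 -> \bar R :=
  pushforward (lebesgue_measure \x mu) (@rV_cons R n).

Let m : {measure set 'rV[R]_n.+1 -> \bar R} :=
  measure_function_pushforward__canonical__measure_function_Measure
    (lebesgue_measure \x mu) (@measurable_rV_cons R n).

Let step0 : lebesgue_step set0 = 0.
Proof. exact: (measure0 m). Qed.

Let step_ge0 A : 0 <= lebesgue_step A.
Proof. exact: (measure_ge0 m). Qed.

Let step_sigma_additive : semi_sigma_additive lebesgue_step.
Proof. exact: (@measure_semi_sigma_additive _ _ _ m). Qed.

HB.instance Definition _ := isMeasure.Build _ _ _ lebesgue_step
  step0 step_ge0 step_sigma_additive.

Let step_sigma_finite : sigma_finite setT lebesgue_step.
Proof.
have /sigma_finiteP[F [TF ndF Foo]] := sigma_finiteT (@lebesgue_measure R).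
have /sigma_finiteP[G [TG ndG Goo]] := sigma_finiteT mu.
exists (fun k => @rV_uncons R n @^-1` (F k `*` G k)).
  rewrite -preimage_bigcup (_ : \bigcup_k _ = setT) ?preimage_setT//.
  rewrite -subTset -setXTT TF TG => -[x y] /= [[k _ Fx] [l _ Gy]].
  exists (maxn k l) => //; split => /=.
  - by move: x Fx; exact/subsetPset/ndF/leq_maxl.
  - by move: y Gy; exact/subsetPset/ndG/leq_maxr.
move=> k; have [mF Fk] := Foo k; have [mG Gk] := Goo k; split.
  rewrite -[X in measurable X]setTI; apply: measurable_rV_uncons => //.
  exact: measurableX.
rewrite /lebesgue_step /pushforward -comp_preimage.
rewrite (_ : _ \o _ = idfun); last by apply/funext => z; exact: rV_consK.
by rewrite preimage_id product_measure1E// lte_mul_pinfty// ge0_fin_numE.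
Qed.

HB.instance Definition _ := Measure_isSigmaFinite.Build _ _ _ lebesgue_step
  step_sigma_finite.

End lebesgue_step.

Fixpoint lebesgue_rV {R : realType} (n : nat) :
    {sigma_finite_measure set 'rV[R]_n -> \bar R} :=
  match n with
  | 0 => dirac (0 : 'rV[R]_0)
  | n'.+1 => lebesgue_step (lebesgue_rV n')
  end.

Lemma lebesgue_rV_box (R : realType) n (A : 'I_n -> set R) :
  (forall i, measurable (A i)) ->
  lebesgue_rV n [set x : 'rV[R]_n | forall i, A i (x 0 i)] =
  (\prod_(i < n) lebesgue_measure (A i))%E.
Proof.
elim: n A => [|n IHn] A mA.
  by rewrite big_ord0 /= diracE mem_set// => -[].
rewrite big_ord_recl -IHn//.
have mB : measurable [set x : 'rV[R]_n | forall i, A (lift ord0 i) (x 0 i)].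
  rewrite (_ : [set x | _] = \bigcap_(i in [set: 'I_n])
    ((fun x : 'rV[R]_n => x 0 i) @^-1` A (lift ord0 i))); last first.
    by apply/seteqP; split=> x /= Ax i => [_|]; exact: Ax.
  apply: fin_bigcap_measurable => // i _.
  by rewrite -[X in measurable X]setTI; apply: measurable_coord => //; exact: mA.
have mA0 : measurable (A ord0) by exact: mA.
rewrite /= /lebesgue_step /pushforward -product_measure1E//.
congr (_ \x _)%E; apply/seteqP; split=> -[a v] /=.
  move=> Ax; split=> [|i].
    by have := Ax ord0; rewrite /rV_cons mxE unlift_none.
  by have := Ax (lift ord0 i); rewrite /rV_cons mxE liftK.
by move=> [Aa Av] i; rewrite /rV_cons mxE; case: unliftP => [j ->|->]//=.
Qed.

Section euclidean.
Context {R : realType} {n : nat}.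
Implicit Types x y : 'rV[R]_n.

Definition dot x y : R := \sum_(i < n) x 0 i * y 0 i.

(* Squared Euclidean norm; the library's norm on ['rV[R]_n] is the sup norm. *)
Definition sqnorm x : R := dot x x.

Definition grad (h : 'rV[R]_n -> R) x : 'rV[R]_n :=
  \row_i 'D_(delta_mx 0 i) h x.

End euclidean.

Section functionals.
Local Open Scope ereal_scope.
Context {R : realType} {n : nat}.
Local Notation mu := (lebesgue_rV n).
Implicit Types f phi : 'rV[R]_n -> \bar R.

Definition V f : \bar R := \int[mu]_x expeR (- f x).

Definition pos_finite_V f : Prop := 0 < V f /\ V f < +oo.

Definition proper_fun f : Prop :=
  (forall x, -oo < f x) /\ (exists x, f x < +oo).

(* In MathComp-Analysis 0 * +oo = 0, so the inequality is trivial for l = 0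
   and l = 1. *)
Definition convex_fun f : Prop :=
  forall (x y : 'rV[R]_n) (l : R), (0 <= l <= 1)%R ->
    f (l *: x + (1 - l) *: y)%R <= l%:E * f x + (1 - l)%:E * f y.

Definition Cvx : set ('rV[R]_n -> \bar R) :=
  [set phi | [/\ proper_fun phi, convex_fun phi, lower_semicontinuous phi &
                 pos_finite_V phi]].

(* Density of the probability measure e^{-f(x)} dx / V(f). *)
Definition gibbs f (x : 'rV[R]_n) : \bar R := expeR (- f x) / V f.

Definition barycenter f : 'rV[R]_n :=
  (\row_i fine (\int[mu]_x ((x 0 i)%:E * gibbs f x)))%R.

Definition Cov f : 'M[R]_n :=
  (\matrix_(i, j) (fine (\int[mu]_x ((x 0 i * x 0 j)%:E * gibbs f x))
                   - barycenter f 0 i * barycenter f 0 j))%R.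

(* [barycenter f] and [Cov f] are only meaningful, [fine] being 0 on infinite
   values, when the second moment is finite. *)
Definition finite_second_moment f : Prop :=
  \int[mu]_x ((sqnorm x)%:E * gibbs f x) < +oo.

Definition lp_legendre (p : R) f (y : 'rV[R]_n) : \bar R :=
  (p^-1)%:E *
  lne (\int[mu]_x (expeR (p%:E * ((dot x y)%:E - f x)) * gibbs f x)).

Definition Mp (p : R) f : \bar R := V f * V (lp_legendre p f).

(* The paper's explicit solution of
     d_t phi = Laplacian phi - |D phi|^2 + <x, D phi> - n,  phi(0, .) = phi0. *)
Definition fokker_planck (phi0 : 'rV[R]_n -> \bar R) (t : R)
    (x : 'rV[R]_n) : \bar R :=
  if (0 < t)%R then
    let s := (1 - expR (- (2 * t)))%R in
    - lne (\int[mu]_y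
        ((expR (- (sqnorm (x - expR (- t) *: y) / (2 * s))))%:E *
         (expeR (- phi0 y) / ((2 * pi * s) `^ (n%:R / 2))%:E)))
  else phi0 x.

(* Density of the probability measure d phi^{p,y}. *)
Definition tilted (p : R) phi (y x : 'rV[R]_n) : R :=
  let w z := expeR ((p * dot z y)%:E - (p + 1)%:E * phi z) in
  fine (w x / \int[mu]_z w z).

(* Fisher information of the probability measure of density g. *)
Definition fisher (g : 'rV[R]_n -> R) : \bar R :=
  \int[mu]_x (sqnorm (grad (fun z => ln (g z)) x) * g x)%:E.

End functionals.

(* Main.v *)
Require Import Defs.
From mathcomp Require Import all_boot all_order all_algebra.
From mathcomp Require Import all_classical all_reals all_analysis.
From mathcomp Require Import measurable_realfun ring lra.
Set Implicit Arguments.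
Unset Strict Implicit.
Unset Printing Implicit Defensive.
Import Order.TTheory GRing.Theory Num.Theory.
Import numFieldNormedType.Exports.
Local Open Scope classical_set_scope.
Local Open Scope ring_scope.

(** The dilation [x -> e^t x] turns the Ornstein-Uhlenbeck type flow of [phi]
    into the heat flow: with [f0 = e^(-phi0)], [s = e^(2t) - 1] and [h_s] the
    convolution of [f0] with the Gaussian of variance [s],
      [e^(-phi(t, x)) = e^(n t) h_s (e^t x)].
    Put [W_s(y) = \int e^(p <z, y>) h_s(z)^(p+1) dz] ([tmass]). Since the mass
    [V] of [h_s] does not depend on [s], unfolding the transform gives
      [M_p(phi(t)) = V^(1 + 1/p) * \int W_s(y)^(-1/p) dy],
    where the integrand is 0 when [W_s(y)] is infinite. So the theorem is a
    derivative in [s] of this last integral, times [ds/dt = 2 e^(2t)].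

    Two integrations by parts give this derivative pointwise in [y]. Let
    [P = e^(p <z, y>) h_s^(p+1)], [a_i = d_i h_s / h_s], [b_i = d_ii h_s / h_s].
    The integrals of [d_i P] and of [d_i (P a_i)] vanish, that is,
      [\int P ((p + 1) a_i + p y_i) = 0] and
      [\int P (p y_i a_i + p a_i^2 + b_i) = 0]
    ([int_score_eq], [int_score_sqr_eq]). As [(p + 1) a_i + p y_i] is
    [d_i log P], they turn the Fisher information [I_s(y)] of [P / W_s] into
      [I_s = p |y|^2 - (p + 1)^2 / p * \sum_i \int P b_i / W_s],
    and by the heat equation [d_s W_s = (p + 1) / 2 * \sum_i \int P b_i]. Hence
      [d_s W_s^(-1/p) = W_s^(-1/p) (I_s - p |y|^2) / (2 (p + 1))]
    ([rfisherE], [is_derive_rmass], [is_derive_polar]). Integrating in [y]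
    leaves the mean Fisher information minus [p] times the second moment of
    [e^(-phi^{*,p})], and this second moment is [tr Cov + |b|^2] ([trace_cov]).

    What remains is to justify the calculus.
    - Derivatives under the integral in [z]: a Gaussian of four times the
      variance dominates the heat kernel and its derivatives locally uniformly
      ([heat_family_dom]), which passes to [h_s] and to [P] ([tilt_dom]).
      Integrating by parts leaves no boundary term because the integral of a
      translate does not depend on the translation ([integral_partial_eq0]).
    - The set where [W_s] is finite does not depend on [s] ([tmass_fin]): one
      direction is monotonicity of the Gaussian in its variance, the other is
      the semigroup property with Jensen's inequality. So for fixed [y] the
      function [s -> W_s(y)^(-1/p)] is either smooth and positive or 0.
    - The derivative under the integral in [y]: [h_s] is bounded below by a
      Gaussian, so [W_s(y) >= c e^(k |y|^2)] ([tmass_lower]); and [b_i >= -1/s]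
      with the formula for [I_s] gives [0 <= I_s <= p |y|^2 + C / s]
      ([rfisher_le]). So [d_s W_s^(-1/p)] is dominated by a Gaussian times a
      quadratic polynomial ([dpolar_dom]).
    - Positivity of the integral: a convex function with [0 < V < oo] grows at
      least linearly, so [f0] has small exponential moments
      ([boltz_exp_moment]) and [W_s] is finite on a box ([polar_int_gt0]). *)

(** * Affine changes of variables on [R^n] *)

Section affine_line.
Context {R : realType}.
Local Notation T := (measurableTypeR R).
Local Notation leb := (@lebesgue_measure R).

Lemma measurable_affine (c b : R) :
  measurable_fun [set: T] (fun x : T => c * x + b : T).
Proof. by apply: measurable_funD => //; apply: measurable_funM. Qed.

(** The two measures agree on half-open intervals, which determine the Lebesgue
    measure. *)
Lemma lebesgue_measure_affine (c b : R) (A : set T) : 0 < c -> measurable A ->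
  leb A = (c%:E * pushforward leb (fun x : T => c * x + b : T)%R A)%E.
Proof.
move=> c0 mA.
pose nu : {measure set T -> \bar R} :=
  measure_function_pushforward__canonical__measure_function_Measure
    leb (measurable_affine c b).
pose nu' : {measure set T -> \bar R} := mscale (NngNum (ltW c0)) nu.
rewrite (_ : (c%:E * _)%E = nu' A)//.
apply: lebesgue_measure_unique => // _ [[u v]] _ <-.
rewrite /= /mscale/= /pushforward.
have -> : (fun x : T => c * x + b) @^-1` `]u, v] = `](u - b) / c, (v - b) / c]%classic.
  apply/seteqP; split => x /=; rewrite !in_itv/= ltr_pdivrMr// ler_pdivlMr// mulrC.
    by rewrite ltrBlDr lerBrDr.
  by rewrite ltrBlDr lerBrDr.
rewrite !lebesgue_measure_itv/= !lte_fin ltr_pM2r ?invr_gt0// ltrD2r.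
case: ifPn => _; last by rewrite mule0.
by rewrite -!EFinB -EFinM; congr EFin; field; rewrite gt_eqF.
Qed.

Lemma ge0_integral_affine (c b : R) (f : T -> \bar R) : 0 < c ->
  measurable_fun setT f -> (forall x, 0 <= f x)%E ->
  (\int[leb]_x f x = c%:E * \int[leb]_x f (c * x + b)%R)%E.
Proof.
move=> c0 mf f0.
pose nu : {measure set T -> \bar R} :=
  measure_function_pushforward__canonical__measure_function_Measure
    leb (measurable_affine c b).
transitivity (\int[mscale (NngNum (ltW c0)) nu]_x f x)%E.
  by apply: eq_measure_integral => A mA _; exact: lebesgue_measure_affine.
rewrite ge0_integral_mscale//; congr (_ * _)%E.
rewrite (ge0_integral_pushforward (measurable_affine c b))//.
Qed.

End affine_line.

Section integral_cons.
Context {R : realType} {n : nat}.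
Local Notation leb := (@lebesgue_measure R).

Lemma ge0_integral_cons (f : 'rV[R]_n.+1 -> \bar R) :
  measurable_fun setT f -> (forall x, 0 <= f x)%E ->
  (\int[lebesgue_rV n.+1]_x f x =
   \int[leb]_a \int[lebesgue_rV n]_v f (rV_cons (a, v)))%E.
Proof.
move=> mf f0.
rewrite [LHS](ge0_integral_pushforward (@measurable_rV_cons R n))//.
rewrite preimage_setT fubini_tonelli1=> [|//|x]; [by []| |exact: f0].
by apply: measurableT_comp => //; exact: measurable_rV_cons.
Qed.

End integral_cons.

Section integral_rV.
Context {R : realType}.

Lemma measurable_rV_affine n (c : R) (b : 'rV[R]_n) :
  measurable_fun [set: 'rV[R]_n] (fun x => c *: x + b).
Proof.
apply/measurable_fun_coordP => i.
under eq_fun do rewrite !mxE.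
by apply: measurable_funD => //; apply: measurable_funM => //; exact: measurable_coord.
Qed.

Lemma rV_cons_affine n (c a : R) (v : 'rV[R]_n) (b : 'rV[R]_n.+1) :
  c *: rV_cons (a, v) + b =
  rV_cons (c * a + (rV_uncons b).1, c *: v + (rV_uncons b).2).
Proof.
apply/rowP => i; rewrite /rV_cons !mxE.
by case: unliftP => [j ->|->]//=; rewrite !mxE.
Qed.

Lemma measurable_rV_cons2 n (a : R) :
  measurable_fun [set: 'rV[R]_n] (fun v => rV_cons (a, v)).
Proof.
apply: (measurableT_comp (@measurable_rV_cons R n)).
exact: measurable_pair1.
Qed.

(** The induction peels off one coordinate at a time by Tonelli's theorem, so
    the factor [c] of the line is collected [n] times. *)
Lemma ge0_integral_rV_affine n (c : R) (b : 'rV[R]_n) (f : 'rV[R]_n -> \bar R) :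
  0 < c -> measurable_fun setT f -> (forall x, 0 <= f x)%E ->
  (\int[lebesgue_rV n]_x f x =
   (c ^+ n)%:E * \int[lebesgue_rV n]_x f (c *: x + b)%R)%E.
Proof.
move=> c0; elim: n b f => [|n IHn] b f mf f0.
  rewrite expr0 mul1e !integral_dirac ?diracT ?mul1e//.
    by congr f; apply/rowP => -[].
  by apply: measurableT_comp => //; exact: measurable_rV_affine.
have mcons (g : 'rV[R]_n.+1 -> \bar R) : measurable_fun setT g ->
    measurable_fun setT (g \o @rV_cons R n).
  by move=> mg; apply: measurableT_comp => //; exact: measurable_rV_cons.
have maff : measurable_fun setT (fun x : 'rV[R]_n.+1 => f (c *: x + b)).
  by apply: measurableT_comp => //; exact: measurable_rV_affine.
rewrite !ge0_integral_cons//.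
set F := fun a : measurableTypeR R => (\int[lebesgue_rV n]_v f (rV_cons (a, v)))%E.
have mF : measurable_fun setT F.
  have := @measurable_fun_fubini_tonelli_F _ _ _ _ _ (lebesgue_rV n) _ (mcons _ mf).
  by apply => x; exact: f0.
have F0 a : (0 <= F a)%E by exact: integral_ge0.
rewrite [LHS](@ge0_integral_affine R c (rV_uncons b).1 F c0 mF F0).
rewrite exprS EFinM -muleA; congr (_ * _)%E.
have mG := @measurable_fun_fubini_tonelli_F _ _ _ _ _ (lebesgue_rV n) _ (mcons _ maff).
rewrite -ge0_integralZl//=; [|by apply: mG => x; exact: f0|..]; last 2 first.
- by move=> x _; exact: integral_ge0.
- by rewrite lee_fin exprn_ge0// ltW.
apply: eq_integral => a _; rewrite /F.
under [in RHS]eq_integral do rewrite rV_cons_affine.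
apply: (IHn _ (fun v => f (rV_cons (_, v)))) => //.
by apply: measurableT_comp => //; exact: measurable_rV_cons2.
Qed.

Lemma ge0_integral_rV_translate n (b : 'rV[R]_n) (f : 'rV[R]_n -> \bar R) :
  measurable_fun setT f -> (forall x, 0 <= f x)%E ->
  (\int[lebesgue_rV n]_x f (x + b)%R = \int[lebesgue_rV n]_x f x)%E.
Proof.
move=> mf f0; rewrite [RHS](@ge0_integral_rV_affine n 1 b)// expr1n mul1e.
by under [RHS]eq_integral do rewrite scale1r.
Qed.

End integral_rV.

(** * Differentiation under the integral and the Gaussian kernel *)

Section measurability.
Context {R : realType}.

Lemma measurable_dot_fun d (T : measurableType d) n (f g : T -> 'rV[R]_n) :
  measurable_fun setT f -> measurable_fun setT g ->
  measurable_fun setT (fun t => dot (f t) (g t)).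
Proof.
move=> /measurable_fun_coordP mf /measurable_fun_coordP mg.
apply: measurable_sum => i; apply: measurable_funM; [exact: mf|exact: mg].
Qed.

Lemma measurable_add_fun d (T : measurableType d) n (f g : T -> 'rV[R]_n) :
  measurable_fun setT f -> measurable_fun setT g ->
  measurable_fun setT (fun t => f t + g t).
Proof.
move=> /measurable_fun_coordP mf /measurable_fun_coordP mg.
apply/measurable_fun_coordP => i; under eq_fun do rewrite mxE.
by apply: measurable_funD; [exact: mf|exact: mg].
Qed.

Lemma measurable_scale_fun d (T : measurableType d) n (c : R) (f : T -> 'rV[R]_n) :
  measurable_fun setT f -> measurable_fun setT (fun t => c *: f t).
Proof.
move=> /measurable_fun_coordP mf.
apply/measurable_fun_coordP => i; under eq_fun do rewrite mxE.
by apply: measurable_funM => //; exact: mf.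
Qed.

Lemma measurable_sub_fun d (T : measurableType d) n (f g : T -> 'rV[R]_n) :
  measurable_fun setT f -> measurable_fun setT g ->
  measurable_fun setT (fun t => f t - g t).
Proof.
move=> mf mg; apply: measurable_add_fun => //.
by under eq_fun do rewrite -scaleN1r; exact: measurable_scale_fun.
Qed.

(** The integral is the difference of those of the positive and negative parts,
    and Tonelli's theorem makes each of them measurable in the parameter. *)
Lemma measurable_integral_param d (T : measurableType d) n (F : T * 'rV[R]_n -> \bar R) :
  measurable_fun setT F ->
  measurable_fun setT (fun x => \int[lebesgue_rV n]_y F (x, y))%E.
Proof.
move=> mF; under eq_fun do rewrite integralE.
apply: emeasurable_funB.
  have := @measurable_fun_fubini_tonelli_F _ _ _ _ R (lebesgue_rV n) _ (measurable_funepos mF).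
  move=> /(_ (funepos_ge0 F)) H; congr (measurable_fun _ _): H.
  by apply/funext => x; apply: eq_integral => y _; rewrite !funeposE.
have := @measurable_fun_fubini_tonelli_F _ _ _ _ R (lebesgue_rV n) _ (measurable_funeneg mF).
move=> /(_ (funeneg_ge0 F)) H; congr (measurable_fun _ _): H.
by apply/funext => x; apply: eq_integral => y _; rewrite !funenegE.
Qed.

Lemma measurable_Rintegral_param d (T : measurableType d) n (F : T * 'rV[R]_n -> R) :
  measurable_fun setT F ->
  measurable_fun setT (fun x => \int[lebesgue_rV n]_y F (x, y)).
Proof.
move=> mF; apply: (measurableT_comp (fine_measurable measurableT)).
by apply: (@measurable_integral_param _ _ _ (EFin \o F)); exact/measurable_EFinP.
Qed.

End measurability.

Section diff_under_integral.
Context {R : realType} d {Y : measurableType d} (mu : {measure set Y -> \bar R}).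

Lemma integrable_le (g f : Y -> R) : measurable_fun setT f ->
  (forall y, `|f y| <= g y) -> mu.-integrable setT (EFin \o g) ->
  mu.-integrable setT (EFin \o f).
Proof.
move=> mf fg; apply: le_integrable => //; first exact/measurable_EFinP.
by move=> y _; rewrite /= lee_fin (le_trans (fg y))// ler_norm.
Qed.

Lemma is_derive_Rintegral (f df : R -> Y -> R) (G : Y -> R) (a u v : R) :
  u < a < v ->
  (forall x, u < x < v -> mu.-integrable setT (EFin \o f x)) ->
  (forall x y, u < x < v -> is_derive x 1 (f ^~ y) (df x y)) ->
  (forall x y, u < x < v -> `|df x y| <= G y) ->
  mu.-integrable setT (EFin \o G) ->
  is_derive a 1 (fun x => \int[mu]_y f x y) (\int[mu]_y df a y).
Proof.
move=> auv fi fd dG Gi.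
have I x : `]u, v[%classic x -> u < x < v by rewrite /= in_itv.
have Ia : `]u, v[%classic a by rewrite /= in_itv.
have E x y : `]u, v[%classic x -> derive1 (f ^~ y) x = df x y.
  by move=> /I xuv; have fxd := fd x y xuv; rewrite derive1E derive_val.
have derf x y : `]u, v[%classic x -> [set: Y] y -> derivable (f ^~ y) x 1.
  by move=> /I xuv _; have fxd := fd x y xuv; exact: ex_derive.
have G0 y : 0 <= G y by exact: le_trans (dG a y auv).
have dG' x y : `]u, v[%classic x -> [set: Y] y -> `|partial1of2 f x y| <= G y.
  by move=> Ix _; rewrite /partial1of2 E//; exact/dG/I.
have fi' x : `]u, v[%classic x -> mu.-integrable setT (EFin \o f x) by move=> /I; exact: fi.
have H1 := @derivable_under_integral R _ Y mu f setT measurableT a u v Ia fi' derf G G0 Gi dG'.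
have H2 := @differentiation_under_integral R _ Y mu f setT measurableT a u v Ia fi' derf G G0 Gi dG'.
have -> : \int[mu]_y df a y = 'D_1 (fun x => \int[mu]_y f x y) a.
  by rewrite -derive1E H2; apply: eq_Rintegral => y _; rewrite /partial1of2 E.
exact: DeriveDef.
Qed.

End diff_under_integral.

Section heat.
Context {R : realType} {n : nat}.
Implicit Types x y : 'rV[R]_n.

(** The centred Gaussian density of covariance [s] times the identity. Its
    normalisation sits inside the exponential, so that products and comparisons
    of kernels reduce to their exponents. *)
Definition heat (s : R) x : R :=
  expR (- (sqnorm x / (2 * s)) - n%:R / 2 * ln (2 * pi * s)).

Lemma heat_gt0 s x : 0 < heat s x. Proof. exact: expR_gt0. Qed.

Lemma sqnorm_ge0 x : 0 <= sqnorm x.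
Proof. by apply: sumr_ge0 => i _; rewrite -expr2 sqr_ge0. Qed.

Lemma measurable_heat_fun d (T : measurableType d) s (f : T -> 'rV[R]_n) :
  measurable_fun setT f -> measurable_fun setT (fun t => heat s (f t)).
Proof.
move=> mf; apply: (measurableT_comp (@measurable_expR R)).
apply: measurable_funB => //; apply: measurable_funN.
apply: measurable_funM => //.
exact: measurable_dot_fun.
Qed.

End heat.

Section heat_mass.
Context {R : realType}.

Lemma sqnorm_cons n (a : R) (v : 'rV[R]_n) : sqnorm (rV_cons (a, v)) = a ^+ 2 + sqnorm v.
Proof.
rewrite /sqnorm /dot big_ord_recl /rV_cons !mxE unlift_none/= -expr2; congr +%R.
by apply: eq_bigr => i _; rewrite !mxE liftK.
Qed.

Lemma heat_cons n (s a : R) (v : 'rV[R]_n) : 0 < s ->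
  heat s (rV_cons (a, v)) = normal_pdf 0 (Num.sqrt s) a * heat s v.
Proof.
move=> s0; have s0' : Num.sqrt s != 0 by rewrite gt_eqF// sqrtr_gt0.
rewrite normal_pdfE// /normal_peak /normal_fun sqr_sqrtr ?ltW// subr0.
have p0 : 0 < 2 * pi * s :> R by rewrite !mulr_gt0// pi_gt0.
have -> : (Num.sqrt (s * pi *+ 2))^-1 = expR (- (2^-1 * ln (2 * pi * s))).
  rewrite -powR12_sqrt; last by rewrite mulrn_wge0// mulr_ge0 ?pi_ge0// ltW.
  rewrite (_ : s * pi *+ 2 = 2 * pi * s); last by ring.
  by rewrite /powR gt_eqF// expRN.
rewrite /heat sqnorm_cons -!expRD; congr expR.
rewrite -natr1; field; rewrite gt_eqF//.
Qed.

(** The Gaussian is a product of normal densities of variance [s] in the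
    coordinates. *)
Lemma integral_heat n (s : R) : 0 < s ->
  (\int[lebesgue_rV n]_x (heat s x)%:E = 1)%E.
Proof.
move=> s0; have m m' : measurable_fun [set: 'rV[R]_m'] (fun x => (heat s x)%:E).
  by apply/measurable_EFinP; exact: measurable_heat_fun.
elim: n => [|n IHn].
  rewrite integral_dirac; [|exact: measurableT|exact: m].
  by rewrite diracT mul1e /heat /sqnorm /dot big_ord0 mulr0n !mul0r oppr0 addr0 expR0.
rewrite (@ge0_integral_cons R n (fun x => (heat s x)%:E))//; last by move=> x; rewrite lee_fin expR_ge0.
transitivity (\int[lebesgue_measure]_a (normal_pdf 0 (Num.sqrt s) a)%:E)%E; last exact: integral_normal_pdf.
apply: eq_integral => a _; under eq_integral do rewrite heat_cons// EFinM.
rewrite ge0_integralZl//; last 2 first.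
- by move=> x _; rewrite lee_fin expR_ge0.
- by rewrite lee_fin normal_pdf_ge0.
  by rewrite IHn mule1.
exact: m.
Qed.

End heat_mass.

(** * Euclidean algebra and derivatives of the Gaussian kernel *)

Section euclid.
Context {R : realType} {n : nat}.
Implicit Types x y z : 'rV[R]_n.

Lemma dotDl x y z : dot (x + y) z = dot x z + dot y z.
Proof. by rewrite /dot -big_split/=; apply: eq_bigr => i _; rewrite mxE mulrDl. Qed.

Lemma dotC x y : dot x y = dot y x.
Proof. by apply: eq_bigr => i _; rewrite mulrC. Qed.

Lemma dotZl c x z : dot (c *: x) z = c * dot x z.
Proof. by rewrite /dot mulr_sumr; apply: eq_bigr => i _; rewrite mxE mulrA. Qed.

Lemma dotZr c x z : dot x (c *: z) = c * dot x z.
Proof. by rewrite dotC dotZl dotC. Qed.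

Lemma dotDr x y z : dot x (y + z) = dot x y + dot x z.
Proof. by rewrite !(dotC x) dotDl. Qed.

Lemma dot_delta (i : 'I_n) x : dot (delta_mx 0 i) x = x 0 i.
Proof.
rewrite /dot (bigD1 i)//= mxE !eqxx mul1r big1 ?addr0// => j ji.
by rewrite mxE (negbTE ji) mul0r.
Qed.

Lemma sqnormD x y : sqnorm (x + y) = sqnorm x + 2 * dot x y + sqnorm y.
Proof. by rewrite /sqnorm dotDl !dotDr (dotC y x); ring. Qed.

Lemma sqnormZ c x : sqnorm (c *: x) = c ^+ 2 * sqnorm x.
Proof. by rewrite /sqnorm dotZl dotZr mulrA expr2. Qed.

Lemma sqnormB x y : sqnorm (x - y) = sqnorm x - 2 * dot x y + sqnorm y.
Proof. by rewrite -scaleN1r sqnormD sqnormZ dotZr; ring. Qed.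

Lemma sqnorm_delta (i : 'I_n) : sqnorm (delta_mx 0 i : 'rV[R]_n) = 1.
Proof. by rewrite /sqnorm dot_delta mxE !eqxx. Qed.

Lemma sqnorm0 : sqnorm (0 : 'rV[R]_n) = 0.
Proof. by rewrite -[in LHS](scale0r (0 : 'rV[R]_n)) sqnormZ expr0n mul0r. Qed.

Lemma sqnormB_le x y : sqnorm (x - y) <= 2 * sqnorm x + 2 * sqnorm y.
Proof.
have := sqnorm_ge0 (x + y); rewrite sqnormD sqnormB; lra.
Qed.

Lemma coord_sqr_le i x : x 0 i ^+ 2 <= sqnorm x.
Proof.
rewrite /sqnorm /dot (bigD1 i)//= -expr2 lerDl.
by apply: sumr_ge0 => j _; rewrite -expr2 sqr_ge0.
Qed.

Lemma norm_coord_le i x : `|x 0 i| <= 1 + sqnorm x.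
Proof.
apply: (@le_trans _ _ (1 + x 0 i ^+ 2)); last by rewrite lerD2l coord_sqr_le.
have := sqr_ge0 (`|x 0 i| - 1); rewrite -[X in _ <= 1 + X]real_normK ?num_real//; nra.
Qed.

Lemma dot_le_sqnorm x y : dot x y <= (sqnorm x + sqnorm y) / 2.
Proof. have := sqnorm_ge0 (x - y); rewrite sqnormB; lra. Qed.

End euclid.

Section chain_rules.
Context {R : realType}.
Implicit Types (g : R -> R) (x a b : R).

Lemma is_derive_expR_comp g x b :
  is_derive x 1 g b -> is_derive x 1 (fun y => expR (g y)) (expR (g x) * b).
Proof. by move=> gb; exact: (@is_derive1_comp _ expR g). Qed.

Lemma is_derive_ln_comp g x b : 0 < g x ->
  is_derive x 1 g b -> is_derive x 1 (fun y => ln (g y)) (b / g x).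
Proof.
by move=> g0 gb; rewrite mulrC; apply: (@is_derive1_comp _ (@ln R) g); exact: is_derive1_ln.
Qed.

Lemma is_derive_powR_comp g x a b : 0 < g x ->
  is_derive x 1 g b -> is_derive x 1 (fun y => g y `^ a) (a * g x `^ a * (b / g x)).
Proof.
move=> g0 gb.
have Ig : g x \in `]0, +oo[ by rewrite in_itv/= g0.
have H : is_derive (g x) 1 (@powR R ^~ a) (a * g x `^ a / g x).
  apply: DeriveDef; first exact: derivable_powR.
  rewrite -derive1E powR_derive1// -mulrA; congr (_ * _).
  by rewrite powRB ?powRr1 ?(ltW g0)// (gt_eqF g0) implybT.
apply: (is_derive_eq (@is_derive1_comp _ (@powR R ^~ a) g _ _ _ H gb)).
by rewrite -!mulrA [(g x)^-1 * _]mulrC.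
Qed.

End chain_rules.

Section heat_derivatives.
Context {R : realType} {n : nat}.
Implicit Types x u v : 'rV[R]_n.

(** [heat1] and [heat2] are the first and second derivatives of [heat] in a
    coordinate; [heatt] is its time derivative, written through the heat
    equation. *)
Definition heat1 (i : 'I_n) (s : R) x : R := - (x 0 i / s) * heat s x.
Definition heat2 (i : 'I_n) (s : R) x : R := (x 0 i ^+ 2 / s ^+ 2 - s^-1) * heat s x.
Definition heatt (s : R) x : R := 2^-1 * \sum_i heat2 i s x.

Lemma is_derive_heat_coord i (s r : R) x : 0 < s ->
  is_derive r 1 (fun r => heat s (x + r *: delta_mx 0 i)) (heat1 i s (x + r *: delta_mx 0 i)).
Proof.
move=> s0; rewrite /heat1 /heat.
under eq_fun do rewrite sqnormD sqnormZ dotZr sqnorm_delta dotC dot_delta.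
apply: is_derive_eq; rewrite !mxE !eqxx sqnormD sqnormZ dotZr sqnorm_delta dotC dot_delta.
rewrite /GRing.scale/=.
set E := expR _; field; rewrite gt_eqF//.
Qed.

Lemma is_derive_heat1_coord i (s r : R) x : 0 < s ->
  is_derive r 1 (fun r => heat1 i s (x + r *: delta_mx 0 i)) (heat2 i s (x + r *: delta_mx 0 i)).
Proof.
move=> s0; rewrite /heat1 /heat2.
have H := is_derive_heat_coord i r x s0.
under eq_fun do rewrite [(_ + _ : 'rV_n) 0 i]mxE [(_ *: _ : 'rV_n) 0 i]mxE mxE !eqxx.
apply: is_derive_eq; rewrite /heat1 !mxE !eqxx /GRing.scale/=.
by field; rewrite gt_eqF.
Qed.

Lemma is_derive_heat_time (s : R) x : 0 < s ->
  is_derive s 1 (fun s => heat s x) (heatt s x).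
Proof.
move=> s0; have s0' : 0 < 2 * pi * s by rewrite !mulr_gt0// pi_gt0.
have H : is_derive s 1 (fun s : R => ln (2 * pi * s)) s^-1.
  have Hl : is_derive s 1 (fun s : R => 2 * pi * s) (2 * pi * 1) by exact: is_deriveZ.
  apply: (is_derive_eq (is_derive_ln_comp s0' Hl)).
  by move: pi (pi_gt0 R) => P P0; field; rewrite (gt_eqF s0) (gt_eqF P0).
have Hi : is_derive s 1 (fun s : R => (2 * s)^-1) (- (2 * s ^+ 2)^-1).
  have Hl2 : is_derive s 1 (fun s : R => 2 * s) (2 * 1) by exact: is_deriveZ.
  have n0 : 2 * s != 0 by rewrite gt_eqF// mulr_gt0.
  apply: (is_derive_eq (is_deriveV n0 Hl2)).
  by rewrite /GRing.scale/=; field; rewrite gt_eqF.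
have Ht : is_derive s 1 (fun s => - (sqnorm x / (2 * s)) - n%:R / 2 * ln (2 * pi * s))
    (- (sqnorm x * - (2 * s ^+ 2)^-1) - n%:R / 2 * s^-1).
  exact: is_deriveB.
apply: (is_derive_eq (is_derive_expR_comp Ht)).
rewrite /heatt /heat2 -mulr_suml sumrB sumr_const card_ord -mulr_suml.
rewrite (_ : \sum_i _ = sqnorm x); last by apply: eq_bigr => i _; rewrite expr2.
rewrite -[s^-1 *+ n]mulr_natl -/(heat s x); set E := heat s x.
by field; rewrite gt_eqF.
Qed.

Lemma measurable_heat1_fun d (T : measurableType d) i s (f : T -> 'rV[R]_n) :
  measurable_fun setT f -> measurable_fun setT (fun t => heat1 i s (f t)).
Proof.
move=> mf; apply: measurable_funM; last exact: measurable_heat_fun.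
apply: measurable_funN; apply: measurable_funM => //.
by move/measurable_fun_coordP : mf; exact.
Qed.

Lemma measurable_heat2_fun d (T : measurableType d) i s (f : T -> 'rV[R]_n) :
  measurable_fun setT f -> measurable_fun setT (fun t => heat2 i s (f t)).
Proof.
move=> mf; apply: measurable_funM; last exact: measurable_heat_fun.
apply: measurable_funB => //; apply: measurable_funM => //.
by apply: measurable_funX; move/measurable_fun_coordP : mf; exact.
Qed.

Lemma heat_le s x : 0 < s -> heat s x <= heat s (0 : 'rV[R]_n).
Proof.
move=> s0; rewrite ler_expR lerD2r lerN2.
by rewrite sqnorm0 mul0r divr_ge0 ?sqnorm_ge0// mulr_ge0// ltW.
Qed.

(** As [s] grows the exponent increases; only the normalisation has to be
    compensated. *)
Lemma heat_mono s s' x : 0 < s -> s <= s' ->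
  heat s x <= expR (n%:R / 2 * (ln (2 * pi * s') - ln (2 * pi * s))) * heat s' x.
Proof.
move=> s0 ss'; rewrite -expRD ler_expR.
suff : sqnorm x / (2 * s') <= sqnorm x / (2 * s) by lra.
rewrite ler_wpM2l ?sqnorm_ge0// lef_pV2 ?posrE; [by rewrite ler_pM2l| |]; rewrite mulr_gt0//.
exact: lt_le_trans ss'.
Qed.

(** A Gaussian absorbs both a quadratic factor and a bounded shift at the price
    of a larger variance; [4 * s2] leaves room for the two at once. *)
Lemma heat_dom s1 s2 : 0 < s1 -> s1 <= s2 ->
  exists2 C, 0 < C & forall s u v, s1 <= s <= s2 -> sqnorm v <= 1 ->
    (1 + sqnorm u) * heat s u <= C * heat (4 * s2) (u - v).
Proof.
move=> s10 s12; have s20 : 0 < s2 by exact: lt_le_trans s12.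
(* [1 + 4 s2] bounds [(1 + a) e^(- a / (4 s2))]; the exponential collects the
   effect of the shift and the ratio of the normalisations. *)
exists ((1 + 4 * s2) * expR ((4 * s2)^-1 + n%:R / 2 * (ln (2 * pi * (4 * s2)) - ln (2 * pi * s1)))).
  by rewrite mulr_gt0 ?expR_gt0// addr_gt0// mulr_gt0.
move=> s u v /andP[s1s ss2] v1; have s0 : 0 < s by exact: lt_le_trans s1s.
have u0 := sqnorm_ge0 u.
have H1 : 1 + sqnorm u <= (1 + 4 * s2) * expR (sqnorm u / (4 * s2)).
  apply: (@le_trans _ _ ((1 + 4 * s2) * (1 + sqnorm u / (4 * s2)))).
    rewrite mulrDl mul1r mulrDr mulr1 mulrCA divff ?gt_eqF ?mulr_gt0// mulr1.
    have : 0 <= sqnorm u / (4 * s2) by rewrite divr_ge0// mulr_ge0// ltW.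
    lra.
  by rewrite ler_wpM2l ?expR_ge1Dx// addr_ge0// mulr_ge0// ltW.
apply: (@le_trans _ _ ((1 + 4 * s2) * expR (sqnorm u / (4 * s2)) * heat s u)).
  by rewrite ler_wpM2r ?expR_ge0.
rewrite -[X in X <= _]mulrA -[X in _ <= X]mulrA ler_pM2l ?addr_gt0 ?mulr_gt0//.
rewrite -!expRD ler_expR.
have H2 : ln (2 * pi * s1) <= ln (2 * pi * s).
  by rewrite ler_ln ?posrE ?mulr_gt0 ?pi_gt0// ler_pM2l// mulr_gt0// pi_gt0.
have H3 : sqnorm u / (2 * s2) <= sqnorm u / (2 * s).
  by rewrite ler_wpM2l// lef_pV2 ?posrE ?mulr_gt0// ler_pM2l.
have H4 : sqnorm (u - v) / (2 * (4 * s2)) <= sqnorm u / (4 * s2) + (4 * s2)^-1.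
  apply: (@le_trans _ _ ((2 * sqnorm u + 2) / (2 * (4 * s2)))).
    rewrite ler_pM2r; last by rewrite invr_gt0 !mulr_gt0.
    by have := sqnormB_le u v; lra.
  rewrite le_eqVlt; apply/orP; left; apply/eqP; field; rewrite gt_eqF//.
have H5 : sqnorm u / (2 * s2) = 2 * (sqnorm u / (4 * s2)) by field; rewrite gt_eqF.
have H6 : n%:R / 2 * ln (2 * pi * s1) <= n%:R / 2 * ln (2 * pi * s).
  by rewrite ler_wpM2l.
lra.
Qed.

Lemma heat1_le i s u : 0 < s -> `|heat1 i s u| <= s^-1 * ((1 + sqnorm u) * heat s u).
Proof.
move=> s0; rewrite /heat1 normrM (gtr0_norm (heat_gt0 _ _)) mulrA.
rewrite ler_wpM2r ?expR_ge0// normrN normrM [`|s^-1|]gtr0_norm ?invr_gt0// mulrC.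
by rewrite ler_pM2l ?invr_gt0// norm_coord_le.
Qed.

Lemma heat2_le i s u : 0 < s ->
  `|heat2 i s u| <= (s ^- 2 + s^-1) * ((1 + sqnorm u) * heat s u).
Proof.
move=> s0; rewrite /heat2 normrM (gtr0_norm (heat_gt0 _ _)) mulrA.
rewrite ler_wpM2r ?expR_ge0// (le_trans (ler_normB _ _))//.
rewrite [`|s^-1|]gtr0_norm ?invr_gt0// ger0_norm ?divr_ge0 ?sqr_ge0//.
have := coord_sqr_le i u; have := sqnorm_ge0 u.
have a0 : 0 < s ^- 2 by rewrite invr_gt0 exprn_gt0.
have b0 : 0 < s^-1 by rewrite invr_gt0.
move: (s ^- 2) a0 (s^-1) b0 (u 0 i ^+ 2) (sqnorm u) => a a0 b b0 w q q0 wq.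
by nra.
Qed.

Lemma heatt_le s u : 0 < s ->
  `|heatt s u| <= n%:R / 2 * (s ^- 2 + s^-1) * ((1 + sqnorm u) * heat s u).
Proof.
move=> s0; rewrite /heatt normrM ger0_norm// -mulrA [n%:R / 2]mulrC -mulrA.
rewrite ler_pM2l// (le_trans (ler_norm_sum _ _ _))//.
apply: (le_trans (ler_sum _ (fun i _ => heat2_le i u s0))).
by rewrite sumr_const card_ord mulr_natl.
Qed.

(** Uniformity in [v] allows derivatives in space under the integral sign,
    uniformity in [s] derivatives in time. The same Gaussian serves for all of
    them, so that the bound passes to convolutions as a bound by a single
    solution of the heat equation. *)
Lemma heat_family_dom s1 s2 : 0 < s1 -> s1 <= s2 ->
  exists2 C, 0 < C & forall s u v, s1 <= s <= s2 -> sqnorm v <= 1 ->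
  [/\ heat s u <= C * heat (4 * s2) (u - v),
      (forall i, `|heat1 i s u| <= C * heat (4 * s2) (u - v)),
      (forall i, `|heat2 i s u| <= C * heat (4 * s2) (u - v)) &
      `|heatt s u| <= C * heat (4 * s2) (u - v)].
Proof.
move=> s10 s12; have [C C0 HC] := heat_dom s10 s12.
(* [a] bounds the coefficient in [heat2_le] and [n / 2 * a] the one in
   [heatt_le]; [M] exceeds the coefficients of the four bounds. *)
pose a := s1 ^- 2 + s1^-1.
have a0 : 0 < a by rewrite addr_gt0// invr_gt0// exprn_gt0.
pose M := 1 + s1^-1 + a + n%:R / 2 * a.
have n0 : 0 <= n%:R / 2 * a by rewrite mulr_ge0 ?divr_ge0// ltW.
have s1i : 0 < s1^-1 by rewrite invr_gt0.
exists (M * C); first by rewrite mulr_gt0// /M; lra.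
move=> s u v s1s2 v1; have := HC s u v s1s2 v1.
have /andP[s1s ss2] := s1s2; have s0 : 0 < s by exact: lt_le_trans s1s.
set D := heat (4 * s2) (u - v); set N := (1 + sqnorm u) * heat s u => ND.
have N0 : 0 <= N by rewrite mulr_ge0 ?expR_ge0// addr_ge0// sqnorm_ge0.
have H c : c <= M -> c * N <= M * C * D.
  move=> cM; rewrite (@le_trans _ _ (M * N))//; first by rewrite ler_wpM2r.
  by rewrite -mulrA ler_pM2l// /M; lra.
have si : s^-1 <= s1^-1 by rewrite lef_pV2.
have si2 : s ^- 2 <= s1 ^- 2.
  by rewrite lef_pV2 ?posrE ?exprn_gt0// lerXn2r// nnegrE ltW.
have aa : s ^- 2 + s^-1 <= a by rewrite lerD.
split.
- apply: le_trans (H 1 _); last by rewrite /M; lra.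
  by rewrite mul1r ler_peMl ?expR_ge0// lerDl sqnorm_ge0.
- by move=> i; apply: le_trans (heat1_le i u s0) (H _ _); rewrite /M; lra.
- by move=> i; apply: le_trans (heat2_le i u s0) (H _ _); rewrite /M; lra.
- apply: le_trans (heatt_le u s0) (H _ _).
  have : n%:R / 2 * (s ^- 2 + s^-1) <= n%:R / 2 * a by rewrite ler_wpM2l.
  by rewrite /M; lra.
Qed.

End heat_derivatives.

(** * Convolution with an integrable density *)

Section convol.
Context {R : realType} {n : nat}.
Local Notation mu := (lebesgue_rV n).
Variable f0 : 'rV[R]_n -> R.
Hypothesis mf0 : measurable_fun setT f0.
Hypothesis f0_ge0 : forall y, 0 <= f0 y.
Hypothesis f0_int : mu.-integrable setT (EFin \o f0).
Implicit Types (q : 'rV[R]_n -> R) (x y z v w : 'rV[R]_n).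

Definition convol q x : R := \int[mu]_y (q (x - y) * f0 y).

(** Bounded measurable kernels are those whose convolution with an integrable
    density converges absolutely at every point. *)
Definition bmeas q := measurable_fun setT q /\ exists C, forall u, `|q u| <= C.

Lemma bmeas_shift q v : bmeas q -> bmeas (fun u => q (u + v)).
Proof.
move=> [mq [C qC]]; split; last by exists C.
by apply: measurableT_comp => //; apply: measurable_add_fun.
Qed.

Lemma bmeasZ c q : bmeas q -> bmeas (fun u => c * q u).
Proof.
move=> [mq [C qC]]; split; first exact: measurable_funM.
by exists (`|c| * C) => u; rewrite normrM ler_wpM2l.
Qed.

Lemma bmeasD q q' : bmeas q -> bmeas q' -> bmeas (fun u => q u + q' u).
Proof.
move=> [mq [C qC]] [mq' [C' qC']]; split; first exact: measurable_funD.
by exists (C + C') => u; rewrite (le_trans (ler_normD _ _))// lerD.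
Qed.

Lemma convol_integrable q x : bmeas q -> mu.-integrable setT (fun y => (q (x - y) * f0 y)%:E).
Proof.
move=> [mq [C qC]].
apply: (@integrable_le _ _ _ mu (fun y => C * f0 y)).
- by apply: measurable_funM => //; apply: measurableT_comp => //; exact: measurable_sub_fun.
- by move=> y; rewrite normrM [`|f0 y|]ger0_norm// ler_wpM2r.
- exact: (integrableZl measurableT C f0_int).
Qed.

Lemma EFin_convol q x : bmeas q ->
  (convol q x)%:E = (\int[mu]_y (q (x - y) * f0 y)%:E)%E.
Proof.
move=> bq; rewrite /convol /Rintegral fineK//.
exact: (integrable_fin_num measurableT (convol_integrable x bq)).
Qed.

Lemma convol_le q q' x : bmeas q -> bmeas q' -> (forall u, q u <= q' u) -> convol q x <= convol q' x.
Proof.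
move=> bq bq' qq'; rewrite /convol le_Rintegral//; [exact: convol_integrable..|].
by move=> y _; rewrite ler_wpM2r.
Qed.

Lemma convolZ c q x : bmeas q -> convol (fun u => c * q u) x = c * convol q x.
Proof.
move=> bq; rewrite /convol -RintegralZl//; last exact: convol_integrable.
by apply: eq_Rintegral => y _; rewrite mulrA.
Qed.

Lemma convolD q q' x : bmeas q -> bmeas q' ->
  convol (fun u => q u + q' u) x = convol q x + convol q' x.
Proof.
move=> bq bq'; rewrite /convol -RintegralD//; [|exact: convol_integrable..].
by apply: eq_Rintegral => y _; rewrite mulrDl.
Qed.

Lemma convol_sum (I : finType) (q : I -> 'rV[R]_n -> R) x : (forall i, bmeas (q i)) ->
  bmeas (fun u => \sum_i q i u) /\
  convol (fun u => \sum_i q i u) x = \sum_i convol (q i) x.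
Proof.
move=> bq.
elim: (index_enum I) => [|i s [IH1 IH2]].
  split; first by under eq_fun do rewrite big_nil; split=> //; exists 0 => u; rewrite normr0.
  rewrite /convol big_nil; under eq_Rintegral do rewrite big_nil mul0r.
  by rewrite /Rintegral integral0.
under eq_fun do rewrite big_cons; split; first exact: bmeasD.
by rewrite big_cons convolD// IH2.
Qed.

Lemma convol_norm_le q q' x : bmeas q -> bmeas q' -> (forall u, `|q u| <= q' u) ->
  `|convol q x| <= convol q' x.
Proof.
move=> bq bq' qq'; rewrite ler_norml; apply/andP; split; last first.
  by apply: convol_le => // u; rewrite (le_trans (ler_norm _)).
rewrite -mulN1r -convolZ//; apply: convol_le => //; first exact: bmeasZ.
by move=> u; rewrite mulN1r lerNl (le_trans (ler_norm _))// normrN.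
Qed.

Lemma convol_ge0 q x : (forall u, 0 <= q u) -> 0 <= convol q x.
Proof. by move=> q0; apply: Rintegral_ge0 => y _; rewrite mulr_ge0. Qed.

Lemma convol_shift q v x : convol q (x + v) = convol (fun u => q (u + v)) x.
Proof. by apply: eq_Rintegral => y _; rewrite addrAC. Qed.

Lemma measurable_convol q : measurable_fun setT q -> measurable_fun setT (convol q).
Proof.
move=> mq.
have mF : measurable_fun setT (fun z : 'rV[R]_n * 'rV[R]_n => q (z.1 - z.2) * f0 z.2).
  apply: measurable_funM; apply: measurableT_comp => //.
  exact: measurable_sub_fun.
exact: (measurable_Rintegral_param mF).
Qed.

(** The multiple [C * f0] of the density dominates, since the kernels
    differentiated here have bounded derivatives. *)
Lemma is_derive_convol (q dq : R -> 'rV[R]_n -> R) (C a lo hi : R) x : lo < a < hi ->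
  (forall r, lo < r < hi -> bmeas (q r)) ->
  (forall r z, lo < r < hi -> is_derive r 1 (q ^~ z) (dq r z)) ->
  (forall r z, lo < r < hi -> `|dq r z| <= C) ->
  is_derive a 1 (fun r => convol (q r) x) (convol (dq a) x).
Proof.
move=> auv bq dqd dqC.
apply: (@is_derive_Rintegral _ _ _ mu _ (fun r y => dq r (x - y) * f0 y) (fun y => C * f0 y) _ lo hi) => //.
- by move=> r ruv; apply: convol_integrable; exact: bq.
- move=> r y ruv; have H := dqd r (x - y) ruv.
  by apply: (is_derive_eq (is_deriveM H (is_derive_cst _ _ _))); rewrite scaler0 add0r /GRing.scale/= mulrC.
- by move=> r y ruv; rewrite normrM [`|f0 y|]ger0_norm// ler_wpM2r// dqC.
- exact: (integrableZl measurableT C f0_int).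
Qed.

End convol.

(** * The heat flow *)

(** If the integral vanished then [k * f], hence [f], would be zero almost
    everywhere. *)
Lemma integral_mul_gt0 {R : realType} d (T : measurableType d) (mu : {measure set T -> \bar R})
    (k f : T -> R) : measurable_fun setT k -> measurable_fun setT f ->
  (forall x, 0 < k x) -> (forall x, 0 <= f x) -> (0 < \int[mu]_x (f x)%:E)%E ->
  (0 < \int[mu]_x (k x * f x)%:E)%E.
Proof.
move=> mk mf k0 f0 If; rewrite lt0e integral_ge0 ?andbT; last first.
  by move=> x _; rewrite lee_fin mulr_ge0// ltW.
apply/eqP => I0; suff : (\int[mu]_x (f x)%:E = 0)%E by move=> E; rewrite E ltxx in If.
pose g x := k x * f x.
have mkf : measurable_fun setT (EFin \o g).
  by apply/measurable_EFinP; exact: measurable_funM.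
have /(ae_eq_integral_abs mu measurableT mkf) : (\int[mu]_x `|(EFin \o g) x| = 0)%E.
  rewrite -[RHS]I0; apply: eq_integral => x _ /=.
  by rewrite ger0_norm// mulr_ge0// ltW.
move=> kf0; rewrite (ae_eq_integral (cst 0%E))//; first by rewrite integral0.
  exact/measurable_EFinP.
apply: filterS kf0 => x /(_ I)/= [/eqP]; rewrite mulf_eq0 gt_eqF//= => /eqP ->.
by [].
Qed.

Section heat_convolution.
Context {R : realType} {n : nat}.
Implicit Types (s r : R) (x y z u v w : 'rV[R]_n).

(** Completing the square in [w]: the product of two Gaussians is a Gaussian in
    [w] whose mass is the convolution at [v]. *)
Lemma heat_semigroup (s r : R) v w : 0 < s -> 0 < r ->
  heat s (v - w) * heat r w =
  heat (s + r) v * heat (s * r / (s + r)) (w - (r / (s + r)) *: v).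
Proof.
move=> s0 r0; have sr0 : 0 < s + r by exact: addr_gt0.
have sr1 : s + r != 0 by rewrite gt_eqF.
rewrite -!expRD; congr expR.
have p0 : 0 < 2 * pi :> R by rewrite mulr_gt0// pi_gt0.
have -> : 2 * pi * (s * r / (s + r)) = (2 * pi * s) * (2 * pi * r) / (2 * pi * (s + r)).
  by move: pi (pi_gt0 R) => P P0; field; rewrite sr1 gt_eqF.
have a0 : 0 < 2 * pi * s by rewrite mulr_gt0.
have b0 : 0 < 2 * pi * r by rewrite mulr_gt0.
have c0 : 0 < 2 * pi * (s + r) by rewrite mulr_gt0.
have -> : ln (2 * pi * s * (2 * pi * r) / (2 * pi * (s + r))) =
    ln (2 * pi * s) + ln (2 * pi * r) - ln (2 * pi * (s + r)).
  by rewrite ln_div ?posrE//; [rewrite lnM|rewrite mulr_gt0].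
rewrite !sqnormB sqnormZ dotZr (dotC w v).
move: (ln _) (ln _) (ln _) (sqnorm v) (sqnorm w) (dot v w) => a b c d e f.
by field; rewrite sr1 (gt_eqF s0) (gt_eqF r0).
Qed.

Lemma integral_heat_shift s v : 0 < s ->
  (\int[lebesgue_rV n]_w (heat s (w - v))%:E = 1)%E.
Proof.
move=> s0; rewrite -(integral_heat n s0).
apply: (@ge0_integral_rV_translate _ _ (- v) (fun w => (heat s w)%:E)).
  by apply/measurable_EFinP; exact: measurable_heat_fun.
by move=> x; rewrite lee_fin expR_ge0.
Qed.

Lemma measurable_heat_shift s v : measurable_fun setT (fun w => (heat s (w - v))%:E).
Proof.
apply/measurable_EFinP/measurable_heat_fun.
exact: measurable_sub_fun.
Qed.

Lemma integral_heat_heat (s r : R) v : 0 < s -> 0 < r ->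
  (\int[lebesgue_rV n]_w (heat s (v - w) * heat r w)%:E = (heat (s + r) v)%:E)%E.
Proof.
move=> s0 r0; under eq_integral do rewrite heat_semigroup// EFinM.
rewrite ge0_integralZl_EFin ?expR_ge0//; last 2 first.
- by move=> w _; rewrite lee_fin expR_ge0.
- exact: measurable_heat_shift.
by rewrite integral_heat_shift ?mule1// divr_gt0 ?mulr_gt0// addr_gt0.
Qed.

(** Completing the square in [w] again; the tilt by [y] recentres the Gaussian
    at [r *: y]. *)
Lemma expR_dot_heat (r : R) y w : 0 < r ->
  expR (dot w y) * heat r w = expR (r / 2 * sqnorm y) * heat r (w - r *: y).
Proof.
move=> r0; rewrite -!expRD; congr expR; rewrite sqnormB sqnormZ dotZr.
move: (ln _) (sqnorm w) (sqnorm y) (dot w y) => a b c d.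
by field; rewrite gt_eqF.
Qed.

Lemma integral_expR_dot_heat (r : R) y : 0 < r ->
  (\int[lebesgue_rV n]_w (expR (dot w y) * heat r w)%:E = (expR (r / 2 * sqnorm y))%:E)%E.
Proof.
move=> r0; under eq_integral do rewrite expR_dot_heat// EFinM.
rewrite ge0_integralZl_EFin ?expR_ge0//; last 2 first.
- by move=> w _; rewrite lee_fin expR_ge0.
- exact: measurable_heat_shift.
by rewrite integral_heat_shift ?mule1.
Qed.

Lemma bmeas_heat_family s : 0 < s ->
  [/\ bmeas (heat s : 'rV[R]_n -> R), (forall i, bmeas (heat1 i s : 'rV[R]_n -> R)),
      (forall i, bmeas (heat2 i s : 'rV[R]_n -> R)) & bmeas (heatt s : 'rV[R]_n -> R)].
Proof.
move=> s0; have [C C0 HC] := @heat_family_dom R n s s s0 (lexx s).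
have D u : C * heat (4 * s) (u - 0) <= C * heat (4 * s) (0 : 'rV[R]_n).
  by rewrite ler_pM2l// heat_le// mulr_gt0.
have {}HC u := HC s u 0; have s11 : s <= s <= s by rewrite lexx.
have m0 : sqnorm (0 : 'rV[R]_n) <= 1 by rewrite sqnorm0.
have B (q : 'rV[R]_n -> R) : measurable_fun setT q -> (forall u, `|q u| <= C * heat (4 * s) (u - 0)) -> bmeas q.
  by move=> mq H; split=> //; eexists => u; exact: le_trans (H u) (D u).
split.
- apply: B => [|u]; first exact: measurable_heat_fun.
  by rewrite ger0_norm ?expR_ge0//; have [] := HC u s11 m0.
- by move=> i; apply: B => [|u]; [exact: measurable_heat1_fun|have [_ /(_ i)] := HC u s11 m0].
- by move=> i; apply: B => [|u]; [exact: measurable_heat2_fun|have [_ _ /(_ i)] := HC u s11 m0].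
- apply: B => [|u]; last by have [] := HC u s11 m0.
  apply: measurable_funM => //; apply: measurable_sum => i.
  exact: measurable_heat2_fun.
Qed.

End heat_convolution.

Section heat_flow.
Context {R : realType} {n : nat}.
Local Notation mu := (lebesgue_rV n).
Variable f0 : 'rV[R]_n -> R.
Hypothesis mf0 : measurable_fun setT f0.
Hypothesis f0_ge0 : forall y, 0 <= f0 y.
Hypothesis f0_int : mu.-integrable setT (EFin \o f0).
Implicit Types (s r : R) (x y z u v w : 'rV[R]_n).

Definition flow s := convol f0 (heat s).
Definition flow1 i s := convol f0 (heat1 i s).
Definition flow2 i s := convol f0 (heat2 i s).
Definition flowt s := convol f0 (heatt s).

Lemma flow_ge0 s x : 0 <= flow s x.
Proof. by apply: convol_ge0 => // u; exact: expR_ge0. Qed.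

Lemma flowtE s x : 0 < s -> flowt s x = 2^-1 * \sum_i flow2 i s x.
Proof.
move=> s0; have [_ _ b2 _] := @bmeas_heat_family R n s s0.
have [bs E] := convol_sum mf0 f0_ge0 f0_int x b2.
by rewrite /flowt /heatt convolZ// E.
Qed.

(** The kernel bounds are integrated against the density. *)
Lemma flow_dom s1 s2 : 0 < s1 -> s1 <= s2 ->
  exists2 C, 0 < C & forall s x v, s1 <= s <= s2 -> sqnorm v <= 1 ->
  [/\ flow s (x + v) <= C * flow (4 * s2) x,
      (forall i, `|flow1 i s (x + v)| <= C * flow (4 * s2) x),
      (forall i, `|flow2 i s (x + v)| <= C * flow (4 * s2) x) &
      `|flowt s (x + v)| <= C * flow (4 * s2) x].
Proof.
move=> s10 s12; have [C C0 HC] := @heat_family_dom R n _ _ s10 s12.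
exists C => // s x v s1s2 v1.
have s0 : 0 < s by case/andP: s1s2 => s1s _; exact: lt_le_trans s1s.
have s40 : 0 < 4 * s2 by rewrite mulr_gt0// (lt_le_trans s10).
have [b b1 b2 bt] := @bmeas_heat_family R n s s0.
have [b4 _ _ _] := @bmeas_heat_family R n (4 * s2) s40.
have H q : bmeas q -> (forall u, `|q u| <= C * heat (4 * s2) (u - v)) ->
    `|convol f0 q (x + v)| <= C * flow (4 * s2) x.
  move=> bq Hq; rewrite convol_shift /flow -convolZ//.
  apply: convol_norm_le => //; [exact: bmeas_shift|exact: bmeasZ|].
  by move=> u; rewrite (le_trans (Hq _))// addrK.
split.
- apply: le_trans (ler_norm _) (H _ b _) => u.
  by rewrite ger0_norm ?expR_ge0//; have [] := HC s u v s1s2 v1.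
- by move=> i; apply: H => // u; have [_ /(_ i)] := HC s u v s1s2 v1.
- by move=> i; apply: H => // u; have [_ _ /(_ i)] := HC s u v s1s2 v1.
- by apply: H => // u; have [] := HC s u v s1s2 v1.
Qed.

Lemma is_derive_flow_coord i s (r : R) x : 0 < s ->
  is_derive r 1 (fun r => flow s (x + r *: delta_mx 0 i)) (flow1 i s (x + r *: delta_mx 0 i)).
Proof.
move=> s0; have [b b1 _ _] := @bmeas_heat_family R n s s0.
have [_ [C HC]] := b1 i.
rewrite /flow /flow1 convol_shift; under eq_fun do rewrite convol_shift.
apply: (@is_derive_convol _ _ _ mf0 f0_ge0 f0_int (fun r u => heat s (u + r *: delta_mx 0 i))
  (fun r u => heat1 i s (u + r *: delta_mx 0 i)) C r (r - 1) (r + 1)).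
- by rewrite ltrBlDr ltrDl ltr01.
- by move=> t _; exact: bmeas_shift.
- by move=> t z _; exact: is_derive_heat_coord.
- by move=> t z _; exact: HC.
Qed.

Lemma is_derive_flow1_coord i s (r : R) x : 0 < s ->
  is_derive r 1 (fun r => flow1 i s (x + r *: delta_mx 0 i)) (flow2 i s (x + r *: delta_mx 0 i)).
Proof.
move=> s0; have [b b1 b2 _] := @bmeas_heat_family R n s s0.
have [_ [C HC]] := b2 i.
rewrite /flow1 /flow2 convol_shift; under eq_fun do rewrite convol_shift.
apply: (@is_derive_convol _ _ _ mf0 f0_ge0 f0_int (fun r u => heat1 i s (u + r *: delta_mx 0 i))
  (fun r u => heat2 i s (u + r *: delta_mx 0 i)) C r (r - 1) (r + 1)).
- by rewrite ltrBlDr ltrDl ltr01.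
- by move=> t _; exact: bmeas_shift.
- by move=> t z _; exact: is_derive_heat1_coord.
- by move=> t z _; exact: HC.
Qed.

Lemma is_derive_flow_time s x : 0 < s -> is_derive s 1 (flow ^~ x) (flowt s x).
Proof.
move=> s0; have s12 : s / 2 <= 2 * s by lra.
have s10 : 0 < s / 2 by lra.
have [C C0 HC] := @heat_family_dom R n _ _ s10 s12.
apply: (@is_derive_convol _ _ _ mf0 f0_ge0 f0_int (fun s u => heat s u)
  (fun s u => heatt s u) (C * heat (4 * (2 * s)) (0 : 'rV[R]_n)) s (s / 2) (2 * s)) => //.
- by apply/andP; lra.
- by move=> r /andP[r0 _]; have [] := @bmeas_heat_family R n r (lt_trans s10 r0).
- by move=> r z /andP[r0 _]; apply: is_derive_heat_time; exact: lt_trans r0.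
- move=> r u /andP[r0 r1]; have m0 : sqnorm (0 : 'rV[R]_n) <= 1 by rewrite sqnorm0.
  have r01 : s / 2 <= r <= 2 * s by rewrite !ltW.
  have [_ _ _ H] := HC r u 0 r01 m0.
  by apply: le_trans H _; rewrite ler_pM2l// heat_le//; lra.
Qed.

Hypothesis f0_gt0 : (0 < \int[mu]_x (f0 x)%:E)%E.

Lemma convol_gt0 q x : bmeas q -> (forall u, 0 < q u) -> 0 < convol f0 q x.
Proof.
move=> bq q0; rewrite -lte_fin EFin_convol//.
apply: (integral_mul_gt0 (k := fun y => q (x - y))) => //.
by apply: measurableT_comp; [exact: bq.1|exact: measurable_sub_fun].
Qed.

Lemma flow_gt0 s x : 0 < s -> 0 < flow s x.
Proof.
move=> s0; have [b _ _ _] := @bmeas_heat_family R n s s0.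
by apply: convol_gt0 => // u; exact: heat_gt0.
Qed.

(** In [heat2] only the term [- s^-1 * heat s] is negative. *)
Lemma flow2_ge i s x : 0 < s -> - s^-1 * flow s x <= flow2 i s x.
Proof.
move=> s0; have [b _ b2 _] := @bmeas_heat_family R n s s0.
rewrite /flow -convolZ//; apply: convol_le => //; first exact: bmeasZ.
move=> u; rewrite /heat2 ler_wpM2r ?expR_ge0//.
by rewrite lerDr divr_ge0 ?sqr_ge0.
Qed.

(** Cauchy-Schwarz inequality for the weight [heat s (x - y) * f0 y]: there
    [flow1] integrates [- u i / s] and [flow2 + flow / s] integrates its square,
    with [u = x - y]. *)
Lemma flow1_sqr i s x : 0 < s ->
  flow1 i s x ^+ 2 <= flow s x * (flow2 i s x + s^-1 * flow s x).
Proof.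
move=> s0; have [b b1 b2 _] := @bmeas_heat_family R n s s0.
have h0 := flow_gt0 x s0.
(* The value of [m] that minimises the integral of [(u i / s + m)^2]. *)
pose m := flow1 i s x / flow s x.
have : 0 <= convol f0 (fun u => heat2 i s u + (s^-1 + m ^+ 2) * heat s u + (- 2 * m) * heat1 i s u) x.
  apply: convol_ge0 => // u; rewrite /heat2 /heat1.
  move: m (heat s u) (heat_gt0 s u) (u 0 i) => {}m E E0 c.
  have -> : (c ^+ 2 / s ^+ 2 - s^-1) * E + (s^-1 + m ^+ 2) * E + - 2 * m * (- (c / s) * E) =
    (c / s + m) ^+ 2 * E by field; rewrite gt_eqF.
  by rewrite mulr_ge0 ?sqr_ge0 ?ltW.
have bh := bmeasZ (s^-1 + m ^+ 2) b; have bh1 := bmeasZ (- 2 * m) (b1 i).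
rewrite convolD//; last exact: bmeasD.
rewrite convolD// !convolZ// -/(flow s x) -/(flow1 i s x) -/(flow2 i s x).
move=> H; have : 0 <= flow s x * (flow2 i s x + (s^-1 + m ^+ 2) * flow s x + - 2 * m * flow1 i s x).
  by rewrite mulr_ge0// ltW.
have -> : flow1 i s x = m * flow s x by rewrite /m divfK// gt_eqF.
by nra.
Qed.

Lemma flow_mono s s' x : 0 < s -> s <= s' ->
  flow s x <= expR (n%:R / 2 * (ln (2 * pi * s') - ln (2 * pi * s))) * flow s' x.
Proof.
move=> s0 ss'; have s'0 := lt_le_trans s0 ss'.
have [b _ _ _] := @bmeas_heat_family R n s s0.
have [b' _ _ _] := @bmeas_heat_family R n s' s'0.
rewrite /flow -convolZ//; apply: convol_le => //; first exact: bmeasZ.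
by move=> u; exact: heat_mono.
Qed.

Lemma flow_bounded s : 0 < s -> exists2 C, 0 < C & forall x, flow s x <= C.
Proof.
move=> s0; have [b _ _ _] := @bmeas_heat_family R n s s0.
pose h0 := heat s (0 : 'rV[R]_n).
have bc : bmeas (cst h0 : 'rV[R]_n -> R) by split=> //; exists `|h0|.
exists (convol f0 (cst h0) 0) => [|x]; first by apply: convol_gt0 => // u; exact: heat_gt0.
by apply: (convol_le mf0 f0_ge0 f0_int x b bc) => u; exact: heat_le.
Qed.

(** Since [|x - y|^2 <= 2 |x|^2 + 2 |y|^2], the kernel [heat s (x - y)] is at
    least a constant times [heat (s / 2) x * heat (s / 2) y], and the second
    factor is integrated against the density. *)
Lemma flow_lower s : 0 < s ->
  exists2 c, 0 < c & forall x, c * heat (s / 2) x <= flow s x.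
Proof.
move=> s0; have s20 : 0 < s / 2 by rewrite divr_gt0.
have [b _ _ _] := @bmeas_heat_family R n s s0.
have [b2 _ _ _] := @bmeas_heat_family R n (s / 2) s20.
(* [E] compensates the normalisations of the three Gaussians. *)
pose E := expR (n%:R / 2 * ln (2 * pi * (s / 2)) + (n%:R / 2 * ln (2 * pi * (s / 2))) - n%:R / 2 * ln (2 * pi * s)).
exists (E * convol f0 (heat (s / 2)) 0) => [|x].
  by rewrite mulr_gt0 ?expR_gt0// convol_gt0// => u; exact: heat_gt0.
rewrite mulrAC -RintegralZl//; last exact: convol_integrable.
apply: le_Rintegral => //.
- by apply: (integrableZl measurableT _ (convol_integrable mf0 f0_ge0 f0_int _ b2)).
- exact: convol_integrable.
move=> y _; rewrite mulrA ler_wpM2r// -!expRD ler_expR.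
have H : sqnorm (x - y) / (2 * s) <= sqnorm x / (2 * (s / 2)) + sqnorm (0 - y) / (2 * (s / 2)).
  rewrite -mulrDl (_ : 2 * (s / 2) = s); last by field.
  rewrite ler_pdivrMr ?mulr_gt0// -mulrA [s^-1 * _]mulrC -mulrA mulfV ?gt_eqF// mulr1.
  by rewrite sub0r -scaleN1r sqnormZ sqrrN expr1n mul1r scaleN1r mulrDl mulrC [sqnorm y * _]mulrC sqnormB_le.
lra.
Qed.

Lemma measurable_flow s : measurable_fun setT (flow s).
Proof. by apply: measurable_convol => //; exact: measurable_heat_fun. Qed.

(** The heat flow preserves mass: integrate the kernel first. *)
Lemma integral_flow s : 0 < s ->
  (\int[mu]_x (flow s x)%:E = \int[mu]_y (f0 y)%:E)%E.
Proof.
move=> s0; have [b _ _ _] := @bmeas_heat_family R n s s0.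
under eq_integral do rewrite EFin_convol//.
rewrite (@fubini_tonelli _ _ _ _ _ _ _ (fun z : 'rV[R]_n * 'rV[R]_n => (heat s (z.1 - z.2) * f0 z.2)%:E))/=; last 2 first.
- apply/measurable_EFinP/measurable_funM; last exact: measurableT_comp.
  by apply: measurable_heat_fun; exact: measurable_sub_fun.
- by move=> z; rewrite lee_fin mulr_ge0// expR_ge0.
apply: eq_integral => y _; under eq_integral do rewrite mulrC EFinM.
rewrite ge0_integralZl_EFin//; last 2 first.
- by move=> w _; rewrite lee_fin expR_ge0.
- exact: measurable_heat_shift.
by rewrite integral_heat_shift ?mule1.
Qed.

(** Tonelli's theorem reduces this to the convolution of two Gaussians. *)
Lemma flow_semigroup s r x : 0 < s -> 0 < r ->
  (\int[mu]_w (flow s (x - w) * heat r w)%:E = (flow (s + r) x)%:E)%E.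
Proof.
move=> s0 r0; have sr0 : 0 < s + r by exact: addr_gt0.
have [b _ _ _] := @bmeas_heat_family R n s s0.
have [b' _ _ _] := @bmeas_heat_family R n (s + r) sr0.
transitivity (\int[mu]_w \int[mu]_y (heat s (x - w - y) * heat r w * f0 y)%:E)%E.
  apply: eq_integral => w _; rewrite mulrC EFinM EFin_convol// -ge0_integralZl_EFin ?expR_ge0//.
  - by apply: eq_integral => y _; rewrite -EFinM; congr EFin; ring.
  - by move=> y _; rewrite lee_fin mulr_ge0// expR_ge0.
  - apply/measurable_EFinP/measurable_funM => //.
    by apply: measurable_heat_fun; exact: measurable_sub_fun.
rewrite (@fubini_tonelli _ _ _ _ _ _ _ (fun z : 'rV[R]_n * 'rV[R]_n => (heat s (x - z.1 - z.2) * heat r z.1 * f0 z.2)%:E))/=; last 2 first.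
- apply/measurable_EFinP/measurable_funM; last exact: measurableT_comp.
  apply: measurable_funM; last exact: measurable_heat_fun.
  by apply: measurable_heat_fun; apply: measurable_sub_fun => //; exact: measurable_sub_fun.
- by move=> z; rewrite lee_fin !mulr_ge0// expR_ge0.
rewrite EFin_convol//; apply: eq_integral => y _.
under eq_integral do rewrite mulrC EFinM addrAC.
rewrite ge0_integralZl_EFin//.
- by rewrite integral_heat_heat// -EFinM mulrC.
- by move=> w _; rewrite lee_fin mulr_ge0// expR_ge0.
- apply/measurable_EFinP/measurable_funM; last exact: measurable_heat_fun.
  by apply: measurable_heat_fun; exact: measurable_sub_fun.
Qed.

End heat_flow.

(** * The tilted mass *)

Section tilted_mass.
Context {R : realType} {n : nat}.
Local Notation mu := (lebesgue_rV n).
Variable f0 : 'rV[R]_n -> R.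
Hypothesis mf0 : measurable_fun setT f0.
Hypothesis f0_ge0 : forall y, 0 <= f0 y.
Hypothesis f0_int : mu.-integrable setT (EFin \o f0).
Hypothesis f0_gt0 : (0 < \int[mu]_x (f0 x)%:E)%E.
Variable p : R.
Hypothesis p0 : 0 < p.
Implicit Types (s r : R) (x y z u v w : 'rV[R]_n).

Local Notation flow := (flow f0).
Local Notation flow_ge0 := (flow_ge0 f0_ge0).
Local Notation flow_gt0 := (flow_gt0 mf0 f0_ge0 f0_int f0_gt0).

(** [tilt] is the unnormalised density of the measure [d phi^{p,y}] in the
    variables of the heat flow, and [tmass] its total mass, possibly infinite. *)
Definition tilt s y z : R := expR (p * dot z y) * flow s z `^ (p + 1).
Definition tmass s y : \bar R := (\int[mu]_z (tilt s y z)%:E)%E.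

Lemma tilt_ge0 s y z : 0 <= tilt s y z.
Proof. by rewrite mulr_ge0 ?expR_ge0// powR_ge0. Qed.

Lemma tilt_gt0 s y z : 0 < s -> 0 < tilt s y z.
Proof. by move=> s0; rewrite mulr_gt0 ?expR_gt0// powR_gt0// flow_gt0. Qed.

Lemma measurable_powR_fun d (T : measurableType d) (f : T -> R) a :
  measurable_fun setT f -> measurable_fun setT (fun t => f t `^ a).
Proof.
by move=> mf; apply: (@measurableT_comp _ _ _ _ _ _ (fun x : R => x `^ a) _ f).
Qed.

Lemma measurable_tilt_fun d (T : measurableType d) s (f g : T -> 'rV[R]_n) :
  measurable_fun setT f -> measurable_fun setT g ->
  measurable_fun setT (fun t => tilt s (f t) (g t)).
Proof.
move=> mf mg; apply: measurable_funM.
  apply: (measurableT_comp (@measurable_expR R)).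
  by apply: measurable_funM => //; exact: measurable_dot_fun.
apply: measurable_powR_fun; apply: measurableT_comp => //.
exact: measurable_flow.
Qed.

Lemma tmass_ge0 s y : (0 <= tmass s y)%E.
Proof. by apply: integral_ge0 => z _; rewrite lee_fin tilt_ge0. Qed.

(** The flow itself is nondecreasing in [s] up to the normalisation of the
    Gaussian. *)
Lemma tmass_mono s s' y : 0 < s -> s <= s' ->
  (tmass s y <= (expR (n%:R / 2 * (ln (2 * pi * s') - ln (2 * pi * s))) `^ (p + 1))%:E * tmass s' y)%E.
Proof.
move=> s0 ss'; have s'0 := lt_le_trans s0 ss'.
rewrite -ge0_integralZl_EFin ?powR_ge0//; last 2 first.
- by move=> z _; rewrite lee_fin tilt_ge0.
- by apply/measurable_EFinP; exact: measurable_tilt_fun.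
apply: ge0_le_integral => //.
- by move=> z _; rewrite lee_fin tilt_ge0.
- by apply/measurable_EFinP; exact: measurable_tilt_fun.
- apply/measurable_EFinP; apply: measurable_funM => //; exact: measurable_tilt_fun.
move=> z _; rewrite -EFinM lee_fin /tilt mulrCA ler_pM2l ?expR_gt0//.
rewrite -powRM ?expR_ge0 ?flow_ge0//.
have p1 : 0 <= p + 1 by rewrite addr_ge0// ltW.
have h0 := flow_ge0 s z; have h0' := flow_ge0 s' z.
apply: (ge0_ler_powR p1); rewrite ?nnegrE; [exact: h0| |exact: flow_mono].
exact: mulr_ge0 (expR_ge0 _) h0'.
Qed.

(** The graph of the power [p + 1] lies above its tangent at [m]; this is
    Young's inequality with exponents [p + 1] and [(p + 1) / p], and integrating
    it gives Jensen's inequality. *)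
Lemma powR_tangent (m X : R) : 0 <= m -> 0 <= X ->
  (p + 1) * m `^ p * X <= X `^ (p + 1) + p * m `^ (p + 1).
Proof.
move=> m0 X0; have p1 : 0 < p + 1 by rewrite addr_gt0.
have := @conjugate_powR R X (m `^ p) (p + 1) ((p + 1) / p) X0 (powR_ge0 _ _).
rewrite divr_gt0// p1 => /(_ isT isT).
rewrite -powRrM mulrCA divff ?gt_eqF// mulr1.
have -> : (p + 1)^-1 + ((p + 1) / p)^-1 = 1 by field; rewrite !gt_eqF.
move=> /(_ erefl); rewrite -(ler_pM2l p1).
have -> : (p + 1) * (X `^ (p + 1) / (p + 1) + m `^ (p + 1) / ((p + 1) / p)) =
  X `^ (p + 1) + p * m `^ (p + 1).
  by move: (X `^ _) (m `^ _) => a b; field; rewrite !gt_eqF.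
by rewrite -mulrA [m `^ p * X]mulrC.
Qed.

(** [flow (s + r) z] is the mean of [flow s (z - w)] for the Gaussian of
    variance [r] in [w], and the power [p + 1] is convex. *)
Lemma flow_jensen s r z : 0 < s -> 0 < r ->
  ((flow (s + r) z `^ (p + 1))%:E <= \int[mu]_w (flow s (z - w) `^ (p + 1) * heat r w)%:E)%E.
Proof.
move=> s0 r0; have sr0 : 0 < s + r by exact: addr_gt0.
set m := flow (s + r) z; have m0 : 0 < m by exact: flow_gt0.
have mfl : measurable_fun setT (fun w => flow s (z - w)).
  by apply: measurableT_comp; [exact: measurable_flow|exact: measurable_sub_fun].
have mh : measurable_fun setT (heat r : 'rV[R]_n -> R) by exact: measurable_heat_fun.
have p1 : 0 < p + 1 by rewrite addr_gt0.
have mL : measurable_fun setT (fun w => (flow s (z - w) * heat r w)%:E).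
  by apply/measurable_EFinP; exact: measurable_funM.
have mP : measurable_fun setT (fun w => (flow s (z - w) `^ (p + 1) * heat r w)%:E).
  by apply/measurable_EFinP; apply: measurable_funM => //; exact: measurable_powR_fun.
have mH : measurable_fun setT (fun w : 'rV[R]_n => (p * m `^ (p + 1))%:E * (heat r w)%:E)%E.
  by apply: emeasurable_funM => //; exact/measurable_EFinP.
have H : (\int[mu]_w (((p + 1) * m `^ p)%:E * (flow s (z - w) * heat r w)%:E) <=
   \int[mu]_w ((flow s (z - w) `^ (p + 1) * heat r w)%:E + (p * m `^ (p + 1))%:E * (heat r w)%:E))%E.
  apply: ge0_le_integral => //.
  - move=> w _; rewrite -EFinM lee_fin.
    by apply: mulr_ge0; [exact: mulr_ge0 (ltW p1) (powR_ge0 _ _)|exact: mulr_ge0 (flow_ge0 _ _) (expR_ge0 _)].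
  - by apply: emeasurable_funM.
  - exact: emeasurable_funD.
  - move=> w _; rewrite -!EFinM -EFinD lee_fin !mulrA -mulrDl ler_wpM2r ?expR_ge0//.
    exact: powR_tangent (ltW m0) (flow_ge0 _ _).
move: H; rewrite ge0_integralZl_EFin//; last 2 first.
- by move=> w _; rewrite lee_fin; exact: mulr_ge0 (flow_ge0 _ _) (expR_ge0 _).
- by rewrite mulr_ge0 ?powR_ge0// ltW.
rewrite flow_semigroup// ge0_integralD//; last 2 first.
- by move=> w _; rewrite lee_fin mulr_ge0 ?expR_ge0// powR_ge0.
- by move=> w _; rewrite -EFinM lee_fin !mulr_ge0 ?expR_ge0 ?powR_ge0// ltW.
rewrite ge0_integralZl_EFin ?integral_heat//; last 3 first.
- by move=> w _; rewrite lee_fin expR_ge0.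
- exact/measurable_EFinP.
- by rewrite mulr_ge0 ?powR_ge0// ltW.
rewrite mule1 -EFinM -leeBlDr// -EFinB -/m; apply: le_trans; rewrite lee_fin.
rewrite -mulrA powRD; last by rewrite (gt_eqF m0) implybT.
rewrite (powRr1 (ltW m0)); lra.
Qed.

(** Jensen's inequality bounds [h_(s+r)^(p+1)] by the convolution of [h_s^(p+1)]
    with a Gaussian, and integrating against [e^(p <z, y>)] turns a convolution
    into a product of Laplace transforms. *)
Lemma tmass_semigroup s r y : 0 < s -> 0 < r ->
  (tmass (s + r) y <= (expR (r / 2 * sqnorm (p *: y)))%:E * tmass s y)%E.
Proof.
move=> s0 r0; have sr0 : 0 < s + r by exact: addr_gt0.
have mT : measurable_fun setT (fun t : 'rV[R]_n * 'rV[R]_n =>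
    (expR (p * dot t.1 y) * (flow s (t.1 - t.2) `^ (p + 1) * heat r t.2))%:E).
  apply/measurable_EFinP; apply: measurable_funM.
    apply: (measurableT_comp (@measurable_expR R)).
    by apply: measurable_funM => //; exact: measurable_dot_fun.
  apply: measurable_funM; last exact: measurable_heat_fun.
  apply: measurable_powR_fun; apply: measurableT_comp; first exact: measurable_flow.
  exact: measurable_sub_fun.
have T0 (t : 'rV[R]_n * 'rV[R]_n) : (0 <=
    (expR (p * dot t.1 y) * (flow s (t.1 - t.2) `^ (p + 1) * heat r t.2))%:E)%E.
  by rewrite lee_fin !mulr_ge0 ?expR_ge0 ?powR_ge0.
apply: (@le_trans _ _ (\int[mu]_z \int[mu]_w
    (expR (p * dot z y) * (flow s (z - w) `^ (p + 1) * heat r w))%:E)%E).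
  apply: ge0_le_integral => //.
  - by move=> z _; rewrite lee_fin tilt_ge0.
  - by apply/measurable_EFinP; exact: measurable_tilt_fun.
  - exact: (measurable_integral_param mT).
  move=> z _; under eq_integral do rewrite EFinM.
  rewrite ge0_integralZl_EFin ?expR_ge0//; last 2 first.
  - by move=> w _; rewrite lee_fin mulr_ge0 ?expR_ge0 ?powR_ge0.
  - apply/measurable_EFinP; apply: measurable_funM; last exact: measurable_heat_fun.
    apply: measurable_powR_fun; apply: measurableT_comp; first exact: measurable_flow.
    exact: measurable_sub_fun.
  by rewrite /tilt EFinM lee_pmul2l ?lte_fin ?expR_gt0// flow_jensen.
rewrite (fubini_tonelli _ mT T0)/=.
rewrite -integral_expR_dot_heat// -ge0_integralZr//; last 2 first.
- by move=> w _; rewrite lee_fin mulr_ge0 ?expR_ge0.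
- exact: tmass_ge0.
rewrite le_eqVlt; apply/orP; left; apply/eqP; apply: eq_integral => w _.
rewrite -(ge0_integral_rV_translate w); last 2 first.
- apply/measurable_EFinP; apply: measurable_funM.
    apply: (measurableT_comp (@measurable_expR R)).
    by apply: measurable_funM => //; exact: measurable_dot_fun.
  apply: measurable_funM => //.
  apply: measurable_powR_fun; apply: measurableT_comp; first exact: measurable_flow.
  exact: measurable_sub_fun.
- by move=> z; rewrite lee_fin !mulr_ge0 ?expR_ge0 ?powR_ge0.
rewrite -ge0_integralZl_EFin ?mulr_ge0 ?expR_ge0//; last 2 first.
- by move=> z _; rewrite lee_fin tilt_ge0.
- by apply/measurable_EFinP; exact: measurable_tilt_fun.
apply: eq_integral => z _; rewrite -EFinM; congr EFin.
  by rewrite addrK /tilt dotDl mulrDr expRD dotZr; ring.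
apply/measurable_EFinP; apply: measurable_funM; last exact: measurable_heat_fun.
by apply: (measurableT_comp (@measurable_expR R)); exact: measurable_dot_fun.
Qed.

(** For [s' <= s] by monotonicity, for [s <= s'] by the semigroup inequality:
    finiteness of the mass does not depend on time, so the domain of integration
    in [y] stays fixed. *)
Lemma tmass_fin s s' y : 0 < s -> 0 < s' -> (tmass s y < +oo)%E -> (tmass s' y < +oo)%E.
Proof.
move=> s0 s'0 fs; have [s's|ss'] := leP s' s.
  apply: le_lt_trans (tmass_mono y s'0 s's) _.
  by rewrite lte_mul_pinfty// lee_fin powR_ge0.
have r0 : 0 < s' - s by rewrite subr_gt0.
have -> : s' = s + (s' - s) by ring.
apply: le_lt_trans (tmass_semigroup y s0 r0) _.
by rewrite lte_mul_pinfty// lee_fin expR_ge0.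
Qed.

Lemma heat_powR s x : 0 < s ->
  heat s x `^ (p + 1) =
  expR (n%:R / 2 * (ln (2 * pi * (s / (p + 1))) - (p + 1) * ln (2 * pi * s))) * heat (s / (p + 1)) x.
Proof.
move=> s0; rewrite /heat -expRM -expRD; congr expR.
have p1 : 0 < p + 1 by rewrite addr_gt0.
move: (ln _) (ln _) (sqnorm x) => a b c.
by field; rewrite (gt_eqF s0) (gt_eqF p1).
Qed.

(** The Gaussian lower bound of the flow, raised to the power [p + 1], has an
    explicit Laplace transform. *)
Lemma tmass_lower s : 0 < s -> exists c k,
  [/\ 0 < c, 0 < k & forall y, ((c * expR (k * sqnorm y))%:E <= tmass s y)%E].
Proof.
move=> s0; have [c c0 Hc] := flow_lower mf0 f0_ge0 f0_int f0_gt0 s0.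
have s20 : 0 < s / 2 by rewrite divr_gt0.
have p1 : 0 < p + 1 by rewrite addr_gt0.
set E := expR (n%:R / 2 * (ln (2 * pi * (s / 2 / (p + 1))) - (p + 1) * ln (2 * pi * (s / 2)))).
exists (c `^ (p + 1) * E), (s / 2 / (p + 1) / 2 * p ^+ 2); split.
- by rewrite mulr_gt0 ?powR_gt0 ?expR_gt0.
- by rewrite !mulr_gt0 ?exprn_gt0 ?invr_gt0.
move=> y; rewrite -[_ * p ^+ 2 * _]mulrA -sqnormZ [X in (X <= _)%E]EFinM.
rewrite -integral_expR_dot_heat ?divr_gt0// -ge0_integralZl_EFin; last 4 first.
- by [].
- by move=> z _; rewrite lee_fin mulr_ge0 ?expR_ge0.
- apply/measurable_EFinP; apply: measurable_funM; last exact: measurable_heat_fun.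
  by apply: (measurableT_comp (@measurable_expR R)); exact: measurable_dot_fun.
- by rewrite mulr_ge0 ?powR_ge0 ?expR_ge0.
apply: ge0_le_integral => //.
- by move=> z _; rewrite -EFinM lee_fin !mulr_ge0 ?expR_ge0 ?powR_ge0.
- apply: emeasurable_funM => //.
  apply/measurable_EFinP; apply: measurable_funM; last exact: measurable_heat_fun.
  by apply: (measurableT_comp (@measurable_expR R)); exact: measurable_dot_fun.
- by apply/measurable_EFinP; exact: measurable_tilt_fun.
move=> z _; rewrite -EFinM lee_fin dotZr /tilt mulrCA ler_pM2l ?expR_gt0//.
rewrite -[X in X <= _]mulrA /E -(heat_powR z s20) -powRM ?expR_ge0 ?(ltW c0)//.
have p1' : 0 <= p + 1 by exact: ltW.
have h0 := flow_ge0 s z.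
by rewrite ge0_ler_powR ?nnegrE ?mulr_ge0 ?expR_ge0// ltW.
Qed.

End tilted_mass.

(** * Integration by parts and derivatives of the tilted density *)

Section translation.
Context {R : realType} {n : nat}.
Local Notation mu := (lebesgue_rV n).
Implicit Types (b x : 'rV[R]_n).

Lemma measurable_translate b : measurable_fun setT (fun x : 'rV[R]_n => x + b).
Proof. exact: measurable_add_fun. Qed.

Lemma integral_rV_translate b (f : 'rV[R]_n -> \bar R) : measurable_fun setT f ->
  (\int[mu]_x f (x + b)%R = \int[mu]_x f x)%E.
Proof.
move=> mf; rewrite integralE [RHS]integralE.
rewrite -(ge0_integral_rV_translate b (measurable_funepos mf) (funepos_ge0 f)).
rewrite -(ge0_integral_rV_translate b (measurable_funeneg mf) (funeneg_ge0 f)).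
by congr (_ - _)%E; apply: eq_integral => x _; rewrite ?funeposE ?funenegE.
Qed.

Lemma integrable_rV_translate b (f : 'rV[R]_n -> R) :
  mu.-integrable setT (EFin \o f) -> mu.-integrable setT (EFin \o (fun x => f (x + b))).
Proof.
move=> /integrableP[mf fi]; apply/integrableP; split.
  by apply: (measurableT_comp mf); exact: measurable_translate.
rewrite (integral_rV_translate b (f := fun x => `|(f x)%:E|)%E)//.
exact: measurableT_comp.
Qed.

(** Integration by parts without boundary terms: by translation invariance [\int
    F (x + r e_i) dx] does not depend on [r], so its derivative, computed under
    the integral sign, vanishes. *)
Lemma integral_partial_eq0 (i : 'I_n) (F dF G : 'rV[R]_n -> R) :
  mu.-integrable setT (EFin \o F) ->
  (forall x (r : R), is_derive r 1 (fun r => F (x + r *: delta_mx 0 i)) (dF (x + r *: delta_mx 0 i))) ->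
  (forall x (r : R), `|r| < 1 -> `|dF (x + r *: delta_mx 0 i)| <= G x) ->
  mu.-integrable setT (EFin \o G) ->
  \int[mu]_x dF x = 0.
Proof.
move=> Fi dFE dFG Gi.
have I1 (r : R) : -1 < r < 1 -> `|r| < 1 by rewrite ltr_norml.
have I0 : (-1 : R) < (0 : R) < (1 : R) by rewrite ltrN10 ltr01.
have := @is_derive_Rintegral R _ _ mu (fun r x => F (x + r *: delta_mx 0 i))
  (fun r x => dF (x + r *: delta_mx 0 i)) G 0 (-1) 1 I0.
have H1 (r : R) : -1 < r < 1 -> mu.-integrable setT (EFin \o (fun x => F (x + r *: delta_mx 0 i))).
  by move=> _; exact: integrable_rV_translate.
have H2 (r : R) x : -1 < r < 1 -> is_derive r 1 (fun r => F (x + r *: delta_mx 0 i)) (dF (x + r *: delta_mx 0 i)).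
  by [].
have H3 (r : R) x : -1 < r < 1 -> `|dF (x + r *: delta_mx 0 i)| <= G x.
  by move=> /I1; exact: dFG.
move=> /(_ H1 H2 H3 Gi) H.
have mF := measurable_int _ Fi.
have E : (fun r : R => \int[mu]_x F (x + r *: delta_mx 0 i)) = cst (\int[mu]_x F x).
  by apply/funext => r; rewrite /Rintegral (integral_rV_translate (r *: delta_mx 0 i) mF).
rewrite E in H; have [_ H'] := H; rewrite derive_cst in H'.
by rewrite H'; apply: eq_Rintegral => x _; rewrite scale0r addr0.
Qed.

End translation.

Section tilted_identities.
Context {R : realType} {n : nat}.
Local Notation mu := (lebesgue_rV n).
Variable f0 : 'rV[R]_n -> R.
Hypothesis mf0 : measurable_fun setT f0.
Hypothesis f0_ge0 : forall y, 0 <= f0 y.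
Hypothesis f0_int : mu.-integrable setT (EFin \o f0).
Hypothesis f0_gt0 : (0 < \int[mu]_x (f0 x)%:E)%E.
Variable p : R.
Hypothesis p0 : 0 < p.
Implicit Types (s r : R) (x y z u v w : 'rV[R]_n).

Local Notation flow := (flow f0).
Local Notation flow1 := (flow1 f0).
Local Notation flow2 := (flow2 f0).
Local Notation flowt := (flowt f0).
Local Notation flow_gt0 := (flow_gt0 mf0 f0_ge0 f0_int f0_gt0).
Local Notation tilt := (tilt f0 p).

(** [score] is the logarithmic derivative of the flow, whereas [score2] and
    [scoret] are the second and the time derivative of the flow divided by the
    flow, not derivatives of [score]. *)
Definition score i s z : R := flow1 i s z / flow s z.
Definition score2 i s z : R := flow2 i s z / flow s z.
Definition scoret s z : R := flowt s z / flow s z.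

(** The Li-Yau inequality in the direction [i]: the second logarithmic
    derivative of the flow, [score2 - score ^+ 2], is at least [- s^-1]. *)
Lemma score_sqr i s z : 0 < s -> score i s z ^+ 2 <= score2 i s z + s^-1.
Proof.
move=> s0; have h0 := flow_gt0 z s0.
have := flow1_sqr mf0 f0_ge0 f0_int f0_gt0 i z s0.
rewrite /score /score2 expr_div_n ler_pdivrMr ?exprn_gt0//.
rewrite (_ : _ * (_ + s^-1 * _) = (flow2 i s z / flow s z + s^-1) * flow s z ^+ 2)//.
by field; rewrite (gt_eqF s0) (gt_eqF h0).
Qed.

Lemma score2_ge i s z : 0 < s -> - s^-1 <= score2 i s z.
Proof.
move=> s0; rewrite ler_pdivlMr ?flow_gt0//; exact: flow2_ge.
Qed.

Lemma scoretE s z : 0 < s -> scoret s z = 2^-1 * \sum_i score2 i s z.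
Proof. by move=> s0; rewrite /scoret flowtE// -mulrA mulr_suml. Qed.

Lemma is_derive_dot_coord i y z r :
  is_derive r 1 (fun r => p * dot (z + r *: delta_mx 0 i) y) (p * y 0 i).
Proof.
under eq_fun do rewrite dotDl dotZl dot_delta.
by apply: is_derive_eq; rewrite /GRing.scale/=; ring.
Qed.

Lemma is_derive_tilt_coord i s y z r : 0 < s ->
  is_derive r 1 (fun r => tilt s y (z + r *: delta_mx 0 i))
    (let x := z + r *: delta_mx 0 i in tilt s y x * ((p + 1) * score i s x + p * y 0 i)).
Proof.
move=> s0 /=.
have H1 := is_derive_expR_comp (is_derive_dot_coord i y z r).
have H2 := is_derive_powR_comp (p + 1) (flow_gt0 (z + r *: delta_mx 0 i) s0)
  (is_derive_flow_coord mf0 f0_ge0 f0_int i r z s0).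
apply: (is_derive_eq (is_deriveM H1 H2)).
by rewrite /tilt /score /GRing.scale/=; ring.
Qed.

Lemma is_derive_tilt_score i s y z r : 0 < s ->
  is_derive r 1 (fun r => let x := z + r *: delta_mx 0 i in tilt s y x * score i s x)
    (let x := z + r *: delta_mx 0 i in
     tilt s y x * (p * y 0 i * score i s x + p * score i s x ^+ 2 + score2 i s x)).
Proof.
move=> s0 /=.
have H1 := is_derive_tilt_coord i y z r s0.
have H2 := is_derive_flow_coord mf0 f0_ge0 f0_int i r z s0.
have H3 := is_derive_flow1_coord mf0 f0_ge0 f0_int i r z s0.
have h0 := flow_gt0 (z + r *: delta_mx 0 i) s0.
have n0 : flow s (z + r *: delta_mx 0 i) != 0 by rewrite gt_eqF.
have H4 : is_derive r 1 (fun r => score i s (z + r *: delta_mx 0 i))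
    (let x := z + r *: delta_mx 0 i in score2 i s x - score i s x ^+ 2).
  apply: (is_derive_eq (is_deriveM H3 (is_deriveV n0 H2))).
  rewrite /score /score2 /= ![_ *: _ :> R]mulrC; field; exact: n0.
apply: (is_derive_eq (is_deriveM H1 H4)) => /=.
by rewrite ![_ *: _ :> R]mulrC; ring.
Qed.

Lemma is_derive_tilt_time s y z : 0 < s ->
  is_derive s 1 (fun s => tilt s y z) (tilt s y z * ((p + 1) * scoret s z)).
Proof.
move=> s0; have H := is_derive_powR_comp (p + 1) (flow_gt0 z s0)
  (is_derive_flow_time mf0 f0_ge0 f0_int z s0).
apply: (is_derive_eq (is_deriveZ _ H)).
by rewrite /tilt /scoret /GRing.scale/=; ring.
Qed.

(** From [h_s <= C h] and [|d h_s| <= C h] for [h = flow (4 * s2)] one gets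
    [h_s^p |d h_s| <= C^(p+1) h^(p+1)] for each derivative. For the square of
    the score this would leave [h_s^(p-1)], a negative power if [p < 1]; there
    the Cauchy-Schwarz bound [score_sqr] is used instead. *)
Lemma tilt_dom s1 s2 y : 0 < s1 -> s1 <= s2 ->
  exists2 C, 0 <= C & forall s z v, s1 <= s <= s2 -> sqnorm v <= 1 ->
  [/\ tilt s y (z + v) <= C * tilt (4 * s2) y z,
      (forall i, tilt s y (z + v) * `|score i s (z + v)| <= C * tilt (4 * s2) y z),
      (forall i, tilt s y (z + v) * `|score2 i s (z + v)| <= C * tilt (4 * s2) y z),
      tilt s y (z + v) * `|scoret s (z + v)| <= C * tilt (4 * s2) y z &
      (forall i, tilt s y (z + v) * score i s (z + v) ^+ 2 <= C * tilt (4 * s2) y z)].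
Proof.
move=> s10 s12; have [C C0 HC] := flow_dom mf0 f0_ge0 f0_int s10 s12.
have s20 : 0 < s2 by exact: lt_le_trans s12.
have s40 : 0 < 4 * s2 by rewrite mulr_gt0.
have p1 : 0 < p + 1 by rewrite addr_gt0.
have grow (a b c : R) : 0 <= a -> 0 <= b -> 0 <= c -> a * b <= a * (1 + c) * b.
  by move=> a0 b0 c0; rewrite ler_wpM2r// ler_peMr// lerDl.
have comb (T X a c d : R) : T <= c * d -> T * X <= c * d -> 0 <= a -> T * (X + a) <= c * (1 + a) * d.
  by move=> H H' a0; nra.
(* [e] bounds the tilt [e^(p <v, y>)] of a shift [v] in the unit ball. *)
pose e := expR (p * ((1 + sqnorm y) / 2)).
pose K := e * C `^ (p + 1).
have e0 : 0 < e by exact: expR_gt0.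
have K0 : 0 <= K by rewrite mulr_ge0 ?powR_ge0 ?(ltW e0).
have si0 : 0 < s1^-1 by rewrite invr_gt0.
exists (K * (1 + s1^-1)); first by rewrite mulr_ge0// addr_ge0// ltW.
move=> s z v s1s2 v1; have [Hf H1 H2 Ht] := HC s z v s1s2 v1.
have /andP[s1s ss2] := s1s2; have s0 : 0 < s by exact: lt_le_trans s1s.
set h4 := flow (4 * s2) z in Hf H1 H2 Ht.
set h := flow s (z + v) in Hf.
have h0 : 0 < h by exact: flow_gt0.
have h40 : 0 < h4 by exact: flow_gt0.
have T40 := tilt_ge0 f0 p (4 * s2) y z.
have T0 := tilt_ge0 f0 p s y (z + v).
have main X : 0 <= X -> X <= C * h4 -> tilt s y (z + v) * (X / h) <= K * tilt (4 * s2) y z.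
  move=> X0 XC.
  have -> : tilt s y (z + v) * (X / h) = expR (p * dot (z + v) y) * (h `^ p * X).
    rewrite /tilt -/h powRD ?(gt_eqF h0) ?implybT// (powRr1 (ltW h0)).
    by field; rewrite (gt_eqF h0).
  have -> : K * tilt (4 * s2) y z = (e * expR (p * dot z y)) * ((C * h4) `^ p * (C * h4)).
    have C40 : 0 < C * h4 by rewrite mulr_gt0.
    rewrite -[X in _ * (_ * X)](powRr1 (ltW C40)) -powRD ?(gt_eqF C40) ?implybT//.
    by rewrite powRM ?ltW// /K /tilt -/h4; ring.
  apply: ler_pM; [exact: expR_ge0|by rewrite mulr_ge0 ?powR_ge0| | ].
  - rewrite -expRD ler_expR dotDl mulrDr addrC lerD2r ler_pM2l//.
    by apply: le_trans (dot_le_sqnorm v y) _; rewrite ler_pM2r// lerD2r.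
  - apply: ler_pM => //; first exact: powR_ge0.
    have C40 : 0 <= C * h4 by rewrite ltW// mulr_gt0.
    by rewrite ge0_ler_powR ?nnegrE ?(ltW p0) ?(ltW h0).
have up X : X <= K * tilt (4 * s2) y z -> X <= K * (1 + s1^-1) * tilt (4 * s2) y z.
  move=> /le_trans; apply; exact: (grow _ _ _ K0 T40 (ltW si0)).
have nrm X : `|X / h| = `|X| / h by rewrite normrM normfV (gtr0_norm h0).
have B : tilt s y (z + v) <= K * tilt (4 * s2) y z.
  by move: (main h (ltW h0) Hf); rewrite (divff (lt0r_neq0 h0)) mulr1; exact.
have B2 i : tilt s y (z + v) * `|score2 i s (z + v)| <= K * tilt (4 * s2) y z.
  by rewrite /score2 nrm; apply: main.
split.
- exact: up.
- by move=> i; apply: up; rewrite /score nrm; apply: main.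
- by move=> i; apply: up.
- by apply: up; rewrite /scoret nrm; apply: main.
- move=> i; apply: (@le_trans _ _ (tilt s y (z + v) * (`|score2 i s (z + v)| + s1^-1))).
    rewrite ler_wpM2l// (le_trans (score_sqr i _ s0))// lerD ?ler_norm//.
    by rewrite lef_pV2.
  exact: comb B (B2 i) (ltW si0).
Qed.

End tilted_identities.

(** * Fisher information of the tilted density *)

Section Rintegral_linear.
Context {R : realType} d {T : measurableType d} (mu : {measure set T -> \bar R}).
Implicit Types f g : T -> R.

Lemma integrableD_real f g : mu.-integrable setT (EFin \o f) -> mu.-integrable setT (EFin \o g) ->
  mu.-integrable setT (EFin \o (fun x => f x + g x)).
Proof. by move=> fi gi; exact: (integrableD measurableT fi gi). Qed.

Lemma integrableZ_real c f : mu.-integrable setT (EFin \o f) ->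
  mu.-integrable setT (EFin \o (fun x => c * f x)).
Proof. by move=> fi; exact: (integrableZl measurableT c fi). Qed.

Lemma Rintegral_sum (I : finType) (F : I -> T -> R) :
  (forall i, mu.-integrable setT (EFin \o F i)) ->
  mu.-integrable setT (EFin \o (fun x => \sum_i F i x)) /\
  \int[mu]_x (\sum_i F i x) = \sum_i \int[mu]_x F i x.
Proof.
move=> Fi; elim: (index_enum I) => [|i s [IH1 IH2]].
  have E : (fun x => \sum_(i <- [::]) F i x) = cst 0 by apply/funext => x; rewrite big_nil.
  rewrite E big_nil; split; first exact: integrable0.
  by rewrite /Rintegral integral0.
have E : (fun x => \sum_(j <- i :: s) F j x) = (fun x => F i x + \sum_(j <- s) F j x).
  by apply/funext => x; rewrite big_cons.
rewrite E big_cons; split; first exact: integrableD_real.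
by rewrite RintegralD// IH2.
Qed.

End Rintegral_linear.

Section tilted_integrals.
Context {R : realType} {n : nat}.
Local Notation mu := (lebesgue_rV n).
Variable f0 : 'rV[R]_n -> R.
Hypothesis mf0 : measurable_fun setT f0.
Hypothesis f0_ge0 : forall y, 0 <= f0 y.
Hypothesis f0_int : mu.-integrable setT (EFin \o f0).
Hypothesis f0_gt0 : (0 < \int[mu]_x (f0 x)%:E)%E.
Variable p : R.
Hypothesis p0 : 0 < p.
Implicit Types (s r : R) (x y z u v w : 'rV[R]_n).

Local Notation tilt := (tilt f0 p).
Local Notation tmass := (tmass f0 p).
Local Notation score := (score f0).
Local Notation score2 := (score2 f0).
Local Notation scoret := (scoret f0).

Lemma measurable_inv_fun d (T : measurableType d) (f : T -> R) :
  (forall t, 0 < f t) -> measurable_fun setT f -> measurable_fun setT (fun t => (f t)^-1).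
Proof.
move=> f_gt0 mf; under eq_fun do rewrite -powR_inv1 ?(ltW (f_gt0 _))//.
exact: measurable_powR_fun.
Qed.

Lemma measurable_score i s : 0 < s -> measurable_fun setT (score i s).
Proof.
move=> s0; apply: measurable_funM.
  by apply: measurable_convol => //; exact: measurable_heat1_fun.
apply: measurable_inv_fun; last exact: measurable_flow.
by move=> t; exact: flow_gt0.
Qed.

Lemma measurable_score2 i s : 0 < s -> measurable_fun setT (score2 i s).
Proof.
move=> s0; apply: measurable_funM.
  by apply: measurable_convol => //; exact: measurable_heat2_fun.
apply: measurable_inv_fun; last exact: measurable_flow.
by move=> t; exact: flow_gt0.
Qed.

(** The mass [tmass] as a real number; it is 0 where [tmass] is infinite. *)
Definition rmass s y : R := \int[mu]_z tilt s y z.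
Definition int_score i s y : R := \int[mu]_z (tilt s y z * score i s z).
Definition int_score_sqr i s y : R := \int[mu]_z (tilt s y z * score i s z ^+ 2).
Definition int_score2 i s y : R := \int[mu]_z (tilt s y z * score2 i s z).
(** The derivative of the logarithm of [tilt] in the coordinate [i]. *)
Definition lscore i s y z : R := (p + 1) * score i s z + p * y 0 i.
(** The Fisher information of the normalised density [tilt / rmass], times
    [rmass]. *)
Definition rfisher s y : R := \int[mu]_z (tilt s y z * \sum_i lscore i s y z ^+ 2).

Variable y : 'rV[R]_n.
(* By [tmass_fin] the time 1 stands for any positive time. *)
Hypothesis yD : (tmass 1 y < +oo)%E.

Lemma tilt_integrable s : 0 < s -> mu.-integrable setT (EFin \o tilt s y).
Proof.
move=> s0; apply/integrableP; split.
  by apply/measurable_EFinP; exact: measurable_tilt_fun.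
under eq_integral do rewrite /= ger0_norm ?tilt_ge0//.
exact: (tmass_fin mf0 f0_ge0 f0_int f0_gt0 p0 ltr01 s0 yD).
Qed.

Lemma EFin_rmass s : 0 < s -> (rmass s y)%:E = tmass s y.
Proof.
move=> s0; rewrite /rmass /Rintegral fineK//.
exact: (integrable_fin_num measurableT (tilt_integrable s0)).
Qed.

Lemma tilt_mul_integrable (X : R -> 'rV[R]_n -> R) s C : 0 < s ->
  measurable_fun setT (X s) ->
  (forall z, tilt s y z * `|X s z| <= C * tilt (4 * s) y z) ->
  mu.-integrable setT (EFin \o (fun z => tilt s y z * X s z)).
Proof.
move=> s0 mX H; apply: (@integrable_le _ _ _ _ (fun z => C * tilt (4 * s) y z)).
- by apply: measurable_funM => //; exact: measurable_tilt_fun.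
- by move=> z; rewrite normrM ger0_norm ?tilt_ge0.
- by apply: integrableZ_real; apply: tilt_integrable; rewrite mulr_gt0.
Qed.

Lemma score_integrable i s : 0 < s ->
  [/\ mu.-integrable setT (EFin \o (fun z => tilt s y z * score i s z)),
      mu.-integrable setT (EFin \o (fun z => tilt s y z * score2 i s z)) &
      mu.-integrable setT (EFin \o (fun z => tilt s y z * score i s z ^+ 2))].
Proof.
move=> s0; have [C C0 HC] := tilt_dom mf0 f0_ge0 f0_int f0_gt0 p0 y s0 (lexx s).
have s11 : s <= s <= s by rewrite lexx.
have m0 : sqnorm (0 : 'rV[R]_n) <= 1 by rewrite sqnorm0.
have {}HC z := HC s z 0 s11 m0.
split.
- apply: (@tilt_mul_integrable (score i) s C) => //; first exact: measurable_score.
  by move=> z; have [_ /(_ i) + _ _ _] := HC z; rewrite addr0.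
- apply: (@tilt_mul_integrable (score2 i) s C) => //; first exact: measurable_score2.
  by move=> z; have [_ _ /(_ i) + _ _] := HC z; rewrite addr0.
- apply: (@tilt_mul_integrable (fun s z => score i s z ^+ 2) s C) => //.
    by apply: measurable_funX; exact: measurable_score.
  by move=> z; have [_ _ _ _ /(_ i)] := HC z; rewrite addr0 ger0_norm// sqr_ge0.
Qed.

Lemma sqnorm_scale_delta i r : `|r| < 1 -> sqnorm (r *: delta_mx 0 i : 'rV[R]_n) <= 1.
Proof.
move=> r1; rewrite sqnormZ sqnorm_delta mulr1 -real_normK ?num_real//.
by rewrite exprn_ile1// ltW.
Qed.

(** The integral of the derivative of [tilt] vanishes. *)
Lemma int_score_eq i s : 0 < s -> (p + 1) * int_score i s y + p * y 0 i * rmass s y = 0.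
Proof.
move=> s0; have [i1 _ _] := score_integrable i s0.
have it := tilt_integrable s0.
have [C C0 HC] := tilt_dom mf0 f0_ge0 f0_int f0_gt0 p0 y s0 (lexx s).
have s11 : s <= s <= s by rewrite lexx.
have s40 : 0 < 4 * s by rewrite mulr_gt0.
have p1 : 0 < p + 1 by rewrite addr_gt0.
have comb (T a b c D e : R) : 0 <= a -> 0 <= b -> T * e <= c * D -> T <= c * D ->
    T * (a * e + b) <= (a * c + b * c) * D.
  by move=> a0 b0 /(ler_wpM2l a0) H1 /(ler_wpM2l b0) H2; lra.
have := @integral_partial_eq0 _ _ i (tilt s y)
  (fun z => tilt s y z * ((p + 1) * score i s z + p * y 0 i))
  (fun z => ((p + 1) * C + `|p * y 0 i| * C) * tilt (4 * s) y z) it.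
have H1 z r := is_derive_tilt_coord mf0 f0_ge0 f0_int f0_gt0 p i y z r s0.
move=> /(_ H1) H.
rewrite -[RHS]H; last 2 first.
- move=> z r r1; have [T0 /(_ i) T1 _ _ _] := HC s z _ s11 (sqnorm_scale_delta i r1).
  rewrite normrM (ger0_norm (tilt_ge0 _ _ _ _ _)).
  apply: (@le_trans _ _ (tilt s y (z + r *: delta_mx 0 i) * ((p + 1) * `|score i s (z + r *: delta_mx 0 i)| + `|p * y 0 i|))).
    rewrite ler_wpM2l ?tilt_ge0// (le_trans (ler_normD _ _))// lerD2r normrM gtr0_norm//.
  exact: comb (ltW p1) (normr_ge0 _) T1 T0.
- exact: integrableZ_real (tilt_integrable s40).
under [RHS]eq_Rintegral do rewrite mulrDr mulrCA [X in _ + X]mulrC.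
rewrite RintegralD//; [|exact: integrableZ_real..].
by rewrite !RintegralZl.
Qed.

(** The integral of the derivative of [tilt * score] vanishes. *)
Lemma int_score_sqr_eq i s : 0 < s ->
  p * y 0 i * int_score i s y + p * int_score_sqr i s y + int_score2 i s y = 0.
Proof.
move=> s0; have [i1 i2 i3] := score_integrable i s0.
have it := tilt_integrable s0.
have [C C0 HC] := tilt_dom mf0 f0_ge0 f0_int f0_gt0 p0 y s0 (lexx s).
have s11 : s <= s <= s by rewrite lexx.
have s40 : 0 < 4 * s by rewrite mulr_gt0.
have comb (T a b c D e f g : R) : 0 <= a -> 0 <= b -> T * e <= c * D -> T * f <= c * D ->
    T * g <= c * D -> T * (a * e + b * f + g) <= (a * c + b * c + c) * D.
  by move=> a0 b0 /(ler_wpM2l a0) H1 /(ler_wpM2l b0) H2 H3; lra.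
have := @integral_partial_eq0 _ _ i (fun z => tilt s y z * score i s z)
  (fun z => tilt s y z * (p * y 0 i * score i s z + p * score i s z ^+ 2 + score2 i s z))
  (fun z => (`|p * y 0 i| * C + p * C + C) * tilt (4 * s) y z) i1.
have H1 z r := is_derive_tilt_score mf0 f0_ge0 f0_int f0_gt0 p i y z r s0.
move=> /(_ H1) H.
rewrite -[RHS]H; last 2 first.
- move=> z r r1; have [T0 /(_ i) T1 /(_ i) T2 _ /(_ i) T3] := HC s z _ s11 (sqnorm_scale_delta i r1).
  rewrite normrM (ger0_norm (tilt_ge0 _ _ _ _ _)).
  set x := z + r *: delta_mx 0 i in T0 T1 T2 T3 *.
  apply: (@le_trans _ _ (tilt s y x * (`|p * y 0 i| * `|score i s x| + p * score i s x ^+ 2 + `|score2 i s x|))).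
    rewrite ler_wpM2l ?tilt_ge0// (le_trans (ler_normD _ _))// lerD2r.
    rewrite (le_trans (ler_normD _ _))// normrM lerD2l ger0_norm// mulr_ge0 ?sqr_ge0//.
    exact: ltW.
  exact: comb (normr_ge0 _) (ltW p0) T1 T3 T2.
- exact: integrableZ_real (tilt_integrable s40).
under [RHS]eq_Rintegral do rewrite !mulrDr mulrCA [X in _ + X + _]mulrCA.
rewrite RintegralD//; last by apply: integrableD_real; exact: integrableZ_real.
rewrite RintegralD//; [|exact: integrableZ_real..].
by rewrite !RintegralZl.
Qed.

(** Expanding [lscore ^+ 2], the two integrations by parts express the integrals
    of [score] and of its square through [rmass] and the integral of [score2]. *)
Lemma rfisherE s : 0 < s ->
  mu.-integrable setT (EFin \o (fun z => tilt s y z * \sum_i lscore i s y z ^+ 2)) /\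
  rfisher s y = p * sqnorm y * rmass s y - (p + 1) ^+ 2 / p * \sum_i int_score2 i s y.
Proof.
move=> s0; have it := tilt_integrable s0.
have E i : (fun z => tilt s y z * lscore i s y z ^+ 2) =
  (fun z => (p + 1) ^+ 2 * (tilt s y z * score i s z ^+ 2) +
            (2 * (p + 1) * (p * y 0 i) * (tilt s y z * score i s z) + (p * y 0 i) ^+ 2 * tilt s y z)).
  by apply/funext => z; rewrite /lscore; ring.
have I i : mu.-integrable setT (EFin \o (fun z => tilt s y z * lscore i s y z ^+ 2)) /\
    \int[mu]_z (tilt s y z * lscore i s y z ^+ 2) =
    p * y 0 i ^+ 2 * rmass s y - (p + 1) ^+ 2 / p * int_score2 i s y.
  have [i1 i2 i3] := score_integrable i s0.
  have j1 := integrableZ_real ((p + 1) ^+ 2) i3.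
  have j2 := integrableZ_real (2 * (p + 1) * (p * y 0 i)) i1.
  have j3 := integrableZ_real ((p * y 0 i) ^+ 2) it.
  have j4 := integrableD_real j2 j3.
  rewrite E; split; first exact: integrableD_real.
  rewrite RintegralD// RintegralD// !RintegralZl//.
  have e1 := int_score_eq i s0; have e2 := int_score_sqr_eq i s0.
  rewrite -/(rmass s y) -/(int_score i s y) -/(int_score_sqr i s y).
  have p1 : 0 < p + 1 by rewrite addr_gt0.
  have -> : int_score2 i s y = - (p * y 0 i * int_score i s y + p * int_score_sqr i s y).
    by apply/eqP; rewrite -addr_eq0 addrC e2.
  have -> : int_score i s y = - (p * y 0 i * rmass s y) / (p + 1).
    have -> : p * y 0 i * rmass s y = - ((p + 1) * int_score i s y).
      by apply/eqP; rewrite -addr_eq0 addrC e1.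
    by field; rewrite (gt_eqF p1).
  by field; rewrite (gt_eqF p1) (gt_eqF p0).
have [J1 J2] := Rintegral_sum (fun i => (I i).1).
have E' : (fun z => tilt s y z * \sum_i lscore i s y z ^+ 2) = (fun z => \sum_i tilt s y z * lscore i s y z ^+ 2).
  by apply/funext => z; rewrite mulr_sumr.
rewrite /rfisher E'; split => //; rewrite J2.
under eq_bigr do rewrite (I _).2.
by rewrite sumrB -mulr_sumr -mulr_suml -mulr_sumr.
Qed.

Lemma rmass_gt0 s : 0 < s -> 0 < rmass s y.
Proof.
move=> s0; rewrite -lte_fin EFin_rmass//.
have [c [k [c0 k0 H]]] := tmass_lower mf0 f0_ge0 f0_int f0_gt0 p0 s0.
by apply: lt_le_trans (H y); rewrite lte_fin mulr_gt0// expR_gt0.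
Qed.

Lemma rfisher_ge0 s : 0 <= rfisher s y.
Proof.
apply: Rintegral_ge0 => z _; rewrite mulr_ge0 ?tilt_ge0// sumr_ge0// => i _.
exact: sqr_ge0.
Qed.

Lemma sum_int_score2_ge s : 0 < s -> - (n%:R / s) * rmass s y <= \sum_i int_score2 i s y.
Proof.
move=> s0; have it := tilt_integrable s0.
apply: (@le_trans _ _ (\sum_(i < n) (- s^-1 * rmass s y))).
  rewrite sumr_const card_ord -[X in _ <= X]mulr_natr.
  by move: (rmass _ _) (n%:R) (s^-1) => a b c; rewrite (_ : - c * a * b = - (b * c) * a)//; ring.
apply: ler_sum => i _; rewrite -RintegralZl//.
apply: le_Rintegral => //; first exact: integrableZ_real.
  by have [] := score_integrable i s0.
by move=> z _; rewrite mulrC ler_wpM2l ?tilt_ge0//; exact: score2_ge.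
Qed.

Lemma rfisher_le s : 0 < s ->
  rfisher s y <= (p * sqnorm y + (p + 1) ^+ 2 / p * (n%:R / s)) * rmass s y.
Proof.
move=> s0; rewrite (rfisherE s0).2.
have := sum_int_score2_ge s0.
have c0 : 0 <= (p + 1) ^+ 2 / p by rewrite divr_ge0 ?sqr_ge0// ltW.
move=> /(ler_wpM2l c0); move: (_ / p) => c; lra.
Qed.

(** The time derivative brings out [(p + 1) * scoret], where by the heat
    equation [scoret] is half the sum of the [score2], and [rfisherE] expresses
    the integral of that sum through the Fisher information. *)
Lemma is_derive_rmass s : 0 < s ->
  is_derive s 1 (rmass ^~ y) (p / (2 * (p + 1)) * (p * sqnorm y * rmass s y - rfisher s y)).
Proof.
move=> s0; have s12 : s / 2 <= 2 * s by lra.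
have s10 : 0 < s / 2 by lra.
have p1 : 0 < p + 1 by rewrite addr_gt0.
have [C C0 HC] := tilt_dom mf0 f0_ge0 f0_int f0_gt0 p0 y s10 s12.
have m0 : sqnorm (0 : 'rV[R]_n) <= 1 by rewrite sqnorm0.
have I0 : s / 2 < s < 2 * s by apply/andP; lra.
have := @is_derive_Rintegral R _ _ mu (fun s z => tilt s y z)
  (fun s z => tilt s y z * ((p + 1) * scoret s z))
  (fun z => (p + 1) * C * tilt (4 * (2 * s)) y z) s (s / 2) (2 * s) I0.
have H1 r : s / 2 < r < 2 * s -> mu.-integrable setT (EFin \o tilt r y).
  by move=> /andP[r0 _]; apply: tilt_integrable; exact: lt_trans r0.
have H2 r z : s / 2 < r < 2 * s ->
    is_derive r 1 (fun s => tilt s y z) (tilt r y z * ((p + 1) * scoret r z)).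
  by move=> /andP[r0 _]; apply: is_derive_tilt_time => //; exact: lt_trans r0.
have H3 r z : s / 2 < r < 2 * s ->
    `|tilt r y z * ((p + 1) * scoret r z)| <= (p + 1) * C * tilt (4 * (2 * s)) y z.
  move=> /andP[r0 r1]; have r01 : s / 2 <= r <= 2 * s by rewrite !ltW.
  have [_ _ _ + _] := HC r z 0 r01 m0; rewrite addr0 => T.
  rewrite normrM (ger0_norm (tilt_ge0 _ _ _ _ _)) normrM gtr0_norm//.
  by rewrite mulrCA -mulrA ler_pM2l.
move=> /(_ H1 H2 H3) H.
have s80 : 0 < 4 * (2 * s) by rewrite !mulr_gt0.
have := H (integrableZ_real _ (tilt_integrable s80)).
move=> {}H; apply: (is_derive_eq H).
rewrite (rfisherE s0).2.
have i2 i : mu.-integrable setT (EFin \o (fun z => tilt s y z * score2 i s z)).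
  by have [] := score_integrable i s0.
have [J1 J2] := Rintegral_sum i2.
transitivity (\int[mu]_z ((p + 1) / 2 * \sum_i tilt s y z * score2 i s z)).
  by apply: eq_Rintegral => z _; rewrite scoretE// -mulr_sumr; ring.
rewrite RintegralZl// J2.
rewrite -/(int_score2 _ s y); move: (\sum_i _) (sqnorm y) (rmass s y) => a b c.
by field; rewrite (gt_eqF p1) (gt_eqF p0).
Qed.

End tilted_integrals.

(** * The polar integral *)

Section polar.
Context {R : realType} {n : nat}.
Local Notation mu := (lebesgue_rV n).
Variable f0 : 'rV[R]_n -> R.
Hypothesis mf0 : measurable_fun setT f0.
Hypothesis f0_ge0 : forall y, 0 <= f0 y.
Hypothesis f0_int : mu.-integrable setT (EFin \o f0).
Hypothesis f0_gt0 : (0 < \int[mu]_x (f0 x)%:E)%E.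
Variable p : R.
Hypothesis p0 : 0 < p.
Implicit Types (s r : R) (x y z u v w : 'rV[R]_n).

Local Notation tilt := (tilt f0 p).
Local Notation tmass := (tmass f0 p).
Local Notation rmass := (rmass f0 p).
Local Notation rfisher := (rfisher f0 p).

(** By [heat_dom] the quadratic factor is absorbed by a wider Gaussian. *)
Lemma gauss_integrable k : 0 < k ->
  mu.-integrable setT (EFin \o (fun y => (1 + sqnorm y) * expR (- (k * sqnorm y)))).
Proof.
move=> k0; pose s := k^-1 / 2.
have s0 : 0 < s by rewrite divr_gt0// invr_gt0.
have [C C0 HC] := @heat_dom R n s s s0 (lexx s).
pose E := expR (n%:R / 2 * ln (2 * pi * s)).
have s40 : 0 < 4 * s by rewrite mulr_gt0.
apply: (@integrable_le _ _ _ _ (fun y => E * C * heat (4 * s) y)).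
- have ms : measurable_fun setT (fun y : 'rV[R]_n => sqnorm y) by exact: measurable_dot_fun.
  apply: measurable_funM; first exact: measurable_funD.
  apply: (measurableT_comp (@measurable_expR R)).
  by apply: measurable_funN; exact: measurable_funM.
- move=> y; rewrite ger0_norm ?mulr_ge0 ?addr_ge0 ?expR_ge0 ?sqnorm_ge0//.
  have -> : expR (- (k * sqnorm y)) = E * heat s y.
    rewrite -expRD; congr expR; rewrite (_ : sqnorm y / (2 * s) = k * sqnorm y); first by ring.
    by rewrite /s; field; rewrite gt_eqF.
  have := HC s y 0; rewrite lexx sqnorm0 subr0 => /(_ isT ler01) H.
  by rewrite mulrCA -mulrA ler_pM2l ?expR_gt0.
- apply: integrableZ_real; apply/integrableP; split.
    by apply/measurable_EFinP; exact: measurable_heat_fun.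
  under eq_integral do rewrite /= ger0_norm ?expR_ge0//.
  by rewrite integral_heat// ltry.
Qed.

(** Up to a constant and a dilation, [exp] of minus the transform. The default
    values matter: [rmass] is 0 where the mass is infinite, and a negative power
    of 0 is 0, which is the value of [exp (- oo)]. *)
Definition polar s y : R := rmass s y `^ (- p^-1).
(** Where the mass is infinite [polar] is 0 at all times, and so is this formula
    for its time derivative. *)
Definition dpolar s y : R :=
  polar s y * (rfisher s y / rmass s y - p * sqnorm y) / (2 * (p + 1)).

Lemma polar_ge0 s y : 0 <= polar s y. Proof. exact: powR_ge0. Qed.

Lemma tmass_dom s y : 0 < s -> (tmass s y < +oo)%E = (tmass 1 y < +oo)%E.
Proof.
by move=> s0; apply/idP/idP; apply: tmass_fin.
Qed.

Lemma polar_out s y : 0 < s -> ~~ (tmass 1 y < +oo)%E -> polar s y = 0.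
Proof.
move=> s0; rewrite -(tmass_dom y s0) -leNgt leye_eq => /eqP E.
rewrite /polar (_ : rmass s y = 0) ?powR0 ?oppr_eq0 ?invr_eq0 ?gt_eqF//.
by rewrite /rmass /Rintegral -/(tmass s y) E.
Qed.

Lemma polar_gt0 s y : 0 < s -> (tmass 1 y < +oo)%E -> 0 < polar s y.
Proof. by move=> s0 yD; rewrite powR_gt0// rmass_gt0. Qed.

Lemma measurable_rmass s : measurable_fun setT (rmass s).
Proof.
have mF : measurable_fun setT (fun z : 'rV[R]_n * 'rV[R]_n => tilt s z.1 z.2).
  exact: measurable_tilt_fun.
exact: (measurable_Rintegral_param mF).
Qed.

Lemma measurable_rfisher s : 0 < s -> measurable_fun setT (rfisher s).
Proof.
move=> s0.
have mF : measurable_fun setT (fun t : 'rV[R]_n * 'rV[R]_n =>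
    tilt s t.1 t.2 * \sum_i lscore f0 p i s t.1 t.2 ^+ 2).
  apply: measurable_funM; first exact: measurable_tilt_fun.
  apply: measurable_sum => i; apply: measurable_funX; apply: measurable_funD.
    apply: measurable_funM => //; apply: measurableT_comp => //.
    exact: measurable_score.
  apply: measurable_funM => //.
  exact: (measurableT_comp (measurable_coord i)).
exact: (measurable_Rintegral_param mF).
Qed.

Lemma rmass_ge0 s y : 0 <= rmass s y.
Proof. by apply: Rintegral_ge0 => z _; exact: tilt_ge0. Qed.

Lemma measurable_rfisher_rmass s : 0 < s ->
  measurable_fun setT (fun y => rfisher s y / rmass s y).
Proof.
move=> s0; have -> : (fun y => rfisher s y / rmass s y) =
    (fun y => rfisher s y * rmass s y `^ (-1)).
  by apply/funext => y; rewrite powR_inv1// rmass_ge0.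
apply: measurable_funM; first exact: measurable_rfisher.
by apply: measurable_powR_fun; exact: measurable_rmass.
Qed.

Lemma measurable_polar s : measurable_fun setT (polar s).
Proof. by apply: measurable_powR_fun; exact: measurable_rmass. Qed.

(** The Gaussian lower bound of the mass at time [s1] holds at later times by
    monotonicity, and a negative power turns it into a decreasing Gaussian. *)
Lemma polar_dom s1 s2 : 0 < s1 -> s1 <= s2 -> exists C k,
  [/\ 0 < C, 0 < k & forall s y, s1 <= s <= s2 -> polar s y <= C * expR (- (k * sqnorm y))].
Proof.
move=> s10 s12; have [c [k [c0 k0 H]]] := tmass_lower mf0 f0_ge0 f0_int f0_gt0 p0 s10.
have p1 : 0 < p + 1 by rewrite addr_gt0.
pose M s := expR (n%:R / 2 * (ln (2 * pi * s) - ln (2 * pi * s1))) `^ (p + 1).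
have M0 s : 0 < M s by rewrite powR_gt0// expR_gt0.
have quot (a e m m' w : R) : 0 < m' -> m <= m' -> 0 <= w -> a * e <= m * w -> a / m' * e <= w.
  move=> m0 mm w0 H'; rewrite mulrAC ler_pdivrMr//; apply: le_trans H' _.
  by rewrite [w * _]mulrC ler_wpM2r.
exists ((c / M s2) `^ (- p^-1)), (k * p^-1); split.
- by rewrite powR_gt0// divr_gt0.
- by rewrite mulr_gt0// invr_gt0.
move=> s y /andP[s1s ss2]; have s0 : 0 < s by exact: lt_le_trans s1s.
have [yD|yD] := boolP (tmass 1 y < +oo)%E; last first.
  by rewrite polar_out// mulr_ge0 ?powR_ge0 ?expR_ge0.
have L : c / M s2 * expR (k * sqnorm y) <= rmass s y.
  have := le_trans (H y) (tmass_mono mf0 f0_ge0 f0_int p0 y s10 s1s).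
  rewrite -EFin_rmass// -EFinM lee_fin -/(M s) => HM.
  apply: (quot _ _ _ _ _ (M0 s2) _ (ltW (rmass_gt0 mf0 f0_ge0 f0_int f0_gt0 p0 yD s0)) HM).
  rewrite ge0_ler_powR ?nnegrE ?expR_ge0 ?(ltW p1)// ler_expR ler_wpM2l// lerD2r.
  rewrite ler_ln ?posrE ?mulr_gt0 ?pi_gt0//; last exact: lt_le_trans s12.
  by rewrite ler_pM2l// mulr_gt0// pi_gt0.
have L0 : 0 < c / M s2 * expR (k * sqnorm y) by rewrite mulr_gt0 ?expR_gt0// divr_gt0.
have -> : expR (- (k / p * sqnorm y)) = expR (k * sqnorm y) `^ (- p^-1).
  by rewrite -expRM; congr expR; ring.
rewrite -powRM ?expR_ge0//; last by rewrite ltW// divr_gt0.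
rewrite /polar !powRN lef_pV2 ?posrE ?powR_gt0 ?rmass_gt0//.
have pi0 : 0 <= p^-1 by rewrite invr_ge0 ltW.
by rewrite ge0_ler_powR ?nnegrE ?(ltW L0)// ltW// rmass_gt0.
Qed.

(** The Fisher information [rfisher / rmass] grows at most quadratically in [y],
    uniformly for [s1 <= s <= s2], while [polar] has Gaussian decay. *)
Lemma dpolar_dom s1 s2 : 0 < s1 -> s1 <= s2 -> exists C k,
  [/\ 0 < C, 0 < k & forall s y, s1 <= s <= s2 ->
    [/\ polar s y <= C * ((1 + sqnorm y) * expR (- (k * sqnorm y))),
        polar s y * sqnorm y <= C * ((1 + sqnorm y) * expR (- (k * sqnorm y))),
        polar s y * (rfisher s y / rmass s y) <= C * ((1 + sqnorm y) * expR (- (k * sqnorm y))) &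
        `|dpolar s y| <= C * ((1 + sqnorm y) * expR (- (k * sqnorm y)))] ].
Proof.
move=> s10 s12; have [C [k [C0 k0 H]]] := polar_dom s10 s12.
have p1 : 0 < p + 1 by rewrite addr_gt0.
(* [q] is the constant term of the quadratic bound of the Fisher information,
   [t] the resulting bound for the coefficient in [dpolar], and [B] exceeds all
   the coefficients met below. They are kept abstract for linear arithmetic. *)
have [q [q0 qE]] : exists q, 0 <= q /\ q = (p + 1) ^+ 2 / p * (n%:R / s1).
  exists ((p + 1) ^+ 2 / p * (n%:R / s1)); split=> //.
  by rewrite mulr_ge0 ?divr_ge0 ?sqr_ge0 ?(ltW p0) ?(ltW s10).
have [t [t0 tE]] : exists t, 0 <= t /\ t = (p + q) / (2 * (p + 1)).
  exists ((p + q) / (2 * (p + 1))); split=> //.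
  by rewrite divr_ge0 ?mulr_ge0 ?addr_ge0 ?(ltW p0) ?(ltW p1).
have [B BE] : exists B, B = 1 + p + q + t by eexists.
have BB : [/\ 0 < B, 1 <= B, p + q <= B & t <= B].
  by have p0' := p0; rewrite BE; split; lra.
have [B0 B1 B2 B3] := BB.
exists (B * C), k; split=> //; first by rewrite mulr_gt0.
move=> s y s1s2; have {}H := H s y s1s2.
have /andP[s1s ss2] := s1s2; have s0 : 0 < s by exact: lt_le_trans s1s.
have P0 := polar_ge0 s y.
have D0 : 0 <= C * expR (- (k * sqnorm y)) by rewrite mulr_ge0 ?expR_ge0 ?ltW.
have y0 := sqnorm_ge0 y.
have -> : B * C * ((1 + sqnorm y) * expR (- (k * sqnorm y))) =
  C * expR (- (k * sqnorm y)) * (B * (1 + sqnorm y)) by ring.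
have step X : 0 <= X -> X <= B * (1 + sqnorm y) ->
    polar s y * X <= C * expR (- (k * sqnorm y)) * (B * (1 + sqnorm y)).
  by move=> X0 XB; exact: ler_pM.
have y1 : 0 <= 1 + sqnorm y by rewrite addr_ge0.
have By : 1 + sqnorm y <= B * (1 + sqnorm y) by rewrite ler_peMl.
have b1 : polar s y <= C * expR (- (k * sqnorm y)) * (B * (1 + sqnorm y)).
  by rewrite -[X in X <= _]mulr1; apply: step => //; lra.
have b2 : polar s y * sqnorm y <= C * expR (- (k * sqnorm y)) * (B * (1 + sqnorm y)).
  by apply: step => //; lra.
have [yD|yD] := boolP (tmass 1 y < +oo)%E; last first.
  have E := polar_out s0 yD; rewrite E in b1 *.
  by rewrite /dpolar E !mul0r normr0.
have w0 := rmass_gt0 mf0 f0_ge0 f0_int f0_gt0 p0 yD s0.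
have F0 : 0 <= rfisher s y / rmass s y by rewrite divr_ge0 ?rfisher_ge0// ltW.
have FB : rfisher s y / rmass s y <= p * sqnorm y + q.
  rewrite ler_pdivrMr//; apply: le_trans (rfisher_le mf0 f0_ge0 f0_int f0_gt0 p0 yD s0) _.
  rewrite ler_pM2r// qE lerD2l ler_wpM2l ?divr_ge0 ?sqr_ge0 ?(ltW p0)//.
  by rewrite ler_wpM2l// lef_pV2.
have pqB : t * (1 + sqnorm y) <= B * (1 + sqnorm y) by rewrite ler_wpM2r.
have py : 0 <= p * sqnorm y by rewrite mulr_ge0// ltW.
have qy : 0 <= q * sqnorm y by rewrite mulr_ge0.
split=> //.
- apply: step => //; apply: le_trans FB _.
  have : (p + q) * (1 + sqnorm y) <= B * (1 + sqnorm y) by rewrite ler_wpM2r.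
  by have p0' := p0; lra.
rewrite /dpolar -mulrA normrM (ger0_norm P0); apply: step => //.
apply: le_trans pqB; rewrite normrM normfV [`|2 * _|]gtr0_norm ?mulr_gt0//.
rewrite tE [X in _ <= X]mulrAC ler_pM2r ?invr_gt0 ?mulr_gt0//.
by have p0' := p0; rewrite ler_norml; apply/andP; split; lra.
Qed.

Lemma polar_integrable s : 0 < s ->
  [/\ mu.-integrable setT (EFin \o polar s),
      mu.-integrable setT (EFin \o (fun y => polar s y * sqnorm y)) &
      mu.-integrable setT (EFin \o (fun y => polar s y * (rfisher s y / rmass s y)))].
Proof.
move=> s0; have [C [k [C0 k0 H]]] := dpolar_dom s0 (lexx s).
have {}H y := H s y; have s11 : s <= s <= s by rewrite lexx.
have G := integrableZ_real C (gauss_integrable k0).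
have mP := measurable_polar s.
split; apply: (integrable_le _ _ G) => //.
- by move=> y; rewrite ger0_norm ?polar_ge0//; have [] := H y s11.
- by apply: measurable_funM => //; exact: measurable_dot_fun.
- by move=> y; rewrite ger0_norm ?mulr_ge0 ?polar_ge0 ?sqnorm_ge0//; have [] := H y s11.
- by apply: measurable_funM => //; exact: measurable_rfisher_rmass.
- move=> y; rewrite ger0_norm ?mulr_ge0 ?polar_ge0 ?rfisher_ge0 ?invr_ge0 ?rmass_ge0//.
  by have [] := H y s11.
Qed.

(** Where the mass is infinite it is so at every positive time, and [polar] is
    constantly 0 there. *)
Lemma is_derive_polar s y : 0 < s -> is_derive s 1 (polar ^~ y) (dpolar s y).
Proof.
move=> s0; have [yD|yD] := boolP (tmass 1 y < +oo)%E.
  have w0 := rmass_gt0 mf0 f0_ge0 f0_int f0_gt0 p0 yD s0.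
  have H := is_derive_rmass mf0 f0_ge0 f0_int f0_gt0 p0 yD s0.
  apply: (is_derive_eq (is_derive_powR_comp (- p^-1) w0 H)).
  have p1 : 0 < p + 1 by rewrite addr_gt0.
  rewrite /dpolar /polar; move: (rmass s y `^ (- p^-1)) (sqnorm y) (rfisher s y) (rmass s y) w0 => a b c d d0.
  by field; rewrite (gt_eqF p1) (gt_eqF p0) (gt_eqF d0).
have E : dpolar s y = 0 by rewrite /dpolar polar_out// !mul0r.
rewrite E; apply: (@near_eq_is_derive _ _ _ (cst 0)) => //.
near=> r; rewrite /= polar_out//; near: r.
exact: lt_nbhsr.
Unshelve. all: by end_near. Qed.

Lemma is_derive_int_polar s : 0 < s ->
  is_derive s 1 (fun s => \int[mu]_y polar s y) (\int[mu]_y dpolar s y).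
Proof.
move=> s0; have s12 : s / 2 <= 2 * s by lra.
have s10 : 0 < s / 2 by lra.
have [C [k [C0 k0 H]]] := dpolar_dom s10 s12.
have I0 : s / 2 < s < 2 * s by apply/andP; lra.
apply: (@is_derive_Rintegral R _ _ mu polar dpolar
  (fun y => C * ((1 + sqnorm y) * expR (- (k * sqnorm y)))) s (s / 2) (2 * s) I0).
- move=> r /andP[r0 _]; by have [] := polar_integrable (lt_trans s10 r0).
- move=> r y /andP[r0 _]; exact: is_derive_polar (lt_trans s10 r0).
- move=> r y /andP[r0 r1]; have r01 : s / 2 <= r <= 2 * s by rewrite !ltW.
  by have [] := H r y r01.
- exact: integrableZ_real (gauss_integrable k0).
Qed.

Lemma int_dpolar s : 0 < s -> \int[mu]_y dpolar s y =
  (\int[mu]_y (polar s y * (rfisher s y / rmass s y)) -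
   p * \int[mu]_y (polar s y * sqnorm y)) / (2 * (p + 1)).
Proof.
move=> s0; have [i1 i2 i3] := polar_integrable s0.
rewrite -RintegralZl// -RintegralB//; last exact: integrableZ_real.
rewrite mulrC -RintegralZl//; last first.
  exact: (integrableB measurableT i3 (integrableZ_real p i2)).
by apply: eq_Rintegral => y _; rewrite /dpolar; ring.
Qed.

End polar.

(** * Exponential decay of integrable log-concave functions *)

Section borel_rV.
Context {R : realType} {n : nat}.

Definition rat_box (ab : 'rV[rat]_n * 'rV[rat]_n) : set 'rV[R]_n :=
  [set x | forall i, ratr (ab.1 0 i) < x 0 i < ratr (ab.2 0 i)].

Lemma measurable_coord_set (P : 'I_n -> set R) : (forall i, measurable (P i)) ->
  measurable [set x : 'rV[R]_n | forall i, P i (x 0 i)].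
Proof.
move=> mP; rewrite (_ : [set x | _] = \bigcap_(i in [set: 'I_n])
    ((fun x : 'rV[R]_n => x 0 i) @^-1` P i)); last first.
  by apply/seteqP; split=> x /= Ax i => [_|]; exact: Ax.
apply: fin_bigcap_measurable => // i _.
by rewrite -[X in measurable X]setTI; apply: measurable_coord => //; exact: mP.
Qed.

Lemma measurable_rat_box ab : measurable (rat_box ab).
Proof.
apply: (measurable_coord_set (P := fun i => [set r | ratr (ab.1 0 i) < r < ratr (ab.2 0 i)])) => i.
by rewrite (_ : [set r | _] = `]ratr (ab.1 0 i), ratr (ab.2 0 i)[%classic)//; apply/seteqP; split=> r /=; rewrite in_itv.
Qed.

(** An open set is the union of the countably many rational boxes that it
    contains. *)
Lemma open_measurable_rV (U : set 'rV[R]_n) : open U -> measurable U.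
Proof.
move=> oU; pose F (m : nat) : set 'rV[R]_n :=
  if unpickle m is Some ab then
    if `[< rat_box ab `<=` U >] then rat_box ab else set0 else set0.
suff -> : U = \bigcup_m F m.
  apply: bigcup_measurable => m _; rewrite /F.
  case: unpickle => // ab; case: ifP => // _; exact: measurable_rat_box.
apply/seteqP; split=> [x Ux|x [m _]]; last first.
  by rewrite /F; case: unpickle => // ab; case: ifPn => // /asboolP; exact.
have [P Px PU] : nbhs x U by exact: open_nbhs_nbhs.
have Q i : exists ab : rat * rat, ratr ab.1 < x 0 i < ratr ab.2 /\
    forall r : R, ratr ab.1 < r < ratr ab.2 -> P 0 i r.
  have /nbhs_ballP[e /= e0 He] := Px 0 i.
  have [a ha] := @rat_in_itvoo R (x 0 i - e) (x 0 i) ltac:(by rewrite ltrBlDr ltrDl).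
  have [b hb] := @rat_in_itvoo R (x 0 i) (x 0 i + e) ltac:(by rewrite ltrDl).
  move: ha hb; rewrite !in_itv/= => /andP[a1 a2] /andP[b1 b2].
  exists (a, b); split; first by rewrite a2 b1.
  move=> r /andP[/= r1 r2]; apply: He; rewrite /ball/= ltr_norml.
  apply/andP; split; lra.
have [g Hg] := choice Q.
exists (pickle (\row_i (g i).1, \row_i (g i).2) ) => //.
rewrite /F pickleK; case: asboolP => [_ i|[]].
  by rewrite !mxE; have [] := Hg i.
move=> w Hw; apply: PU => i j; rewrite ord1; have [_] := Hg j; apply.
by have := Hw j; rewrite !mxE.
Qed.

Lemma lsc_measurable_rV (f : 'rV[R]_n -> \bar R) :
  lower_semicontinuous f -> measurable_fun setT f.
Proof.
move=> scif; apply: (measurability _ (ErealGenOInfty.measurableE R)).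
move=> /= _ [_ [a ->]] <-; apply: measurableI => //; apply: open_measurable_rV.
by rewrite preimage_itvoy; move/lower_semicontinuousP : scif; exact.
Qed.

End borel_rV.

Section convex_growth.
Context {R : realType} {n : nat}.
Local Notation mu := (lebesgue_rV n).
Variable phi : 'rV[R]_n -> \bar R.
Hypothesis phiN : forall x, (-oo < phi x)%E.
Hypothesis phi_convex : convex_fun phi.
Hypothesis mphi : measurable_fun setT phi.
Hypothesis phiV : pos_finite_V phi.

(** The density [exp (- phi)] as a real function; [phi > -oo] makes it finite. *)
Definition boltz x : R := fine (expeR (- phi x)).

Lemma boltzE x : expeR (- phi x) = (boltz x)%:E.
Proof.
rewrite /boltz fineK//; have := phiN x; case: (phi x) => //=.
Qed.

Lemma boltz_ge0 x : 0 <= boltz x.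
Proof. by apply: fine_ge0; exact: expeR_ge0. Qed.

Lemma measurable_boltz : measurable_fun setT boltz.
Proof.
have E : boltz = fun x => expR (- fine (phi x)) * \1_[set x | (phi x < +oo)%E] x.
  apply/funext => x; rewrite /boltz indicE; have := phiN x.
  case E: (phi x) => [r||]//= _.
    by rewrite mem_set ?mulr1//= E ltry.
  by rewrite memNset ?mulr0//= E ltxx.
rewrite E; apply: measurable_funM.
  apply: (measurableT_comp (@measurable_expR R)); apply: measurable_funN.
  exact: (measurableT_comp (fine_measurable measurableT)).
apply: measurable_indic; rewrite -[X in measurable X]setTI.
exact: emeasurable_fun_infty_o.
Qed.

Lemma V_boltz : V phi = (\int[mu]_x (boltz x)%:E)%E.
Proof. by apply: eq_integral => x _; rewrite boltzE. Qed.

Lemma boltz_integrable : mu.-integrable setT (EFin \o boltz).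
Proof.
apply/integrableP; split; first by apply/measurable_EFinP; exact: measurable_boltz.
under eq_integral do rewrite /= ger0_norm ?boltz_ge0//.
by rewrite -V_boltz; exact: phiV.2.
Qed.

Lemma boltz_int_gt0 : (0 < \int[mu]_x (boltz x)%:E)%E.
Proof. by rewrite -V_boltz; exact: phiV.1. Qed.

Lemma boltz_ge (c : R) x : (phi x <= c%:E)%E -> expR (- c) <= boltz x.
Proof.
rewrite /boltz; have := phiN x; case: (phi x) => //= r _.
by rewrite lee_fin ler_expR lerN2.
Qed.

(** Sublevel sets cut off by a cube: the cube bounds [level k], which makes the
    copies of it shrunk towards a far point by different ratios disjoint. *)
Definition level (k : nat) : set 'rV[R]_n :=
  [set x | (phi x <= k%:R%:E)%E /\ forall i, `|x 0 i| <= k%:R].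

Lemma measurable_level k : measurable (level k).
Proof.
apply: measurableI.
  by rewrite -[X in measurable X]setTI; exact: emeasurable_fun_infty_c.
apply: (measurable_coord_set (P := fun=> [set r : R | `|r| <= k%:R])) => _.
rewrite (_ : [set r : R | _] = `[- k%:R, k%:R]%classic)//.
by apply/seteqP; split=> r /=; rewrite in_itv/= ler_norml.
Qed.

(** These sets exhaust the domain of [phi]; if they were all negligible then
    [exp (- phi)] would be zero almost everywhere. *)
Lemma exists_level : exists k, (0 < mu (level k))%E.
Proof.
apply: contrapT => /forallNP H.
have L0 k : mu (level k) = 0%E.
  by apply/eqP; rewrite eq_le measure_ge0 andbT leNgt; apply/negP; exact: H.
have : mu.-negligible (\bigcup_k level k).
  apply: negligible_bigcup => k; exists (level k).
  by split; [exact: measurable_level|exact: L0|].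
move=> neg; have := boltz_int_gt0.
rewrite (ae_eq_integral (cst 0%E))//; first by rewrite integral0 ltxx.
  by apply/measurable_EFinP; exact: measurable_boltz.
apply: (@negligibleS _ _ _ mu _ _ _ neg) => x /= /not_implyP[_].
rewrite /boltz; have := phiN x; case E: (phi x) => [r||]//= _ _.
(* [K] is at least [|phi x|] and all [|x_i|]. *)
pose K := (Num.bound `|r| + \sum_(i < n) Num.bound `|x (0%R : 'I_1) i|)%N.
have KP (m : nat) (a : R) : (Num.bound `|a| <= m)%N -> `|a| <= m%:R :> R.
  move=> bm; rewrite (le_trans (ltW (archi_boundP (normr_ge0 _))))//.
  by rewrite ler_nat.
exists K => //; split=> /=.
  by rewrite E lee_fin (le_trans (ler_norm _))// KP// leq_addr.
move=> i; apply: KP; rewrite /K (bigD1 i)//= addnCA leq_addr//.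
Qed.

(** Markov's inequality. *)
Lemma mu_le_V (S : set 'rV[R]_n) (c : R) : measurable S ->
  (forall x, S x -> (phi x <= c%:E)%E) -> (mu S <= (expR c)%:E * V phi)%E.
Proof.
move=> mS Sc; rewrite V_boltz -ge0_integralZl_EFin ?expR_ge0//; last 2 first.
- by move=> x _; rewrite lee_fin boltz_ge0.
- by apply/measurable_EFinP; exact: measurable_boltz.
have -> : mu S = (\int[mu]_x (\1_S x)%:E)%E by rewrite integral_indic// setIT.
apply: ge0_le_integral => //.
- exact/measurable_EFinP/measurable_indic.
- by apply: emeasurable_funM => //; by apply/measurable_EFinP; exact: measurable_boltz.
move=> x _; rewrite -EFinM lee_fin indicE.
have [/set_mem Sx|_] := boolP (x \in S); last by rewrite mulr_ge0 ?expR_ge0 ?boltz_ge0.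
have := ler_wpM2l (expR_ge0 c) (boltz_ge (Sc x Sx)).
by rewrite -expRD subrr expR0.
Qed.

(** Let [x] be a far point of the sublevel set of height [k + 1]. By convexity
    the images of [level k] under contractions towards [x] lie in that sublevel
    set. If [x] is far enough, [N] of them with ratio at least 1/2 are pairwise
    disjoint, whereas the sublevel set has finite measure. *)
Lemma copies_le k x (i : 'I_n) (N : nat) : (0 < N)%N ->
  (phi x <= (k%:R + 1)%:E)%E -> 4 * k%:R * N%:R < `|x 0 i| ->
  (N%:R%:E * ((2^-1 ^+ n)%:E * mu (level k)) <= (expR (k%:R + 1))%:E * V phi)%E.
Proof.
move=> N0 phix xi; pose l (j : 'I_N) : R := j%:R / (2 * N%:R).
have N0R : 0 < N%:R :> R by rewrite ltr0n.
have l0 j : 0 <= l j by rewrite divr_ge0// mulr_ge0.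
have l1 j : l j <= 2^-1.
  rewrite /l ler_pdivrMr ?mulr_gt0// mulrA mulVf ?mul1r ?pnatr_eq0//.
  by rewrite ler_nat ltnW.
(* The contraction towards [x] of ratio [1 - l j] maps [level k] onto [S j],
   whose membership is expressed through the inverse map [z -> c j *: z + b j]. *)
pose c j : R := (1 - l j)^-1.
have c0 j : 0 < 1 - l j by rewrite subr_gt0 (le_lt_trans (l1 j))// invf_lt1// ltr1n.
have cV j : (c j)^-1 = 1 - l j by rewrite invrK.
pose b j := - (c j * l j) *: x.
pose S j := [set z | level k (c j *: z + b j)].
have zE j z : z = l j *: x + (1 - l j) *: (c j *: z + b j).
  rewrite /b scalerDr !scalerA mulrN mulrA mulfV ?gt_eqF// !mul1r scale1r.
  by rewrite scaleNr addrCA subrr addr0.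
have mS j : measurable (S j).
  rewrite -[X in measurable X]setTI; apply: (measurable_rV_affine (c j) (b j)) => //.
  exact: measurable_level.
have disj (j j' : 'I_N) z : S j z -> S j' z -> j = j'.
  move=> Sj Sj'; apply: contrapT => /eqP jj'.
  have E : (l j - l j') * x 0 i =
     (1 - l j') * (c j' *: z + b j') 0 i - (1 - l j) * (c j *: z + b j) 0 i.
    have coord (a a' : R) (u v : 'rV[R]_n) : (a *: u + a' *: v) 0 i = a * u 0 i + a' * v 0 i.
      by rewrite !mxE.
    have e1 : z 0 i = l j * x 0 i + (1 - l j) * (c j *: z + b j) 0 i.
      by rewrite {1}(zE j z) coord.
    have e2 : z 0 i = l j' * x 0 i + (1 - l j') * (c j' *: z + b j') 0 i.
      by rewrite {1}(zE j' z) coord.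
    move: e1 e2.
    move: (z 0 i) ((c j' *: z + b j') 0 i) ((c j *: z + b j) 0 i) => A B C e1 e2.
    have : l j * x 0 i + (1 - l j) * C = l j' * x 0 i + (1 - l j') * B by rewrite -e1 -e2.
    by move/eqP; rewrite -subr_eq0 => /eqP H; apply/eqP; rewrite -subr_eq0 -H; apply/eqP; ring.
  have bd t : level k t -> forall a : R, 0 <= a <= 1 -> `|a * t 0 i| <= k%:R.
    move=> [_ /(_ i) ti] a /andP[a0 a1]; rewrite normrM (ger0_norm a0).
    by apply: le_trans ti; rewrite ler_piMl.
  have I01 j0 : 0 <= 1 - l j0 <= 1 by rewrite (ltW (c0 j0)) gerBl l0.
  have U : `|(l j - l j') * x 0 i| <= 2 * k%:R.
    rewrite E (le_trans (ler_normB _ _))// (_ : 2 * k%:R = k%:R + k%:R); last by ring.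
    by apply: lerD; apply: bd.
  (* Distinct ratios differ by at least the step [1 / (2 N)], while a common
     point of [S j] and [S j'] forces [|l j - l j'| * |x_i| <= 2 k]. *)
  have W : (2 * N%:R)^-1 <= `|l j - l j'|.
    have v0 : 0 < (2 * N%:R)^-1 :> R by rewrite invr_gt0 mulr_gt0.
    rewrite /l -mulrBl normrM (gtr0_norm v0) ler_peMl ?(ltW v0)//.
    have : j != j' :> nat by [].
    rewrite neq_ltn => /orP[] lt; [rewrite distrC|].
      by rewrite -natrB ?(ltnW lt)// ger0_norm// ler1n subn_gt0.
    by rewrite -natrB ?(ltnW lt)// ger0_norm// ler1n subn_gt0.
  move: U; rewrite normrM leNgt => /negP; apply.
  apply: lt_le_trans (ler_wpM2r (normr_ge0 _) W).
  by rewrite ltr_pdivlMl ?mulr_gt0//; move: xi; lra.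
(* By disjointness at most one indicator is nonzero. *)
have ptw z : \sum_(j < N) \1_(S j) z <= expR (k%:R + 1) * boltz z :> R.
  have [[j Sj]|nS] := pselect (exists j, S j z); last first.
    rewrite big1 ?mulr_ge0 ?expR_ge0 ?boltz_ge0// => j _.
    by rewrite indicE memNset// => Sj; apply: nS; exists j.
  rewrite (bigD1 j)//= big1 ?addr0; last first.
    move=> j' jj'; rewrite indicE memNset// => Sj'.
    by move/eqP : jj'; apply; exact: disj Sj' Sj.
  rewrite indicE mem_set//=.
  have phiz : (phi z <= (k%:R + 1)%:E)%E.
    have [phib _] := Sj.
    have l01 : 0 <= l j <= 1 by rewrite l0 (le_trans (l1 j))// invf_le1// ler1n.
    rewrite (zE j z); apply: le_trans (phi_convex _ _ l01) _.
    apply: (@le_trans _ _ ((l j)%:E * (k%:R + 1)%:E + (1 - l j)%:E * k%:R%:E)%E).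
      by apply: leeD; apply: lee_wpmul2l => //; rewrite lee_fin// ltW.
    rewrite -!EFinM -EFinD lee_fin.
    by have := l0 j; have /andP[_] := l01; nra.
  have := ler_wpM2l (expR_ge0 (k%:R + 1)) (boltz_ge phiz).
  by rewrite -expRD subrr expR0.
rewrite V_boltz -ge0_integralZl_EFin ?expR_ge0//; last 2 first.
- by move=> z _; rewrite lee_fin boltz_ge0.
- by apply/measurable_EFinP; exact: measurable_boltz.
apply: (@le_trans _ _ (\int[mu]_z (\sum_(j < N) (\1_(S j) z)%:E))%E); last first.
  apply: ge0_le_integral => //.
  - by move=> z _; apply: sume_ge0 => j _; rewrite lee_fin.
  - by apply: emeasurable_sum => j; apply/measurable_EFinP/measurable_indic.
  - by apply: emeasurable_funM => //; apply/measurable_EFinP; exact: measurable_boltz.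
  - by move=> z _; rewrite sumEFin -EFinM lee_fin.
rewrite ge0_integral_sum//; last first.
  by move=> j; apply/measurable_EFinP/measurable_indic.
have step (j : 'I_N) : ((2^-1 ^+ n)%:E * mu (level k) <= \int[mu]_z (\1_(S j) z)%:E)%E.
  have cj0 : 0 < c j by rewrite invr_gt0.
  have mi : measurable_fun setT (fun z : 'rV[R]_n => (\1_(level k) z)%:E : \bar R).
    by apply/measurable_EFinP/measurable_indic; exact: measurable_level.
  have -> : mu (level k) = (\int[mu]_x (\1_(level k) x)%:E)%E.
    by rewrite integral_indic// ?setIT//; exact: measurable_level.
  rewrite (ge0_integral_rV_affine (b j) cj0 mi)//.
  rewrite muleA -EFinM -exprMn.
  rewrite -[X in (_ <= X)%E]mul1e.
  apply: lee_pmul => //.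
  - by rewrite lee_fin exprn_ge0// mulr_ge0// ltW.
  - by apply: integral_ge0.
  - rewrite lee_fin exprn_ile1// ?mulr_ge0// ?(ltW cj0)// ?invr_ge0//.
    rewrite ler_pdivrMl// mulr1 /c -[X in _ <= X]invrK lef_pV2 ?posrE ?invr_gt0//.
    by have := l1 j; lra.
apply: (@le_trans _ _ (\sum_(j < N) ((2^-1 ^+ n)%:E * mu (level k)))%E).
  by rewrite sumr_const card_ord mule_natl.
by apply: lee_sum => j _; exact: step.
Qed.

(** Otherwise [copies_le] applies with [N] so large that the disjoint copies
    have more than the total measure available. *)
Lemma sublevel_bounded k : (0 < mu (level k))%E ->
  exists2 r, 0 < r & forall x i, (phi x <= (k%:R + 1)%:E)%E -> `|x 0 i| <= r.
Proof.
move=> m0; pose b := expR (k%:R + 1) * fine (V phi).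
have Vfin : V phi \is a fin_num by rewrite ge0_fin_numE; [exact: phiV.2|exact/ltW/phiV.1].
have mfin : mu (level k) \is a fin_num.
  rewrite ge0_fin_numE//; apply: le_lt_trans (mu_le_V (c := k%:R) _ _) _.
  - exact: measurable_level.
  - by move=> x [].
  - by rewrite lte_mul_pinfty ?lee_fin ?expR_ge0//; exact: phiV.2.
pose m := fine (mu (level k)).
have mE : mu (level k) = m%:E by rewrite fineK.
have m0' : 0 < m by rewrite -lte_fin -mE.
have a0 : 0 < 2^-1 ^+ n * m by rewrite mulr_gt0// exprn_gt0// invr_gt0.
have b0 : 0 <= b / (2^-1 ^+ n * m).
  by rewrite divr_ge0 ?(ltW a0)// mulr_ge0 ?expR_ge0// fine_ge0// ltW//; exact: phiV.1.
pose N := (Num.bound (b / (2^-1 ^+ n * m))).+1.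
have bN : b < N%:R * (2^-1 ^+ n * m).
  rewrite -ltr_pdivrMr//; apply: lt_le_trans (archi_boundP b0) _.
  by rewrite ler_nat.
exists (4 * k%:R * N%:R + 1) => [|x i phix].
  by rewrite ltr_wpDl// !mulr_ge0.
rewrite leNgt; apply/negP => xi.
have := @copies_le k x i N (ltn0Sn _) phix; rewrite mE -(fineK Vfin) -!EFinM lee_fin.
by move=> /(_ ltac:(lra)); rewrite leNgt bN.
Qed.

(** Outside a bounded set [phi] exceeds its value at [x0] by at least 1, and
    convexity along rays from [x0] propagates this increment linearly. *)
Lemma convex_linear_growth : exists (x0 : 'rV[R]_n) (r : R) (k : nat),
  [/\ 0 < r, level k x0 & forall x i (a : R), phi x = a%:E ->
      `|x 0 i - x0 0 i| <= r * Num.max 1 (a - k%:R)].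
Proof.
have [k m0] := exists_level.
have [r r0 Hr] := sublevel_bounded m0.
have [x0 Bx0] : level k !=set0.
  apply/set0P/negP => /eqP E; move: m0.
  by rewrite E measure0 ltxx.
(* On the segment from [x0] to [x], the point [z] at which the coordinate [i]
   has moved by [r + k + 1] has [|z_i| > r], as [|x0_i| <= k]. *)
exists x0, (r + k%:R + 1), k.
have q0 : 0 < r + k%:R + 1 by rewrite ltr_wpDl// addr_ge0// ltW.
split=> // x i a xa; set q := r + k%:R + 1 in q0 *; set D := `|_|.
have [Dq|Dq] := leP D q.
  by rewrite (le_trans Dq)// ler_peMr ?(ltW q0)// le_max lexx.
have D0 : 0 < D by exact: lt_trans Dq.
have l01 : 0 <= q / D <= 1 by rewrite divr_ge0 ?(ltW q0) ?(ltW D0)//= ler_pdivrMr// mul1r ltW.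
pose z := (q / D) *: x + (1 - q / D) *: x0.
have [x0k x0i] := Bx0.
have zi : r < `|z 0 i|.
  have -> : z 0 i = x0 0 i + q / D * (x 0 i - x0 0 i) by rewrite !mxE; ring.
  have H : `|q / D * (x 0 i - x0 0 i)| = q.
    by rewrite normrM -/D ger0_norm ?divfK ?gt_eqF//; case/andP: l01.
  rewrite addrC; have := lerB_normD (q / D * (x 0 i - x0 0 i)) (x0 0 i).
  rewrite H; have := x0i i; rewrite /q => h1 h2.
  apply: lt_le_trans h2; lra.
have phiz : ((k%:R + 1)%:E < phi z)%E.
  rewrite ltNge; apply/negP => /(Hr z i); rewrite leNgt zi//.
have := lt_le_trans phiz (phi_convex x x0 l01).
have [c x0c] : exists c, phi x0 = c%:E.
  by have := phiN x0; move: x0k; case: (phi x0) => // c; exists c.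
rewrite xa x0c -!EFinM -EFinD lte_fin => H.
have ck : c <= k%:R by rewrite -lee_fin -x0c.
have H2 : (1 - q / D) * c <= (1 - q / D) * k%:R by rewrite ler_wpM2l// subr_ge0; case/andP: l01.
have : 1 < q / D * (a - k%:R) by lra.
rewrite mulrAC ltr_pdivlMr// mul1r => /ltW/le_trans; apply.
by rewrite ler_pM2l// le_max lexx orbT.
Qed.

Lemma boltz_fin x a : phi x = a%:E -> boltz x = expR (- a).
Proof. by rewrite /boltz => ->. Qed.

(** At the midpoint of [x] and [x0] convexity gives [phi <= (phi x + c) / 2], so
    [exp (- phi / 2)] is at most a constant times [exp (- phi)] precomposed with
    a dilation. *)
Lemma sqrt_boltz_integrable x0 c : (phi x0 <= c%:E)%E ->
  (\int[mu]_x (boltz x `^ 2^-1)%:E < +oo)%E.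
Proof.
move=> x0c; pose C := expR (c / 2).
have mb := measurable_boltz.
have ma : measurable_fun setT (fun x : 'rV[R]_n => boltz (2^-1 *: x + 2^-1 *: x0)).
  by apply: measurableT_comp => //; exact: measurable_rV_affine.
have h0 : 0 < 2^-1 :> R by rewrite invr_gt0.
apply: (@le_lt_trans _ _ (\int[mu]_x (C%:E * (boltz (2^-1 *: x + 2^-1 *: x0))%:E))%E).
  apply: ge0_le_integral => //.
  - by move=> x _; rewrite lee_fin powR_ge0.
  - by apply/measurable_EFinP; exact: measurable_powR_fun.
  - by apply: emeasurable_funM => //; exact/measurable_EFinP.
  move=> x _; rewrite -EFinM lee_fin.
  have := phiN x; case E: (phi x) => [a||]// _; last first.
    rewrite [boltz x](_ : _ = 0) ?powR0 ?mulr_ge0 ?expR_ge0 ?boltz_ge0 ?gt_eqF//.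
    by rewrite /boltz E.
  rewrite (boltz_fin E) -expRM -ler_pdivrMl ?expR_gt0// -expRN -expRD.
  have -> : - (c / 2) + - a / 2 = - (2^-1 * a + 2^-1 * c) by field.
  apply: boltz_ge; have hl : 0 <= (2^-1 : R) <= 1 by rewrite ltW//= invf_le1// ler1n.
  have h1 : 1 - 2^-1 = 2^-1 :> R by lra.
  have := phi_convex x x0 hl; rewrite h1 E => /le_trans; apply.
  by rewrite EFinD !EFinM leeD2l// lee_wpmul2l// lee_fin ltW.
rewrite ge0_integralZl_EFin ?expR_ge0//; last 2 first.
- by move=> x _; rewrite lee_fin boltz_ge0.
- exact/measurable_EFinP.
rewrite lte_mul_pinfty ?lee_fin ?expR_ge0//.
have := @ge0_integral_rV_affine R n 2^-1 (2^-1 *: x0) (EFin \o boltz) h0.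
rewrite -V_boltz => /(_ ltac:(exact/measurable_EFinP) ltac:(by move=> x; rewrite lee_fin boltz_ge0)) HV.
have := phiV.2; rewrite HV; case: (\int[mu]_x _)%E => [u _| |//]; first by rewrite ltry.
by rewrite mulry gtr0_sg ?mul1e// exprn_gt0.
Qed.

(** If [y] is small then [<x, y>] is at most half of the linear growth of [phi],
    so [exp (<x, y> - phi x)] is bounded by multiples of [exp (- phi x / 2)] far
    away and of [exp (- phi x)] near [x0]. *)
Lemma boltz_exp_moment : exists2 e : R, 0 < e & forall y : 'rV[R]_n, (forall i, `|y 0 i| <= e) ->
  (\int[mu]_x (expR (dot x y) * boltz x)%:E < +oo)%E.
Proof.
have [x0 [r [k [r0 [x0k _] H]]]] := convex_linear_growth.
(* The bound [r * max 1 (phi x - k)] on each of the [n] coordinates then gives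
   at most half of [max 1 (phi x - k)]; [n.+1] keeps the denominator positive. *)
pose e := (2 * (r * n.+1%:R))^-1.
have e0 : 0 < e by rewrite invr_gt0 !mulr_gt0.
exists e => // y ye.
have mb := measurable_boltz.
have msq : measurable_fun setT (fun x => boltz x `^ 2^-1) by exact: measurable_powR_fun.
pose A := expR (dot x0 y) * expR (2^-1).
pose B := expR (dot x0 y).
apply: (@le_lt_trans _ _ (\int[mu]_x (A%:E * (boltz x)%:E + B%:E * (boltz x `^ 2^-1)%:E))%E); last first.
  rewrite ge0_integralD//; last 4 first.
  - by move=> x _; rewrite -EFinM lee_fin !mulr_ge0 ?expR_ge0 ?boltz_ge0.
  - by apply: emeasurable_funM => //; exact/measurable_EFinP.
  - by move=> x _; rewrite -EFinM lee_fin !mulr_ge0 ?expR_ge0 ?powR_ge0.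
  - by apply: emeasurable_funM => //; exact/measurable_EFinP.
  rewrite !ge0_integralZl_EFin ?mulr_ge0 ?expR_ge0//; try exact/measurable_EFinP.
  - rewrite lte_add_pinfty// lte_mul_pinfty ?lee_fin ?mulr_ge0 ?expR_ge0//.
      by rewrite -V_boltz; exact: phiV.2.
    exact: sqrt_boltz_integrable x0k.
  - by move=> x _; rewrite lee_fin powR_ge0.
  - by move=> x _; rewrite lee_fin boltz_ge0.
apply: ge0_le_integral => //.
- by move=> x _; rewrite lee_fin mulr_ge0 ?expR_ge0 ?boltz_ge0.
- apply/measurable_EFinP; apply: measurable_funM => //.
  by apply: (measurableT_comp (@measurable_expR R)); exact: measurable_dot_fun.
- by apply: emeasurable_funD; apply: emeasurable_funM => //; exact/measurable_EFinP.
move=> x _; rewrite -!EFinM -EFinD lee_fin.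
have := phiN x; case E: (phi x) => [a||]// _; last first.
  have -> : boltz x = 0 by rewrite /boltz E.
  by rewrite !mulr0 add0r mulr_ge0 ?expR_ge0 ?powR_ge0.
set m := Num.max 1 (a - k%:R).
have m0 : 0 <= m by rewrite le_max ler01.
have D : dot x y <= dot x0 y + m / 2.
  rewrite -lerBlDl; have -> : dot x y - dot x0 y = \sum_i (x 0 i - x0 0 i) * y 0 i.
    by rewrite /dot -sumrB; apply: eq_bigr => i _; rewrite mulrBl.
  apply: (@le_trans _ _ (\sum_(i < n) (r * m * e))).
    apply: ler_sum => i _; apply: le_trans (ler_norm _) _; rewrite normrM.
    by apply: ler_pM => //; exact: H.
  rewrite sumr_const card_ord -[X in X <= _]mulr_natr.
  have -> : r * m * e * n%:R = n%:R / n.+1%:R * (m / 2).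
    have d0 : n.+1%:R != 0 :> R by rewrite pnatr_eq0.
    rewrite /e; move: (n.+1%:R : R) d0 => d d0.
    by field; rewrite (gt_eqF r0) d0.
  by rewrite ler_piMl ?divr_ge0// ler_pdivrMr// mul1r ler_nat.
apply: (@le_trans _ _ (B * (expR (m / 2) * boltz x))).
  by rewrite mulrA ler_wpM2r ?boltz_ge0// -expRD ler_expR.
rewrite /A -mulrA -mulrDr ler_pM2l ?expR_gt0//.
rewrite (boltz_fin E) -expRM -!expRD /m; have [ak|ak] := leP 1 (a - k%:R).
  apply: (@le_trans _ _ (expR (- a / 2))); last by rewrite lerDr expR_ge0.
  rewrite ler_expR; have : 0 <= k%:R :> R by []. lra.
by rewrite mul1r lerDl expR_ge0.
Qed.

End convex_growth.

(** * Positivity of the polar integral *)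

Section polar_positive.
Context {R : realType} {n : nat}.
Local Notation mu := (lebesgue_rV n).
Variable f0 : 'rV[R]_n -> R.
Hypothesis mf0 : measurable_fun setT f0.
Hypothesis f0_ge0 : forall y, 0 <= f0 y.
Hypothesis f0_int : mu.-integrable setT (EFin \o f0).
Hypothesis f0_gt0 : (0 < \int[mu]_x (f0 x)%:E)%E.
Variable p : R.
Hypothesis p0 : 0 < p.
Implicit Types (s r : R) (x y z u v w : 'rV[R]_n).

Local Notation tilt := (tilt f0 p).
Local Notation tmass := (tmass f0 p).
Local Notation polar := (polar f0 p).
Local Notation flow := (flow f0).

(** The Laplace transform of a convolution is the product of those of the
    density and of the Gaussian. *)
Lemma flow_exp_moment s y : 0 < s ->
  (\int[mu]_z (expR (dot z y) * flow s z)%:E =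
   \int[mu]_x (expR (dot x y) * f0 x)%:E * (expR (s / 2 * sqnorm y))%:E)%E.
Proof.
move=> s0; have [b _ _ _] := @bmeas_heat_family R n s s0.
have mexp d (T : measurableType d) (f : T -> 'rV[R]_n) : measurable_fun setT f ->
    measurable_fun setT (fun t => expR (dot (f t) y)).
  by move=> mf; apply: (measurableT_comp (@measurable_expR R)); exact: measurable_dot_fun.
have mT : measurable_fun setT (fun t : 'rV[R]_n * 'rV[R]_n =>
    (expR (dot t.1 y) * (heat s (t.1 - t.2) * f0 t.2))%:E).
  apply/measurable_EFinP; apply: measurable_funM; first exact: mexp.
  apply: measurable_funM; last exact: measurableT_comp.
  by apply: measurable_heat_fun; exact: measurable_sub_fun.
have T0 (t : 'rV[R]_n * 'rV[R]_n) : (0 <=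
    (expR (dot t.1 y) * (heat s (t.1 - t.2) * f0 t.2))%:E)%E.
  by rewrite lee_fin !mulr_ge0 ?expR_ge0.
transitivity (\int[mu]_z \int[mu]_x (expR (dot z y) * (heat s (z - x) * f0 x))%:E)%E.
  apply: eq_integral => z _; rewrite EFinM (EFin_convol mf0 f0_ge0 f0_int z b).
  rewrite -ge0_integralZl_EFin ?expR_ge0//.
  - by move=> x _; rewrite lee_fin mulr_ge0// expR_ge0.
  - apply/measurable_EFinP; apply: measurable_funM => //.
    by apply: measurable_heat_fun; exact: measurable_sub_fun.
rewrite (fubini_tonelli _ mT T0)/= -ge0_integralZr//; last 2 first.
- by apply/measurable_EFinP; apply: measurable_funM => //; exact: mexp.
- by move=> x _; rewrite lee_fin mulr_ge0 ?expR_ge0.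
apply: eq_integral => x _.
have mg : measurable_fun setT (fun z : 'rV[R]_n => (expR (dot z y) * (heat s (z - x) * f0 x))%:E).
  apply/measurable_EFinP; apply: measurable_funM; first exact: mexp.
  by apply: measurable_funM => //; apply: measurable_heat_fun; exact: measurable_sub_fun.
rewrite -(ge0_integral_rV_translate x mg); last first.
  by move=> z; rewrite lee_fin !mulr_ge0 ?expR_ge0.
rewrite -integral_expR_dot_heat// -ge0_integralZl_EFin ?mulr_ge0 ?expR_ge0//; last 2 first.
- by move=> z _; rewrite lee_fin mulr_ge0 ?expR_ge0.
- apply/measurable_EFinP; apply: measurable_funM; first exact: mexp.
  exact: measurable_heat_fun.
apply: eq_integral => z _; rewrite -EFinM; congr EFin.
by rewrite addrK dotDl expRD; ring.
Qed.

(** The flow at time 1 is bounded, so [flow ^ (p + 1)] is at most a multiple of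
    [flow], whose Laplace transform is explicit. *)
Lemma tmass_moment y : (\int[mu]_x (expR (dot x (p *: y)) * f0 x)%:E < +oo)%E ->
  (tmass 1 y < +oo)%E.
Proof.
move=> My; have [C C0 HC] := flow_bounded mf0 f0_ge0 f0_int f0_gt0 (@ltr01 R).
have mfl : measurable_fun setT (fun z => expR (dot z (p *: y)) * flow 1 z).
  apply: measurable_funM; last exact: measurable_flow.
  by apply: (measurableT_comp (@measurable_expR R)); exact: measurable_dot_fun.
have fl0 z : 0 < flow 1 z by exact: flow_gt0.
apply: (@le_lt_trans _ _ (\int[mu]_z ((C `^ p)%:E * (expR (dot z (p *: y)) * flow 1 z)%:E))%E).
  apply: ge0_le_integral => //.
  - by move=> z _; rewrite lee_fin tilt_ge0.
  - by apply/measurable_EFinP; exact: measurable_tilt_fun.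
  - by apply: emeasurable_funM => //; exact/measurable_EFinP.
  move=> z _; rewrite -EFinM lee_fin /tilt dotZr mulrCA ler_pM2l ?expR_gt0//.
  rewrite powRD ?(gt_eqF (fl0 z)) ?implybT// (powRr1 (ltW (fl0 z))) ler_pM2r//.
  by rewrite ge0_ler_powR ?nnegrE ?(ltW p0) ?(ltW C0) ?(ltW (fl0 z)).
rewrite ge0_integralZl_EFin ?powR_ge0//; last 2 first.
- by move=> z _; rewrite lee_fin mulr_ge0 ?expR_ge0// ltW.
- exact/measurable_EFinP.
rewrite flow_exp_moment// lte_mul_pinfty ?lee_fin ?powR_ge0//.
rewrite muleC lte_mul_pinfty ?lee_fin ?expR_ge0//.
Qed.

(** On a small box around 0 the mass is finite, so [polar] is positive there,
    and a box has positive volume. *)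
Lemma polar_int_gt0 s : 0 < s ->
  (exists2 e : R, 0 < e & forall y : 'rV[R]_n, (forall i, `|y 0 i| <= e) ->
    (\int[mu]_x (expR (dot x y) * f0 x)%:E < +oo)%E) ->
  (0 < \int[mu]_y (polar s y)%:E)%E.
Proof.
move=> s0 [e e0 He]; pose a := e / p.
have a0 : 0 < a by rewrite divr_gt0.
pose B := [set y : 'rV[R]_n | forall i, `[- a, a]%classic (y 0 i)].
have mB : measurable B.
  exact: (measurable_coord_set (P := fun=> `[- a, a]%classic)).
have muB : (0 < mu B)%E.
  rewrite /B (lebesgue_rV_box (A := fun=> `[- a, a]%classic))//.
  apply: (big_ind (fun z : \bar R => 0 < z)%E) => [||i _]; [exact: lte01|exact: mule_gt0|].
  have aa : - a < a by rewrite gtrN.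
  by rewrite lebesgue_measure_itv/= lte_fin aa -EFinB lte_fin opprK addr_gt0.
have BD y : B y -> (tmass 1 y < +oo)%E.
  move=> By; apply: tmass_moment; apply: He => i; rewrite mxE normrM gtr0_norm//.
  by have := By i; rewrite /= in_itv/= -ler_norml /a ler_pdivlMr// mulrC.
have mP := measurable_polar mf0 p s.
have mind : measurable_fun setT (\1_B : 'rV[R]_n -> R) by exact: measurable_indic.
(* The factor [1 - \1_B + polar * \1_B] is positive everywhere and coincides
   with [polar] on the box. *)
apply: (@lt_le_trans _ _ (\int[mu]_y ((1 - \1_B y + polar s y * \1_B y) * \1_B y)%:E)%E).
  apply: integral_mul_gt0 => //.
  - by apply: measurable_funD; [exact: measurable_funB|exact: measurable_funM].
  - move=> y; rewrite indicE; have [/set_mem By|_] := boolP (y \in B).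
      by rewrite subrr add0r mulr1 (polar_gt0 mf0 f0_ge0 f0_int f0_gt0 p0 s0 (BD y By)).
    by rewrite subr0 mulr0 addr0.
  - by rewrite integral_indic// setIT.
apply: ge0_le_integral => //.
- move=> y _; rewrite lee_fin; have : (\1_B y : R) = 0 \/ (\1_B y : R) = 1.
    by rewrite indicE; case: (_ \in _); [right|left].
  by have := polar_ge0 f0 p s y; move=> P0 [->|->]; rewrite ?mulr0// mulr1 subrr add0r !mulr1.
- apply/measurable_EFinP; apply: measurable_funM => //.
  by apply: measurable_funD; [exact: measurable_funB|exact: measurable_funM].
- exact/measurable_EFinP.
move=> y _; rewrite lee_fin indicE; case: (_ \in _).
  by rewrite subrr add0r !mulr1.
by rewrite mulr0 polar_ge0.
Qed.

End polar_positive.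

(** * From the Ornstein-Uhlenbeck flow to the heat flow *)

(** Directional derivatives are taken along lines, where the one-variable chain
    rules apply. *)
Lemma derive_line {R : realType} {n : nat} (f : 'rV[R]_n -> R) (x v : 'rV[R]_n) (d : R) :
  is_derive (0 : R) 1 (fun r : R => f (x + r *: v)) d -> 'D_v f x = d.
Proof.
move=> [_ <-]; rewrite /derive.
have -> : (fun h : R => h^-1 *: ((f \o shift x) (h *: v) - f x)) =
  (fun h : R => h^-1 *: (((fun r : R => f (x + r *: v)) \o shift 0) (h *: 1) - f (x + 0 *: v))) => //.
apply/funext => h /=; rewrite scale0r !addr0 [h *: v + x]addrC.
by rewrite /GRing.scale/= mulr1.
Qed.

Section fokker_planck_flow.
Context {R : realType} {n : nat}.
Local Notation mu := (lebesgue_rV n).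
Variable phi0 : 'rV[R]_n -> \bar R.
Variable f0 : 'rV[R]_n -> R.
Hypothesis phi0E : forall y, expeR (- phi0 y) = (f0 y)%:E.
Hypothesis mf0 : measurable_fun setT f0.
Hypothesis f0_ge0 : forall y, 0 <= f0 y.
Hypothesis f0_int : mu.-integrable setT (EFin \o f0).
Hypothesis f0_gt0 : (0 < \int[mu]_x (f0 x)%:E)%E.
Variable p : R.
Hypothesis p0 : 0 < p.
Implicit Types (x y z : 'rV[R]_n).

Local Notation flow := (flow f0).
Local Notation tmass := (tmass f0 p).
Local Notation rmass := (rmass f0 p).
Local Notation tilt := (tilt f0 p).
Local Notation polar := (polar f0 p).

(** The time of the heat flow that corresponds to time [t]: dilating by [e^t]
    turns the variance [1 - e^(-2t)] into [e^(2t) - 1]. *)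
Definition heat_time (t : R) : R := expR (2 * t) - 1.

(** The function [exp (- phi(t, x))] in the variables of the heat flow; see
    [ouE]. *)
Definition ou (t : R) x : R := expR (n%:R * t) * flow (heat_time t) (expR t *: x).

Lemma heat_time_gt0 t : 0 < t -> 0 < heat_time t.
Proof. by move=> t0; rewrite subr_gt0 expR_gt1 mulr_gt0. Qed.

Lemma ou_gt0 t x : 0 < t -> 0 < ou t x.
Proof.
move=> t0; rewrite mulr_gt0 ?expR_gt0//.
by rewrite (flow_gt0 mf0 f0_ge0 f0_int f0_gt0)// heat_time_gt0.
Qed.

(** The left-hand side is the kernel in the definition of [phi(t, x)]. *)
Lemma heat_ou (t : R) x y : 0 < t -> let s := 1 - expR (- (2 * t)) in
  expR (- (sqnorm (x - expR (- t) *: y) / (2 * s))) / (2 * pi * s) `^ (n%:R / 2) =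
  expR (n%:R * t) * heat (heat_time t) (expR t *: x - y).
Proof.
move=> t0 /=; set s := 1 - _.
have s0 : 0 < s by rewrite subr_gt0 expR_lt1 oppr_lt0 mulr_gt0.
have ht : heat_time t = expR (2 * t) * s.
  by rewrite /s mulrBr mulr1 -expRD subrr expR0.
have ps : 0 < 2 * pi * s by rewrite !mulr_gt0// pi_gt0.
have -> : expR t *: x - y = expR t *: (x - expR (- t) *: y).
  by rewrite scalerBr scalerA -expRD subrr expR0 scale1r.
rewrite /heat sqnormZ ht (_ : 2 * pi * (expR (2 * t) * s) = expR (2 * t) * (2 * pi * s)); last by ring.
rewrite lnM ?posrE ?expR_gt0// expRK.
have e2 : expR t ^+ 2 = expR (2 * t) by rewrite -expRM_natl.
rewrite e2 /powR gt_eqF// -expRN -!expRD; congr expR.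
have E0 : expR (2 * t) != 0 by rewrite gt_eqF ?expR_gt0.
move: (expR (2 * t)) E0 (sqnorm _) (ln _) => a a0 b c.
by field; rewrite a0 gt_eqF.
Qed.

Lemma ouE t x : 0 < t -> expeR (- fokker_planck phi0 t x) = (ou t x)%:E /\
  fokker_planck phi0 t x = (- ln (ou t x))%:E.
Proof.
move=> t0; suff E : fokker_planck phi0 t x = (- ln (ou t x))%:E.
  by rewrite E; split=> //=; rewrite opprK lnK// posrE ou_gt0.
rewrite /fokker_planck t0; set I := (\int[_]_y _)%E.
suff -> : I = (ou t x)%:E by rewrite lne_EFin ?ou_gt0.
have ht0 := heat_time_gt0 t0.
have [b _ _ _] := @bmeas_heat_family R n _ ht0.
rewrite /ou EFinM /flow (EFin_convol mf0 f0_ge0 f0_int _ b).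
rewrite -ge0_integralZl_EFin ?expR_ge0//; last 2 first.
- by move=> y _; rewrite lee_fin mulr_ge0 ?expR_ge0.
- apply/measurable_EFinP; apply: measurable_funM => //.
  by apply: measurable_heat_fun; exact: measurable_sub_fun.
apply: eq_integral => y _; rewrite phi0E.
have s0 : 0 < 1 - expR (- (2 * t)) by rewrite subr_gt0 expR_lt1 oppr_lt0 mulr_gt0.
have ps : (2 * pi * (1 - expR (- (2 * t)))) `^ (n%:R / 2) != 0.
  by rewrite gt_eqF// powR_gt0// !mulr_gt0// pi_gt0.
rewrite inver (negbTE ps) -!EFinM; congr EFin.
have := heat_ou x y t0 => /= H; rewrite [RHS]mulrA -H; ring.
Qed.

Lemma integral_dilate t (g : 'rV[R]_n -> \bar R) : measurable_fun setT g -> (forall x, 0 <= g x)%E ->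
  (\int[mu]_x g (expR t *: x)%R = (expR (- (n%:R * t)))%:E * \int[mu]_x g x)%E.
Proof.
move=> mg g0; rewrite [in RHS](ge0_integral_rV_affine 0 (expR_gt0 t) mg g0).
rewrite muleA -EFinM -expRM_natl -expRD addrC subrr expR0 mul1e.
by under [RHS]eq_integral do rewrite addr0.
Qed.

Lemma integral_dilateZ t (c : R) (g : 'rV[R]_n -> \bar R) : 0 <= c ->
  measurable_fun setT g -> (forall x, 0 <= g x)%E ->
  (\int[mu]_x (c%:E * g (expR t *: x)%R) = (c * expR (- (n%:R * t)))%:E * \int[mu]_x g x)%E.
Proof.
move=> c0 mg g0; rewrite EFinM -muleA -(integral_dilate t mg g0).
apply: ge0_integralZl_EFin => //.
by apply: measurableT_comp => //; exact: measurable_scale_fun.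
Qed.

Lemma V_f0 : V phi0 = (\int[mu]_x (f0 x)%:E)%E.
Proof. by apply: eq_integral => x _; rewrite phi0E. Qed.

Lemma V_fokker_planck t : 0 < t -> V (fokker_planck phi0 t) = V phi0.
Proof.
move=> t0; have ht0 := heat_time_gt0 t0.
have mfl := measurable_flow mf0 (heat_time t).
have fl0 x : (0 <= (flow (heat_time t) x)%:E)%E.
  by rewrite lee_fin flow_ge0.
rewrite V_f0 -(integral_flow mf0 f0_ge0 f0_int ht0).
have mflE : measurable_fun setT (fun x => (flow (heat_time t) x)%:E) by exact/measurable_EFinP.
have D := @integral_dilateZ t (expR (n%:R * t)) _ (expR_ge0 _) mflE fl0.
rewrite -expRD subrr expR0 mul1e in D; apply: etrans D.
by apply: eq_integral => x _; rewrite (ouE x t0).1 EFinM.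
Qed.

Let v : R := fine (V phi0).

Let vE : V phi0 = v%:E.
Proof. by rewrite fineK// V_f0; exact: (integrable_fin_num measurableT f0_int). Qed.

Let v0 : 0 < v. Proof. by rewrite -lte_fin -vE V_f0. Qed.

(** The unnormalised density of [d phi^{p,y}] before the dilation. *)
Definition weight t y x : R := expR (p * dot x y) * ou t x `^ (p + 1).

Lemma weightE t y x :
  weight t y x = expR (n%:R * t * (p + 1)) * tilt (heat_time t) (expR (- t) *: y) (expR t *: x).
Proof.
rewrite /weight /ou /tilt.
have -> : dot (expR t *: x) (expR (- t) *: y) = dot x y.
  by rewrite dotZl dotZr mulrA -expRD subrr expR0 mul1r.
rewrite powRM ?expR_ge0//; last first.
  exact: flow_ge0.
by rewrite -expRM; ring.
Qed.

Lemma measurable_weight t y : measurable_fun setT (weight t y).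
Proof.
rewrite (_ : weight t y = fun x => expR (n%:R * t * (p + 1)) *
    tilt (heat_time t) (expR (- t) *: y) (expR t *: x)); last first.
  by apply/funext => x; rewrite weightE.
apply: measurable_funM => //; apply: (measurable_tilt_fun mf0) => //.
exact: measurable_scale_fun.
Qed.

Lemma integral_weight t y :
  (\int[mu]_x (weight t y x)%:E =
   (expR (n%:R * t * p))%:E * tmass (heat_time t) (expR (- t) *: y))%E.
Proof.
have mt := measurable_tilt_fun mf0 p (heat_time t).
have mt1 : measurable_fun setT (fun z : 'rV[R]_n => (tilt (heat_time t) (expR (- t) *: y) z)%:E).
  by apply/measurable_EFinP; exact: mt.
have ti0 z : (0 <= (tilt (heat_time t) (expR (- t) *: y) z)%:E)%E by rewrite lee_fin tilt_ge0.
have D := @integral_dilateZ t (expR (n%:R * t * (p + 1))) _ (expR_ge0 _) mt1 ti0.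
rewrite -expRD (_ : n%:R * t * (p + 1) - n%:R * t = n%:R * t * p) in D; last by ring.
apply: etrans D.
by apply: eq_integral => x _; rewrite weightE// EFinM.
Qed.

Lemma expeR_tilt t y x : 0 < t ->
  expeR ((p * dot x y)%:E - (p + 1)%:E * fokker_planck phi0 t x) = (weight t y x)%:E.
Proof.
move=> t0; rewrite (ouE x t0).2 -EFinM -EFinB /=; congr EFin.
by rewrite expRD mulrN opprK /weight /powR gt_eqF ?ou_gt0.
Qed.

Lemma legendre_integral t y : 0 < t ->
  (\int[mu]_x (expeR (p%:E * ((dot x y)%:E - fokker_planck phi0 t x)) * gibbs (fokker_planck phi0 t) x) =
   (v^-1 * expR (n%:R * t * p))%:E * tmass (heat_time t) (expR (- t) *: y))%E.
Proof.
move=> t0; rewrite EFinM -muleA -integral_weight//.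
rewrite -ge0_integralZl_EFin ?invr_ge0 ?(ltW v0)//; last 2 first.
- by move=> x _; rewrite lee_fin mulr_ge0 ?expR_ge0 ?powR_ge0.
- by apply/measurable_EFinP; exact: measurable_weight.
apply: eq_integral => x _; rewrite /gibbs V_fokker_planck// vE (ouE x t0).1 (ouE x t0).2.
rewrite inver gt_eqF// -EFinB -!EFinM/=; congr EFin.
have o0 := ou_gt0 x t0.
rewrite /weight powRD ?(gt_eqF o0) ?implybT// (powRr1 (ltW o0)).
by rewrite opprK mulrDr expRD /powR (gt_eqF o0); ring.
Qed.

Lemma legendre_fin t y : 0 < t -> (tmass 1 (expR (- t) *: y) < +oo)%E ->
  lp_legendre p (fokker_planck phi0 t) y =
  (p^-1 * (n%:R * t * p - ln v + ln (rmass (heat_time t) (expR (- t) *: y))))%:E.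
Proof.
move=> t0 yD; have ht0 := heat_time_gt0 t0.
have w0 := rmass_gt0 mf0 f0_ge0 f0_int f0_gt0 p0 yD ht0.
have wE := EFin_rmass mf0 f0_ge0 f0_int f0_gt0 p0 yD ht0.
have := legendre_integral y t0; rewrite -wE /lp_legendre => ->.
move: (rmass _ _) w0 => w w0.
have c0 : 0 < v^-1 * expR (n%:R * t * p) by rewrite mulr_gt0 ?invr_gt0 ?expR_gt0.
have cw0 : 0 < v^-1 * expR (n%:R * t * p) * w by exact: mulr_gt0.
rewrite -EFinM (lne_EFin cw0) -EFinM; congr EFin; congr (_ * _).
have vi0 : 0 < v^-1 by rewrite invr_gt0.
rewrite (lnM c0 w0) (lnM vi0 (expR_gt0 _)) (lnV v0) expRK.
by congr (_ + _); rewrite addrC.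
Qed.

Lemma legendre_infty t y : 0 < t -> ~~ (tmass 1 (expR (- t) *: y) < +oo)%E ->
  lp_legendre p (fokker_planck phi0 t) y = +oo%E.
Proof.
move=> t0 yD; have ht0 := heat_time_gt0 t0.
have WE : tmass (heat_time t) (expR (- t) *: y) = +oo%E.
  apply/eqP; rewrite -leye_eq leNgt.
  by rewrite (tmass_dom mf0 f0_ge0 f0_int f0_gt0 p0 (expR (- t) *: y) ht0).
have := legendre_integral y t0; rewrite WE /lp_legendre => ->.
have c0 : 0 < v^-1 * expR (n%:R * t * p) by rewrite mulr_gt0 ?invr_gt0 ?expR_gt0.
by rewrite gt0_muley ?lte_fin//= gt0_muley ?lte_fin ?invr_gt0.
Qed.

(** The ratio of [exp (- psi)] to the dilated [polar]; see [expeR_legendre]. *)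
Definition kappa t : R := v `^ p^-1 * expR (- (n%:R * t)).

Lemma kappa_gt0 t : 0 < kappa t.
Proof. by rewrite mulr_gt0 ?powR_gt0 ?expR_gt0. Qed.

Lemma legendre_dom t y : 0 < t ->
  (lp_legendre p (fokker_planck phi0 t) y < +oo)%E = (tmass 1 (expR (- t) *: y) < +oo)%E.
Proof.
move=> t0; have [yD|yD] := boolP (tmass 1 (expR (- t) *: y) < +oo)%E.
  by rewrite legendre_fin// ltry.
by rewrite legendre_infty.
Qed.

Lemma expeR_legendre t y : 0 < t ->
  expeR (- lp_legendre p (fokker_planck phi0 t) y) =
    (kappa t * polar (heat_time t) (expR (- t) *: y))%:E.
Proof.
move=> t0; have ht0 := heat_time_gt0 t0.
have [yD|yD] := boolP (tmass 1 (expR (- t) *: y) < +oo)%E; last first.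
  by rewrite legendre_infty// (polar_out mf0 f0_ge0 f0_int f0_gt0 p0 ht0 yD) mulr0.
have w0 := rmass_gt0 mf0 f0_ge0 f0_int f0_gt0 p0 yD ht0.
rewrite legendre_fin// /kappa /polar; move: (rmass _ _) w0 => w w0 /=; congr EFin.
rewrite /powR !gt_eqF// -!expRD; congr expR.
by move: (ln _) (ln _) => a b; field; rewrite gt_eqF.
Qed.

Local Notation psi t := (lp_legendre p (fokker_planck phi0 t)).

Definition vpolar s : R := \int[mu]_y polar s y.

Lemma EFin_vpolar s : 0 < s -> (vpolar s)%:E = (\int[mu]_y (polar s y)%:E)%E.
Proof.
move=> s0; have [i _ _] := polar_integrable mf0 f0_ge0 f0_int f0_gt0 p0 s0.
by rewrite /vpolar /Rintegral fineK//; exact: (integrable_fin_num measurableT i).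
Qed.

Lemma kappa_dilate t : kappa t * expR (n%:R * t) = v `^ p^-1.
Proof. by rewrite /kappa -mulrA -expRD addNr expR0 mulr1. Qed.

(** The dilation of [y] cancels the factor [e^(- n t)] of [kappa], so only [V
    phi0 ^ (1/p)] remains. *)
Lemma integral_expeR_psi t (g : 'rV[R]_n -> R) : 0 < t ->
  measurable_fun setT g -> (forall y, 0 <= g y) ->
  (\int[mu]_y ((g (expR (- t) *: y))%:E * expeR (- psi t y)) =
   (v `^ p^-1)%:E * \int[mu]_y (g y * polar (heat_time t) y)%:E)%E.
Proof.
move=> t0 mg g0; have mP := measurable_polar mf0 p (heat_time t).
have mgP : measurable_fun setT (fun y => (g y * polar (heat_time t) y)%:E).
  by apply/measurable_EFinP; exact: measurable_funM.
have gP0 y : (0 <= (g y * polar (heat_time t) y)%:E)%E.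
  by rewrite lee_fin mulr_ge0// polar_ge0.
have D := @integral_dilateZ (- t) (kappa t) _ (ltW (kappa_gt0 t)) mgP gP0.
rewrite mulrN opprK kappa_dilate in D; apply: etrans D.
apply: eq_integral => y _; rewrite expeR_legendre// -!EFinM; congr EFin.
by rewrite mulrCA.
Qed.

Lemma V_psi t : 0 < t -> V (psi t) = (v `^ p^-1 * vpolar (heat_time t))%:E.
Proof.
move=> t0; rewrite EFinM EFin_vpolar ?heat_time_gt0//.
have := @integral_expeR_psi t (cst 1) t0 (measurable_cst _) (fun=> ler01).
under eq_integral do rewrite mul1e.
under [in X in _ = X -> _]eq_integral do rewrite mul1r.
by [].
Qed.

Hypothesis f0_moment : exists2 e : R, 0 < e & forall y : 'rV[R]_n, (forall i, `|y 0 i| <= e) ->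
    (\int[mu]_x (expR (dot x y) * f0 x)%:E < +oo)%E.

Lemma vpolar_gt0 s : 0 < s -> 0 < vpolar s.
Proof.
move=> s0; rewrite -lte_fin EFin_vpolar//.
exact: (polar_int_gt0 mf0 f0_ge0 f0_int f0_gt0 p0 s0 f0_moment).
Qed.

Lemma integral_gibbs_psi t (g : 'rV[R]_n -> R) : 0 < t ->
  measurable_fun setT g -> (forall y, 0 <= g y) ->
  mu.-integrable setT (EFin \o (fun y => polar (heat_time t) y * g y)) ->
  (\int[mu]_y ((g (expR (- t) *: y))%:E * gibbs (psi t) y) =
   ((\int[mu]_y (polar (heat_time t) y * g y)) / vpolar (heat_time t))%:E)%E.
Proof.
move=> t0 mg g0 gi; have F0 := vpolar_gt0 (heat_time_gt0 t0).
have k0 : 0 < v `^ p^-1 by rewrite powR_gt0.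
pose W := v `^ p^-1 * vpolar (heat_time t).
have W0 : 0 < W by rewrite mulr_gt0.
transitivity (\int[mu]_y ((W^-1)%:E * ((g (expR (- t) *: y))%:E * expeR (- psi t y))))%E.
  apply: eq_integral => y _; rewrite /gibbs V_psi// -/W inver gt_eqF//.
  by rewrite muleA [RHS]muleC.
rewrite ge0_integralZl_EFin ?invr_ge0 ?(ltW W0)//; last 2 first.
- by move=> y _; rewrite mule_ge0 ?lee_fin ?expeR_ge0.
- under eq_fun do rewrite expeR_legendre// -EFinM.
  apply/measurable_EFinP; apply: measurable_funM.
    by apply: measurableT_comp => //; exact: measurable_scale_fun.
  apply: measurable_funM => //; apply: (measurableT_comp (measurable_polar mf0 p _)).
  exact: measurable_scale_fun.
rewrite integral_expeR_psi// muleA -EFinM.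
have -> : (\int[mu]_y (g y * polar (heat_time t) y)%:E =
  (\int[mu]_y (polar (heat_time t) y * g y))%:E)%E.
  rewrite /Rintegral fineK; last exact: (integrable_fin_num measurableT gi).
  by apply: eq_integral => y _; rewrite mulrC.
rewrite -EFinM; congr EFin; rewrite /W.
move: (v `^ _) k0 (\int[_]_y _) (vpolar _) F0 => a a0 b c c0.
by field; rewrite (gt_eqF a0) (gt_eqF c0).
Qed.

End fokker_planck_flow.

(** * The derivative of the volume product *)

Section entropy_identity.
Context {R : realType} {n : nat}.
Local Notation mu := (lebesgue_rV n).
Variable phi0 : 'rV[R]_n -> \bar R.
Variable f0 : 'rV[R]_n -> R.
Hypothesis phi0E : forall y, expeR (- phi0 y) = (f0 y)%:E.
Hypothesis mf0 : measurable_fun setT f0.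
Hypothesis f0_ge0 : forall y, 0 <= f0 y.
Hypothesis f0_int : mu.-integrable setT (EFin \o f0).
Hypothesis f0_gt0 : (0 < \int[mu]_x (f0 x)%:E)%E.
Variable p : R.
Hypothesis p0 : 0 < p.
Hypothesis f0_moment : exists2 e : R, 0 < e & forall y : 'rV[R]_n, (forall i, `|y 0 i| <= e) ->
    (\int[mu]_x (expR (dot x y) * f0 x)%:E < +oo)%E.
Implicit Types (t : R) (x y z : 'rV[R]_n).

Local Notation tmass := (tmass f0 p).
Local Notation rmass := (rmass f0 p).
Local Notation tilt := (tilt f0 p).
Local Notation rfisher := (rfisher f0 p).
Local Notation polar := (polar f0 p).
Local Notation psi t := (lp_legendre p (fokker_planck phi0 t)).
Local Notation vpolar := (vpolar f0 p).
Local Notation v := (fine (V phi0)).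

Let vE : V phi0 = v%:E.
Proof. by rewrite fineK// (V_f0 phi0E); exact: (integrable_fin_num measurableT f0_int). Qed.

Let v0 : 0 < v. Proof. by rewrite -lte_fin -vE (V_f0 phi0E). Qed.

Lemma tiltedE t y x : 0 < t -> (tmass 1 (expR (- t) *: y) < +oo)%E ->
  tilted p (fokker_planck phi0 t) y x =
  expR (n%:R * t) / rmass (heat_time t) (expR (- t) *: y) *
  tilt (heat_time t) (expR (- t) *: y) (expR t *: x).
Proof.
move=> t0 yD; have ht0 := heat_time_gt0 t0.
have w0 := rmass_gt0 mf0 f0_ge0 f0_int f0_gt0 p0 yD ht0.
have wE := EFin_rmass mf0 f0_ge0 f0_int f0_gt0 p0 yD ht0.
rewrite /tilted.
have -> : (\int[mu]_z expeR ((p * dot z y)%:E - (p + 1)%:E * fokker_planck phi0 t z) =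
  (expR (n%:R * t * p) * rmass (heat_time t) (expR (- t) *: y))%:E)%E.
  rewrite EFinM wE; have H := integral_weight mf0 f0_ge0 p t y.
  apply: etrans H; apply: eq_integral => z _.
  exact: (expeR_tilt phi0E mf0 f0_ge0 f0_int f0_gt0).
rewrite (expeR_tilt phi0E mf0 f0_ge0 f0_int f0_gt0 p y x t0).
rewrite (weightE f0_ge0 p t y x).
move: (rmass _ _) w0 => w w0; have e0 := expR_gt0 (n%:R * t * p).
have ew : expR (n%:R * t * p) * w != 0 by rewrite gt_eqF// mulr_gt0.
rewrite inver (negbTE ew) -EFinM /= mulrDr mulr1 expRD.
by field; rewrite (gt_eqF w0) (gt_eqF e0).
Qed.

Lemma grad_ln_tilted t y x i : 0 < t -> (tmass 1 (expR (- t) *: y) < +oo)%E ->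
  grad (fun z => ln (tilted p (fokker_planck phi0 t) y z)) x 0 i =
  expR t * lscore f0 p i (heat_time t) (expR (- t) *: y) (expR t *: x).
Proof.
move=> t0 yD; have ht0 := heat_time_gt0 t0; rewrite mxE.
have w0 := rmass_gt0 mf0 f0_ge0 f0_int f0_gt0 p0 yD ht0.
have tE r := tiltedE (x + r *: delta_mx 0 i) t0 yD.
move: (heat_time t) (expR (- t) *: y) ht0 w0 tE {yD} => s y' s0 w0 tE.
pose c := expR (n%:R * t) / rmass s y'.
have c0 : 0 < c by rewrite divr_gt0 ?expR_gt0.
apply: derive_line; move: (expR t) tE => a tE.
have {}tE : (fun r : R => ln (tilted p (fokker_planck phi0 t) y (x + r *: delta_mx 0 i))) =
  (fun r : R => ln (c * tilt s y' (a *: x + (a * r) *: delta_mx 0 i))).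
  by apply/funext => r; rewrite (tE r) scalerDr scalerA.
rewrite tE; move: (a *: x) => z {tE}.
have H1 := is_derive_tilt_coord mf0 f0_ge0 f0_int f0_gt0 p i y' z (a * 0) s0.
have H2 : is_derive (0 : R) 1 (fun r : R => a * r) (a * 1) by exact: is_deriveZ.
have H3 := @is_derive1_comp _ (fun r => tilt s y' (z + r *: delta_mx 0 i)) (fun r => a * r) 0 _ _ H1 H2.
have H4 := is_deriveZ c H3.
have T0 : 0 < tilt s y' z by exact: (tilt_gt0 mf0 f0_ge0 f0_int f0_gt0).
have g0 : 0 < c * tilt s y' (z + (a * 0) *: delta_mx 0 i).
  by rewrite mulr0 scale0r addr0 mulr_gt0.
apply: (is_derive_eq (@is_derive_ln_comp _ (fun r => c * tilt s y' (z + (a * r) *: delta_mx 0 i)) 0 _ g0 H4)).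
rewrite /= mulr0 scale0r addr0 /lscore /GRing.scale/=.
by field; rewrite (gt_eqF c0) (gt_eqF T0).
Qed.

(** Two factors [e^t] come from the gradient of a dilated function. *)
Lemma fisher_tilted t y : 0 < t -> (tmass 1 (expR (- t) *: y) < +oo)%E ->
  fisher (tilted p (fokker_planck phi0 t) y) =
  (expR (2 * t) * (rfisher (heat_time t) (expR (- t) *: y) /
                   rmass (heat_time t) (expR (- t) *: y)))%:E.
Proof.
move=> t0 yD; have ht0 := heat_time_gt0 t0.
have w0 := rmass_gt0 mf0 f0_ge0 f0_int f0_gt0 p0 yD ht0.
have [I _] := rfisherE mf0 f0_ge0 f0_int f0_gt0 p0 yD ht0.
have E : (rfisher (heat_time t) (expR (- t) *: y))%:E = (\int[mu]_z
    (tilt (heat_time t) (expR (- t) *: y) z *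
     \sum_i lscore f0 p i (heat_time t) (expR (- t) *: y) z ^+ 2)%:E)%E.
  by rewrite /rfisher /Rintegral fineK//; exact: (integrable_fin_num measurableT I).
set K := expR (2 * t) * (expR (n%:R * t) / rmass (heat_time t) (expR (- t) *: y)).
have K0 : 0 <= K by rewrite mulr_ge0 ?divr_ge0 ?expR_ge0 ?(ltW w0).
have g0 z : (0 <= (tilt (heat_time t) (expR (- t) *: y) z *
     \sum_i lscore f0 p i (heat_time t) (expR (- t) *: y) z ^+ 2)%:E)%E.
  by rewrite lee_fin mulr_ge0 ?tilt_ge0// sumr_ge0// => i _; rewrite sqr_ge0.
have D := @integral_dilateZ _ n t K _ K0 (measurable_int _ I) g0.
rewrite -E -EFinM in D.
transitivity ((K * expR (- (n%:R * t)) * rfisher (heat_time t) (expR (- t) *: y))%:E); last first.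
  rewrite /K; congr EFin; rewrite (expRN (n%:R * t)).
  move: (rmass _ _) w0 (rfisher _ _) => w w0 r.
  by field; rewrite (gt_eqF w0) (gt_eqF (expR_gt0 _)).
apply: etrans D; apply: eq_integral => x _; rewrite -EFinM; congr EFin.
rewrite tiltedE// /K.
have -> : sqnorm (grad (fun z => ln (tilted p (fokker_planck phi0 t) y z)) x) =
  expR (2 * t) * \sum_i lscore f0 p i (heat_time t) (expR (- t) *: y) (expR t *: x) ^+ 2.
  rewrite /sqnorm /dot mulr_sumr; apply: eq_bigr => i _.
  by rewrite grad_ln_tilted// expRM_natl; ring.
ring.
Qed.

Definition polar_energy s : R := \int[mu]_y (polar s y * (rfisher s y / rmass s y)).
Definition polar_moment s : R := \int[mu]_y (polar s y * sqnorm y).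

Lemma sqnorm_dilate t y : expR (2 * t) * sqnorm (expR (- t) *: y) = sqnorm y.
Proof.
by rewrite sqnormZ mulrA -expRM_natl -expRD mulrN subrr expR0 mul1r.
Qed.

Lemma fisher_integral t : 0 < t ->
  (\int[mu]_(y in [set y | psi t y < +oo])
     (fisher (tilted p (fokker_planck phi0 t) y) * gibbs (psi t) y) =
   (expR (2 * t) * polar_energy (heat_time t) / vpolar (heat_time t))%:E)%E.
Proof.
move=> t0; have ht0 := heat_time_gt0 t0.
have [i1 i2 i3] := polar_integrable mf0 f0_ge0 f0_int f0_gt0 p0 ht0.
have j3 := integrableZ_real (expR (2 * t)) i3.
have G0 y : 0 <= expR (2 * t) * (rfisher (heat_time t) y / rmass (heat_time t) y).
  by rewrite mulr_ge0 ?expR_ge0// divr_ge0 ?rfisher_ge0 ?rmass_ge0.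
have mG : measurable_fun setT (fun y => expR (2 * t) * (rfisher (heat_time t) y / rmass (heat_time t) y)).
  by apply: measurable_funM => //; exact: measurable_rfisher_rmass.
have E2 : (fun y => polar (heat_time t) y * (expR (2 * t) * (rfisher (heat_time t) y / rmass (heat_time t) y))) =
  (fun y => expR (2 * t) * (polar (heat_time t) y * (rfisher (heat_time t) y / rmass (heat_time t) y))).
  by apply/funext => y; rewrite mulrCA.
have D := integral_gibbs_psi phi0E mf0 f0_ge0 f0_int f0_gt0 p0 f0_moment t0 mG G0.
rewrite E2 in D; have {D} := D j3.
rewrite RintegralZl// -/(polar_energy _) => D; apply: etrans D.
rewrite integral_mkcond; apply: eq_integral => y _; rewrite patchE.
have dE := legendre_dom phi0E mf0 f0_ge0 f0_int f0_gt0 p0 y t0.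
have [yD|yD] := boolP (tmass 1 (expR (- t) *: y) < +oo)%E.
  by rewrite mem_set ?fisher_tilted//= dE.
rewrite memNset/=; last by rewrite dE; exact/negP.
rewrite /gibbs (expeR_legendre phi0E mf0 f0_ge0 f0_int f0_gt0 p0 y t0).
by rewrite (polar_out mf0 f0_ge0 f0_int f0_gt0 p0 ht0 yD) mulr0 mul0e mule0.
Qed.

Lemma second_moment t : 0 < t ->
  (\int[mu]_y ((sqnorm y)%:E * gibbs (psi t) y) =
   (expR (2 * t) * polar_moment (heat_time t) / vpolar (heat_time t))%:E)%E.
Proof.
move=> t0; have ht0 := heat_time_gt0 t0.
have [i1 i2 i3] := polar_integrable mf0 f0_ge0 f0_int f0_gt0 p0 ht0.
have j2 := integrableZ_real (expR (2 * t)) i2.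
have G0 y : 0 <= expR (2 * t) * sqnorm y by rewrite mulr_ge0 ?expR_ge0 ?sqnorm_ge0.
have mG : measurable_fun setT (fun y : 'rV[R]_n => expR (2 * t) * sqnorm y).
  by apply: measurable_funM => //; exact: measurable_dot_fun.
have E2 : (fun y => polar (heat_time t) y * (expR (2 * t) * sqnorm y)) =
  (fun y => expR (2 * t) * (polar (heat_time t) y * sqnorm y)).
  by apply/funext => y; rewrite mulrCA.
have D := integral_gibbs_psi phi0E mf0 f0_ge0 f0_int f0_gt0 p0 f0_moment t0 mG G0.
rewrite E2 in D; have {D} := D j2.
rewrite RintegralZl// -/(polar_moment _) => D; apply: etrans D.
by apply: eq_integral => y _; rewrite sqnorm_dilate.
Qed.

(** On the diagonal the products of barycenters subtracted in [Cov] are added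
    back by the squared norm of the barycenter, which leaves the second moment. *)
Lemma trace_cov t : 0 < t ->
  \tr (Cov (psi t)) + sqnorm (barycenter (psi t)) =
  expR (2 * t) * polar_moment (heat_time t) / vpolar (heat_time t).
Proof.
move=> t0; have ht0 := heat_time_gt0 t0.
have [i1 i2 i3] := polar_integrable mf0 f0_ge0 f0_int f0_gt0 p0 ht0.
have mP := measurable_polar mf0 p (heat_time t).
have ij (i : 'I_n) : mu.-integrable setT (EFin \o (fun y => polar (heat_time t) y * y 0 i ^+ 2)).
  apply: integrable_le i2.
    apply: measurable_funM => //; apply: measurable_funX; exact: measurable_coord.
  move=> y; rewrite normrM (ger0_norm (polar_ge0 _ _ _ _)) (ger0_norm (sqr_ge0 _)).
  by rewrite ler_wpM2l ?polar_ge0// coord_sqr_le.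
have diag : forall k : 'I_n, (\int[mu]_y ((y 0 k * y 0 k)%:E * gibbs (psi t) y) =
   (expR (2 * t) * (\int[mu]_y (polar (heat_time t) y * y 0 k ^+ 2)) / vpolar (heat_time t))%:E)%E.
  move=> k; have G0 y : 0 <= expR (2 * t) * y 0 k ^+ 2 by rewrite mulr_ge0 ?expR_ge0 ?sqr_ge0.
  have mG : measurable_fun setT (fun y : 'rV[R]_n => expR (2 * t) * y 0 k ^+ 2).
    apply: measurable_funM => //; apply: measurable_funX; exact: measurable_coord.
  have E2 : (fun y => polar (heat_time t) y * (expR (2 * t) * y 0 k ^+ 2)) =
    (fun y => expR (2 * t) * (polar (heat_time t) y * y 0 k ^+ 2)).
    by apply/funext => y; rewrite mulrCA.
  have D := integral_gibbs_psi phi0E mf0 f0_ge0 f0_int f0_gt0 p0 f0_moment t0 mG G0.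
  rewrite E2 in D; have {D} := D (integrableZ_real (expR (2 * t)) (ij k)).
  rewrite RintegralZl// => D; apply: etrans D.
  apply: eq_integral => y _; congr (_%:E * _)%E; rewrite mxE exprMn mulrA.
  by rewrite -expRM_natl -expRD mulrN subrr expR0 mul1r expr2.
rewrite /mxtrace /sqnorm /dot -big_split/=.
have [J1 J2] := Rintegral_sum ij.
have -> : polar_moment (heat_time t) = \sum_i \int[mu]_y (polar (heat_time t) y * y 0 i ^+ 2).
  rewrite -J2; apply: eq_Rintegral => y _; rewrite /sqnorm /dot mulr_sumr.
  by apply: eq_bigr => i _; rewrite expr2.
rewrite mulr_sumr mulr_suml; apply: eq_bigr => i _.
by rewrite mxE diag/= subrK.
Qed.

Lemma Mp_fokker_planck t : 0 < t ->
  Mp p (fokker_planck phi0 t) = (v * (v `^ p^-1 * vpolar (heat_time t)))%:E.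
Proof.
move=> t0; rewrite /Mp (V_fokker_planck phi0E mf0 f0_ge0 f0_int f0_gt0 t0).
by rewrite (V_psi phi0E mf0 f0_ge0 f0_int f0_gt0 p0 t0) vE.
Qed.

Lemma is_derive_timechange t : is_derive t 1 (@heat_time R) (2 * expR (2 * t)).
Proof.
have H : is_derive t 1 (fun t : R => 2 * t) (2 * 1) by exact: is_deriveZ.
apply: (is_derive_eq (is_deriveB (is_derive_expR_comp H) (is_derive_cst _ _ _))).
by rewrite subr0 mulr1 mulrC.
Qed.

Lemma is_derive_Mp t : 0 < t ->
  is_derive t 1 (fun s : R => fine (Mp p (fokker_planck phi0 s)))
    (v * v `^ p^-1 * expR (2 * t) / (p + 1) *
     (polar_energy (heat_time t) - p * polar_moment (heat_time t))).
Proof.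
move=> t0; have ht0 := heat_time_gt0 t0.
have H1 := is_derive_int_polar mf0 f0_ge0 f0_int f0_gt0 p0 ht0.
rewrite (int_dpolar mf0 f0_ge0 f0_int f0_gt0 p0 ht0) in H1.
have H2 := is_derive1_comp H1 (is_derive_timechange t).
have H3 := is_deriveZ (v * v `^ p^-1) H2.
apply: (@near_eq_is_derive _ _ _ (fun s : R => (v * v `^ p^-1) * vpolar (heat_time s))).
  near=> s; rewrite Mp_fokker_planck ?mulrA//; near: s; exact: lt_nbhsr.
apply: (is_derive_eq H3).
have p1 : 0 < p + 1 by rewrite addr_gt0.
rewrite -/(polar_energy _) -/(polar_moment _) /GRing.scale/=.
move: v (v `^ _) (expR _) (polar_energy _) (polar_moment _) => e a b c d.
by field; rewrite (gt_eqF p1).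
Unshelve. all: by end_near. Qed.

Lemma entropy_identity t : 0 < t ->
  let phi := fokker_planck phi0 in
  let J := (\int[mu]_(y in [set y | psi t y < +oo])
              (fisher (tilted p (phi t) y) * gibbs (psi t) y))%E in
  [/\ pos_finite_V (phi t), pos_finite_V (psi t), finite_second_moment (psi t),
      (J < +oo)%E &
      is_derive t 1 (fun s : R => fine (Mp p (phi s)))
        (p * fine (Mp p (phi t)) / (p + 1) *
         (p^-1 * fine J - \tr (Cov (psi t)) - sqnorm (barycenter (psi t))))].
Proof.
move=> t0 phi J; have ht0 := heat_time_gt0 t0.
have F0 := vpolar_gt0 mf0 f0_ge0 f0_int f0_gt0 p0 f0_moment ht0.
have VE := V_fokker_planck phi0E mf0 f0_ge0 f0_int f0_gt0 t0.
have PE := V_psi phi0E mf0 f0_ge0 f0_int f0_gt0 p0 t0.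
have JE : J = _ := fisher_integral t0.
split.
- by rewrite /pos_finite_V /phi VE vE; split; rewrite ?lte_fin ?ltry.
- by rewrite /pos_finite_V PE; split; rewrite ?ltry// lte_fin mulr_gt0// powR_gt0.
- by rewrite /finite_second_moment second_moment// ltry.
- by rewrite JE ltry.
apply: (is_derive_eq (is_derive_Mp t0)).
rewrite -addrA -opprD trace_cov// JE /phi Mp_fokker_planck//=.
have p1 : 0 < p + 1 by rewrite addr_gt0.
move: v (v `^ _) (expR _) (polar_energy _) (polar_moment _) (vpolar _) F0 => e a b c d w w0.
by field; rewrite (gt_eqF p1) (gt_eqF p0) (gt_eqF w0).
Qed.

End entropy_identity.

(** * The theorem *)

Theorem lemma6p8 (R : realType) (n : nat) (p : R)
    (phi0 : 'rV[R]_n -> \bar R) :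
  0 < p -> Cvx phi0 ->
  forall t : R, 0 < t ->
  let phi := fokker_planck phi0 in
  let psi := lp_legendre p (phi t) in
  let J := (\int[lebesgue_rV n]_(y in [set y | psi y < +oo])
              (fisher (tilted p (phi t) y) * gibbs psi y))%E in
  [/\ pos_finite_V (phi t), pos_finite_V psi, finite_second_moment psi,
      (J < +oo)%E &
      is_derive t 1 (fun s : R => fine (Mp p (phi s)))
        (p * fine (Mp p (phi t)) / (p + 1) *
         (p^-1 * fine J - \tr (Cov psi) - sqnorm (barycenter psi)))].
Proof.
move=> p0 [[phiN _] phi_conv lsc phiV] t t0.
have mphi := lsc_measurable_rV lsc.
apply: (entropy_identity (boltzE phiN) (measurable_boltz phiN mphi) (boltz_ge0 phi0)
  (boltz_integrable phiN mphi phiV) (boltz_int_gt0 phiN phiV) p0) t0.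
exact: boltz_exp_moment phiN phi_conv mphi phiV.
Qed.
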